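(* Let $\frac12<\alpha<1$ and let $f:\mathbb R\times\mathbb R\to\mathbb R$ be continuous; put $F(t,\xi)=\int_0^\xi f(t,\sigma)\,d\sigma$. Assume: $(f_0)$ $f(t,\xi)\ge 0$ if $\xi\ge 0$ and $f(t,\xi)=0$ if $\xi\le 0$, for all $t\in\mathbb R$; $(f_1)$ there exists $\theta>2$ such that $0<\theta F(t,\xi)\le \xi f(t,\xi)$ for all $t\in\mathbb R$ and $\xi>0$; $(f_2)$ $f(t,\xi)=o(|\xi|)$ as $\xi\to 0$, uniformly in $t\in\mathbb R$; $(f_3)$ $\lim_{|\xi|\to\infty}\frac{f(t,\xi)}{|\xi|^{p_0}}=0$ uniformly in $t\in\mathbb R$, for some $p_0$ with $p_0+1>\theta$; $(f_4)$ for every $t\in\mathbb R$ and $\xi>0$ the function $\sigma\mapsto\frac{f(t,\sigma\xi)\,\xi}{\sigma}$ is (strictly) increasing on $(0,\infty)$; $(f_5)$ there exist continuous functions $\overline f:\mathbb R\to\mathbb R$ and $a:\mathbb R\to\mathbb R$ such that $\overline f$ (viewed as a function of $(t,\xi)$ independent of $t$) satisfies $(f_0)$–$(f_4)$, $$0\le f(t,\xi)-\overline f(\xi)\le a(t)\,(|\xi|+|\xi|^{p_0})\quad\text{for all } t,\xi\in\mathbb R,\qquad \lim_{|t|\to\infty}a(t)=0,$$ and the set $\{t\in\mathbb R:\ f(t,\xi)>\overline f(\xi)\text{ for all }\xi>0\}$ has positive Lebesgue measure. Then the equation $$ {}_tD_\infty^\alpha\,{}_{-\infty}D_t^\alpha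 u(t)+u(t)=f(t,u(t)),\qquad t\in\mathbb R,\quad u\in H^\alpha(\mathbb R), $$ possesses at least one nontrivial weak solution, i.e. there is $u\in H^\alpha(\mathbb R)$, $u\ne0$, such that $$ \int_{\mathbb R}\big[{}_{-\infty}D_t^\alpha u(t)\,{}_{-\infty}D_t^\alpha v(t)+u(t)v(t)\big]dt=\int_{\mathbb R}f(t,u(t))v(t)\,dt\quad\text{for all } v\in H^\alpha(\mathbb R). $$
   Context: All functions are real valued. The Fourier transform is $\widehat u(w)=\int_{\mathbb R}e^{-ixw}u(x)\,dx$. $H^\alpha(\mathbb R)$ is the completion of $C_0^\infty(\mathbb R)$ under the norm $\|u\|_\alpha=(\|u\|_{L^2}^2+\||w|^\alpha\widehat u\|_{L^2}^2)^{1/2}$. It coincides, with equivalent norms, with the completion of $C_0^\infty(\mathbb R)$ under $(\|u\|_{L^2}^2+\|{}_{-\infty}D_x^\alpha u\|_{L^2}^2)^{1/2}$. For $0<\alpha<1$ the Liouville-Weyl fractional derivatives are $${}_{-\infty}D_x^\alpha u(x)=\frac{d}{dx}\,\frac{1}{\Gamma(1-\alpha)}\int_{-\infty}^x(x-\xi)^{-\alpha}u(\xi)\,d\xi,\qquad {}_xD_\infty^\alpha u(x)=-\frac{d}{dx}\,\frac{1}{\Gamma(1-\alpha)}\int_x^\infty(\xi-x)^{-\alpha}u(\xi)\,d\xi.$$ Their Fourier transforms are $(iw)^\alpha\widehat u(w)$ and $(-iw)^\alpha\widehat u(w)$ respectively, with $(\pm iw)^\alpha=|w|^\alpha e^{\pm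 i\pi\alpha\,\mathrm{sgn}(w)/2}$. On $H^\alpha(\mathbb R)$ they are understood through these Fourier multipliers, and so map $H^\alpha(\mathbb R)$ into $L^2(\mathbb R)$. In $(f_5)$ the function $\overline f$ satisfies $(f_0)$–$(f_4)$ with the same constants $\theta$ and $p_0$ as $f$. *)

(* Defs.v *)
From HB Require Import structures.
From mathcomp Require Import all_boot all_order all_algebra.
From mathcomp Require Import all_classical all_reals all_analysis.
From mathcomp Require Import complex.

Set Implicit Arguments.
Unset Strict Implicit.
Unset Printing Implicit Defensive.

Import Order.TTheory GRing.Theory Num.Theory.
Import numFieldNormedType.Exports.

Local Open Scope classical_set_scope.
Local Open Scope ring_scope.
Local Open Scope complex_scope.

Notation leb R := (@lebesgue_measure R).

(** Elements of L^2 and H^alpha are represented by functions R -> R; all the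
    notions below are invariant under measurable a.e. modification. *)

Definition L2 {R : realType} (u : R -> R) : Prop := u \in Lfun (leb R) 2%:E.

Definition L2norm {R : realType} (u : R -> R) : \bar R :=
  'N[leb R]_2%:E[EFin \o u].

Definition L2C {R : realType} (U : R -> R[i]) : Prop :=
  L2 (fun w => complex.Re (U w)) /\ L2 (fun w => complex.Im (U w)).

Definition L2Cnorm {R : realType} (U : R -> R[i]) : \bar R :=
  L2norm (fun w => Normc.normc (U w)).

Definition expi {R : realType} (x : R) : R[i] := cos x +i* sin x.

Definition Cintegral {R : realType} (U : R -> R[i]) : R[i] :=
  Rintegral (leb R) setT (fun x => complex.Re (U x)) +i*
  Rintegral (leb R) setT (fun x => complex.Im (U x)).

Definition fourier {R : realType} (u : R -> R) (w : R) : R[i] :=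
  Cintegral (fun x => expi (- (x * w)) * (u x)%:C).

Definition test_function {R : realType} (phi : R -> R) : Prop :=
  (forall n x, derivable (derive1n n phi) x 1) /\
  compact (closure [set x | phi x != 0]).

(** The Fourier transform on L^2, as the closure in L^2 x L^2 of the graph of
    the integral transform on test functions (Plancherel extension). *)
Definition is_fourierL2 {R : realType} (u : R -> R) (U : R -> R[i]) : Prop :=
  [/\ L2 u, L2C U & exists phi : nat -> R -> R,
    [/\ forall n, test_function (phi n),
        L2norm (fun x => phi n x - u x) @[n --> \oo] --> 0%E &
        L2Cnorm (fun w => fourier (phi n) w - U w) @[n --> \oo] --> 0%E]].

(** [Halpha_norm] is only used on test functions, where [fourier] is given by
    an absolutely convergent integral. *)
Definition Halpha_norm {R : realType} (alpha : R) (phi : R -> R) : \bar R :=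
  (((L2norm phi) `^ 2 +
    (L2Cnorm (fun w => (`|w| `^ alpha)%:C * fourier phi w)%R) `^ 2)
   `^ (2^-1)%R)%E.

(** The completion of the test functions, realized inside L^2: u is the L^2
    limit of a Cauchy sequence for [Halpha_norm]. *)
Definition Halpha {R : realType} (alpha : R) (u : R -> R) : Prop :=
  L2 u /\ exists phi : nat -> R -> R,
    [/\ forall n, test_function (phi n),
        forall eps : R, 0 < eps -> exists N : nat, forall m n : nat,
          (N <= m)%N -> (N <= n)%N ->
          (Halpha_norm alpha (fun x => (phi m x - phi n x)%R) < eps%:E)%E &
        L2norm (fun x => phi n x - u x) @[n --> \oo] --> 0%E].

(** (i w)^alpha = |w|^alpha exp (i pi alpha sgn(w) / 2) *)
Definition iw_pow {R : realType} (alpha w : R) : R[i] :=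
  (`|w| `^ alpha)%:C * expi (pi * alpha * Num.sg w / 2).

Definition is_LWderive {R : realType} (alpha : R) (u g : R -> R) : Prop :=
  exists2 U : R -> R[i], is_fourierL2 u U &
    is_fourierL2 g (fun w => iw_pow alpha w * U w).

(** Left Liouville-Weyl derivative of order alpha, as a Fourier multiplier;
    [is_LWderive] determines it almost everywhere, and the default value 0 is
    only taken outside H^alpha. *)
Definition LWderive {R : realType} (alpha : R) (u : R -> R) : R -> R :=
  xget (fun=> 0) [set g | is_LWderive alpha u g].

(** The oriented integral of f(t, .) from 0 to xi. *)
Definition primitive {R : realType} (f : R -> R -> R) (t xi : R) : R :=
  if 0 <= xi then Rintegral (leb R) `[0, xi] (f t)
  else - Rintegral (leb R) `[xi, 0] (f t).

Definition cond_f0 {R : realType} (f : R -> R -> R) : Prop :=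
  forall t xi, (0 <= xi -> 0 <= f t xi) /\ (xi <= 0 -> f t xi = 0).

Definition cond_f1 {R : realType} (theta : R) (f : R -> R -> R) : Prop :=
  forall t xi, 0 < xi ->
    0 < theta * primitive f t xi /\ theta * primitive f t xi <= xi * f t xi.

Definition cond_f2 {R : realType} (f : R -> R -> R) : Prop :=
  forall eps : R, 0 < eps -> exists2 delta : R, 0 < delta &
    forall t xi, `|xi| < delta -> `|f t xi| <= eps * `|xi|.

Definition cond_f3 {R : realType} (p0 : R) (f : R -> R -> R) : Prop :=
  forall eps : R, 0 < eps -> exists2 M : R, 0 < M &
    forall t xi, M < `|xi| -> `|f t xi / (`|xi| `^ p0)| < eps.

Definition cond_f4 {R : realType} (f : R -> R -> R) : Prop :=
  forall t xi, 0 < xi -> forall s1 s2 : R, 0 < s1 -> s1 < s2 ->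
    f t (s1 * xi) * xi / s1 < f t (s2 * xi) * xi / s2.

Definition cond_f04 {R : realType} (theta p0 : R) (f : R -> R -> R) : Prop :=
  [/\ cond_f0 f, cond_f1 theta f, cond_f2 f, cond_f3 p0 f & cond_f4 f].

Definition cond_f5 {R : realType} (theta p0 : R) (f : R -> R -> R) : Prop :=
  exists fbar a : R -> R,
    [/\ continuous fbar /\ continuous a,
        cond_f04 theta p0 (fun _ xi => fbar xi),
        forall t xi, 0 <= f t xi - fbar xi /\
          f t xi - fbar xi <= a t * (`|xi| + `|xi| `^ p0),
        (a t @[t --> +oo] --> 0) /\ (a t @[t --> -oo] --> 0) &
        (0 < leb R [set t | forall xi, (0 < xi)%R -> (fbar xi < f t xi)%R])%E].

(** Integrability of both sides is part of the identity, since [Rintegral] is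
    total. *)
Definition weak_solution {R : realType} (alpha : R) (f : R -> R -> R)
    (u : R -> R) : Prop :=
  Halpha alpha u /\ forall v : R -> R, Halpha alpha v ->
    let lhs t := LWderive alpha u t * LWderive alpha v t + u t * v t in
    let rhs t := f t (u t) * v t in
    [/\ (leb R).-integrable setT (EFin \o lhs),
        (leb R).-integrable setT (EFin \o rhs) &
        Rintegral (leb R) setT lhs = Rintegral (leb R) setT rhs].

(* Main.v *)
Require Import Defs.
From HB Require Import structures.
From mathcomp Require Import all_boot all_order all_algebra.
From mathcomp Require Import all_classical all_reals all_analysis.
From mathcomp Require Import complex.
From mathcomp Require Import measurable_realfun.
From mathcomp Require Import ring lra.

(** The equation is the Euler-Lagrange equation of the energy
    I(u) = n(u)/2 - int F(t, u), where n(u) is the squared norm of u plus that of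
    its fractional derivative, and a solution is found as a minimizer of I on the
    Nehari set of the u, positive somewhere, with D(u) = n(u) - int f(t, u)u = 0.

    The function space. Since alpha > 1/2, the weight 1/(1 + |w|^(2 alpha)) is
    integrable, so that the Cauchy-Schwarz inequality and Fourier inversion bound
    the values and the moduli of continuity of test functions by their energy
    ([test_sup], [test_equi]). The completion is therefore realized by continuous
    functions ([Hs], compared with [Halpha] in [Hs_Halpha] and [Halpha_Hs]), and a
    bounded sequence has a pointwise convergent subsequence ([subseq_ptw]), which
    also converges weakly ([weak_limit]). All functions are real, so the Fourier
    analysis is done with the Hartley transform, whose Plancherel identity and
    inversion formula come from the Poisson kernel ([plancherel], [hartley_inv]);
    the fractional derivative is a closed operator ([isLW_closed]) and is computed
    on test functions ([mult_test]).

    The nonlinearity enters through three consequences of the hypotheses. As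
    f(t, y)/y increases, I(su) <= I(u) for s >= 0 if D(u) = 0 ([energy_max]), and
    each ray through a function that is positive somewhere meets the Nehari set
    ([nehari_ray]). The condition with theta > 2 makes I coercive on the Nehari set
    ([energy_coercive]). Finally F(t, a + b) differs from F(t, a) + F(t, b) by at
    most a multiple of |ab| for bounded a and b ([F_split]); so, if u_n = u + v_n
    with v_n -> 0 pointwise and bounded, I(u_n) splits up to a null sequence into
    I(u) and the energy of v_n for the limit nonlinearity ([energy_split]).

    Existence of a minimizer. If the limit u of a minimizing sequence is positive
    somewhere and the infimum c is at most the infimum at infinity, then the
    splitting shows that the point of the Nehari set on the ray through u is a
    minimizer ([nehari_limit]). For the limit nonlinearity, which does not depend
    on t, translations ensure that u is positive at 0 ([ground_state]). Comparing
    f with the limit nonlinearity, which lies below it, the ground state at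
    infinity dilated to the Nehari set of f shows that c is at most the infimum at
    infinity; if u is positive nowhere the two are equal ([level_at_infinity]) and
    this dilation is itself a minimizer ([nehari_minimizer]).

    A minimizer w is a critical point: for small e there are s near 1 with
    s(w + e phi) on the Nehari set, and I(sw) <= I(w) <= I(s(w + e phi)) gives a
    one-sided inequality for the derivative of I at w in the direction phi
    ([critical_half]), hence equality on replacing phi by - phi. *)

Set Implicit Arguments.
Unset Strict Implicit.
Unset Printing Implicit Defensive.

Import Order.TTheory GRing.Theory Num.Theory.
Import numFieldNormedType.Exports.

Local Open Scope classical_set_scope.
Local Open Scope ring_scope.

(** * Integration over the line *)

Definition ig {R : realType} (f : R -> R) : Prop :=
  (leb R).-integrable setT (EFin \o f).

Definition IR {R : realType} (f : R -> R) : R := Rintegral (leb R) setT f.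

Notation meas := (measurable_fun setT).

Section toolbox.
Context {R : realType}.
Implicit Types f g h : R -> R.

Lemma ig_meas f : ig f -> meas f.
Proof. by move=> /measurable_int/measurable_EFinP. Qed.

Lemma ig_le {f} g : meas f -> ig g -> (forall x, `|f x| <= g x) -> ig f.
Proof.
move=> mf gi fg; apply: (le_integrable _ _ _ gi) => //.
  exact/measurable_EFinP.
by move=> x _ /=; rewrite lee_fin (le_trans (fg x))// ler_norm.
Qed.

Lemma ig_ext f g : f =1 g -> ig f -> ig g.
Proof. by move=> /funext ->. Qed.

Lemma igD f g : ig f -> ig g -> ig (fun x => f x + g x).
Proof. by move=> fi gi; apply: (integrableD _ fi gi). Qed.

Lemma igB f g : ig f -> ig g -> ig (fun x => f x - g x).
Proof. by move=> fi gi; apply: (integrableB _ fi gi). Qed.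

Lemma igZ c f : ig f -> ig (fun x => c * f x).
Proof. by move=> fi; apply: (integrableZl _ c fi). Qed.

Lemma igZr c f : ig f -> ig (fun x => f x * c).
Proof. by move=> fi; apply: (integrableZr _ c fi). Qed.

Lemma ig_abs f : ig f -> ig (fun x => `|f x|).
Proof. by move=> fi; apply: (integrable_abse fi). Qed.

Lemma ig0 : ig (fun _ : R => 0).
Proof. exact: integrable0. Qed.

Lemma ID f g : ig f -> ig g -> IR (fun x => f x + g x) = IR f + IR g.
Proof. by move=> fi gi; rewrite /IR RintegralD. Qed.

Lemma IB f g : ig f -> ig g -> IR (fun x => f x - g x) = IR f - IR g.
Proof. by move=> fi gi; rewrite /IR RintegralB. Qed.

Lemma IZ c f : ig f -> IR (fun x => c * f x) = c * IR f.
Proof. by move=> fi; rewrite /IR RintegralZl. Qed.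

Lemma IZr c f : ig f -> IR (fun x => f x * c) = IR f * c.
Proof. by move=> fi; rewrite /IR RintegralZr. Qed.

Lemma IN f : ig f -> IR (fun x => - f x) = - IR f.
Proof.
by move=> fi; rewrite -mulN1r -IZ//; congr IR; apply/funext => x; rewrite mulN1r.
Qed.

Lemma I0 : IR (fun _ : R => 0) = 0 :> R.
Proof. by rewrite /IR /Rintegral integral0. Qed.

Lemma I_ge0 f : (forall x, 0 <= f x) -> 0 <= IR f.
Proof. by move=> f0; apply: Rintegral_ge0. Qed.

Lemma I_le f g : ig f -> ig g -> (forall x, f x <= g x) -> IR f <= IR g.
Proof. by move=> fi gi fg; apply: le_Rintegral. Qed.

Lemma I_abs f : ig f -> `|IR f| <= IR (fun x => `|f x|).
Proof. by move=> fi; apply: le_normr_Rintegral. Qed.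

Lemma I_abs_le f g : ig f -> ig g -> (forall x, `|f x| <= g x) ->
  `|IR f| <= IR g.
Proof.
move=> fi gi fg; have h := I_abs fi; apply: le_trans h _; apply: I_le => //.
exact: ig_abs.
Qed.

Lemma I_ext f g : f =1 g -> IR f = IR g.
Proof. by move=> /funext ->. Qed.

Lemma IRE f : ig f -> (IR f)%:E = (\int[leb R]_x (f x)%:E)%E.
Proof. by move=> fi; rewrite /IR /Rintegral fineK//; exact: integrable_fin_num. Qed.

Lemma aeS (P Q : R -> Prop) : (forall x, P x -> Q x) ->
  {ae leb R, forall x, P x} -> {ae leb R, forall x, Q x}.
Proof.
move=> PQ [N [mN N0 sub]]; exists N; split => // x nQ; apply: sub => /= Px.
exact/nQ/PQ.
Qed.

Lemma aeS2 (P Q S : R -> Prop) : (forall x, P x -> Q x -> S x) ->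
  {ae leb R, forall x, P x} -> {ae leb R, forall x, Q x} ->
  {ae leb R, forall x, S x}.
Proof.
move=> PQS [N [mN N0 sub]] [M [mM M0 subM]]; exists (N `|` M); split => //.
- exact: measurableU.
- by rewrite null_set_setU.
- move=> x /= nS; apply: contrapT => /not_orP[nN nM]; apply: nS.
  by apply: PQS; apply: contrapT => h; [exact/nN/sub|exact/nM/subM].
Qed.

Lemma aeT (P : R -> Prop) : (forall x, P x) -> {ae leb R, forall x, P x}.
Proof.
by move=> PT; apply: aeW.
Qed.

Lemma DCT (h_ : nat -> R -> R) h G :
  (forall n, meas (h_ n)) -> meas h ->
  {ae leb R, forall x, h_ ^~ x @ \oo --> h x} -> ig G ->
  (forall n x, `|h_ n x| <= G x) ->
  ig h /\ (IR (h_ n) @[n --> \oo] --> IR h).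
Proof.
move=> mh_ mh hh Gi hG.
have [||||| hi _ cv] := @dominated_convergence _ _ R (leb R) setT measurableT
  (fun n => EFin \o h_ n) (EFin \o h) (EFin \o G).
- by move=> n /=; apply/measurable_EFinP; exact: mh_.
- exact/measurable_EFinP.
- apply: aeS hh => x hx _; apply: cvg_EFin => //; exact: nearW.
- exact: Gi.
- by apply: aeT => x n _ /=; rewrite lee_fin.
split => //.
have hni n : ig (h_ n) by apply: (ig_le (mh_ n) Gi).
have /= := cv; rewrite -IRE//.
under eq_cvg do rewrite -IRE//.
by move=> /fine_cvgP[].
Qed.

(** Convergence at every point makes the limit measurable. *)
Lemma DCTe (h_ : nat -> R -> R) h G :
  (forall n, meas (h_ n)) ->
  (forall x, h_ ^~ x @ \oo --> h x) -> ig G ->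
  (forall n x, `|h_ n x| <= G x) ->
  ig h /\ (IR (h_ n) @[n --> \oo] --> IR h).
Proof.
move=> mh_ hh; apply: DCT => //; last exact: aeT.
by apply: (measurable_fun_cvg mh_) => x _; exact: hh.
Qed.

(** A bound on the integrals of the approximations is turned into integrability
    of the limit; the square integrability of limits is obtained this way. *)
Lemma fatouR (h_ : nat -> R -> R) h (B : R) :
  (forall n, ig (h_ n)) -> (forall n x, 0 <= h_ n x) -> meas h ->
  (forall x, 0 <= h x) -> {ae leb R, forall x, h_ ^~ x @ \oo --> h x} ->
  (forall n, IR (h_ n) <= B) -> ig h /\ IR h <= B.
Proof.
move=> hi h0 mh hp hh hB.
have le1 : (\int[leb R]_x (h x)%:E <= B%:E)%E.
  have F := @fatou _ _ R (leb R) setT measurableT (fun n => EFin \o h_ n)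
    (fun n => measurable_int _ (hi n)) (fun n x _ => h0 n x).
  have -> : (\int[leb R]_x (h x)%:E =
      \int[leb R]_x limn_einf (fun n => (h_ n x)%:E))%E.
    apply: ae_eq_integral => //.
    - exact/measurable_EFinP.
    - rewrite [X in measurable_fun _ X](_ : _ =
        fun x => - limn_esup (-%E \o (fun n => (h_ n x)%:E)))%E; last first.
        by apply/funext => x; rewrite limn_esupN oppeK.
      apply: measurableT_comp => //.
      apply: (measurable_fun_limn_esup (f := fun n x => - (h_ n x)%:E)%E) => n.
      by apply: measurableT_comp => //; exact: (measurable_int _ (hi n)).
    - apply: aeS hh => x hx _; apply/esym.
      have hx' : (h_ n x)%:E @[n --> \oo] --> (h x)%:E.
        by apply: cvg_EFin => //; exact: nearW.
      rewrite is_cvg_limn_einfE; first exact/cvg_lim.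
      by apply/cvg_ex; exists (h x)%:E.
  apply: (le_trans F) => /=.
  rewrite limn_einf_lim; apply: lime_le; first exact: is_cvg_einfs.
  apply: nearW => n; apply: (@le_trans _ _ (IR (h_ n))%:E); last by rewrite lee_fin.
  rewrite IRE//; apply: ereal_inf_lbound; exists n => //=.
have hig : ig h.
  apply/integrableP; split; first exact/measurable_EFinP.
  under eq_integral do rewrite /= ger0_norm//.
  by apply: le_lt_trans le1 _; rewrite ltry.
by split => //; rewrite -lee_fin IRE.
Qed.

Lemma ig_ae f g : meas g -> {ae leb R, forall x, f x = g x} -> ig f -> ig g.
Proof.
move=> mg fg fi; have mf := ig_meas fi.
have mfE : meas (EFin \o f) by exact/measurable_EFinP.
have mgE : meas (EFin \o g) by exact/measurable_EFinP.
apply/integrableP; split => //; have /integrableP[_] := fi.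
apply: le_lt_trans; rewrite le_eqVlt; apply/orP; left; apply/eqP.
apply: ae_eq_integral => //; [exact: measurableT_comp|exact: measurableT_comp|].
by apply: aeS fg => x fgx _ /=; rewrite fgx.
Qed.

Lemma I_ae f g : meas f -> meas g -> {ae leb R, forall x, f x = g x} ->
  IR f = IR g.
Proof.
move=> mf mg fg; rewrite /IR /Rintegral; congr fine.
apply: ae_eq_integral => //; [exact/measurable_EFinP|exact/measurable_EFinP|].
by apply: aeS fg => x fgx _ /=; rewrite fgx.
Qed.

Lemma I_eq0 f : ig f -> (forall x, 0 <= f x) -> IR f = 0 ->
  {ae leb R, forall x, f x = 0}.
Proof.
move=> fi f0 If; have mf := ig_meas fi.
have /ae_eq_integral_abs : (\int[leb R]_(x in setT) `|(f x)%:E| = 0)%E.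
  under eq_integral do rewrite gee0_abs ?lee_fin//.
  by rewrite -IRE// If.
move=> /(_ measurableT)/= H; have {}H := H (proj2 (measurable_EFinP _ _) mf).
by apply: aeS H => x /(_ I)/= [].
Qed.

(** By uniqueness of the Lebesgue measure: the scaled image measure has the same
    value on half-open intervals. *)
Let affine_leb (a b : R) (b0 : b != 0) (A : set (measurableTypeR R)) :
  measurable A ->
  (leb R A = (`|b|)%:E * leb R ((fun x => (a + b * x)%R) @^-1` A))%E.
Proof.
move=> mA.
have mphi : measurable_fun [set: measurableTypeR R]
    (fun x : measurableTypeR R => a + b * x : measurableTypeR R).
  apply: measurable_funD; first exact: measurable_cst.
  by apply: measurable_funM; [exact: measurable_cst|exact: measurable_id].
pose k : {nonneg R} := NngNum (normr_ge0 b).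
pose nu := mscale k
  (measure_function_pushforward__canonical__measure_function_Measure
    (leb R) mphi).
rewrite (@lebesgue_measure_unique _ nu)// => _ [[c d] _ <-].
change (leb R `]c, d]%classic =
  (`|b|)%:E * leb R ((fun x => (a + b * x)%R) @^-1` `]c, d]%classic))%E.
have bn : 0 < `|b| by rewrite normr_gt0.
have eqi p q bp bq : leb R [set` Interval (BSide bp p) (BSide bq q)] =
   (Num.max 0 (q - p))%:E.
  rewrite lebesgue_measure_itv/= lte_fin; case: ltP => cd.
    by rewrite -EFinB max_r// subr_ge0 ltW.
  by rewrite max_l// subr_le0.
rewrite eqi; have [bp|bp] := ltP 0 b.
  rewrite (_ : _ @^-1` _ = [set` `](c - a) / b, (d - a) / b]]); last first.
    apply/seteqP; split => x /=; rewrite !in_itv/= ltr_pdivrMr// ler_pdivlMr//;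
    rewrite (mulrC x) ltrBlDl lerBrDl; done.
  rewrite eqi -mulrBl opprB addrA subrK -EFinM maxr_pMr ?normr_ge0//.
  by rewrite mulr0 gtr0_norm// mulrC divfK// gt_eqF.
have bm : b < 0 by rewrite lt_neqAle b0.
rewrite (_ : _ @^-1` _ = [set` `[(d - a) / b, (c - a) / b[]); last first.
  apply/seteqP; split => x /=; rewrite !in_itv/= ltr_ndivlMr// ler_ndivrMr//;
  rewrite (mulrC x) ltrBlDl lerBrDl andbC; done.
rewrite eqi -mulrBl opprB addrA subrK -EFinM maxr_pMr ?normr_ge0//.
rewrite mulr0 ltr0_norm// mulNr mulrC divfK// ?opprB//.
Qed.

Lemma affine_ge0 (a b : R) (f : R -> R) : b != 0 -> meas f ->
  (forall x, 0 <= f x) -> ig f ->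
  ig (fun x => f (a + b * x)) /\ IR (fun x => f (a + b * x)) = IR f / `|b|.
Proof.
move=> b0 mf f0 fi.
have mphi : measurable_fun [set: measurableTypeR R]
    (fun x : measurableTypeR R => a + b * x : measurableTypeR R).
  apply: measurable_funD; first exact: measurable_cst.
  by apply: measurable_funM; [exact: measurable_cst|exact: measurable_id].
pose k : {nonneg R} := NngNum (normr_ge0 b).
have mfe : meas (EFin \o f) by exact/measurable_EFinP.
have mg : meas (fun x => f (a + b * x)) by apply: measurableT_comp mphi.
have e : (\int[leb R]_x (f x)%:E =
    (`|b|)%:E * \int[leb R]_x (f (a + b * x)%R)%:E)%E.
  transitivity (\int[mscale k
    (measure_function_pushforward__canonical__measure_function_Measure
    (leb R) mphi)]_x (f x)%:E)%E.
    by apply: eq_measure_integral => A mA _ /=; exact: affine_leb.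
  rewrite ge0_integral_mscale//=; last by move=> x _; rewrite lee_fin.
  by rewrite ge0_integral_pushforward// => x _; rewrite lee_fin.
have bn : 0 < `|b| by rewrite normr_gt0.
have fin : (\int[leb R]_x (f (a + b * x)%R)%:E = (IR f / `|b|)%:E)%E.
  have := IRE fi; rewrite e => /(congr1 (fun z => (`|b|^-1)%:E * z)%E).
  rewrite muleA -!EFinM mulVf ?gt_eqF// mul1e => <-.
  by rewrite mulrC.
split; last by rewrite {1}/IR /Rintegral fin.
apply/integrableP; split; first exact/measurable_EFinP.
under eq_integral do rewrite /= ger0_norm//.
by rewrite fin ltry.
Qed.

(** Reduction to non-negative integrands, where the image measure applies. *)
Lemma I_affine (a b : R) (f : R -> R) : b != 0 -> ig f ->
  ig (fun x => f (a + b * x)) /\ IR (fun x => f (a + b * x)) = IR f / `|b|.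
Proof.
move=> b0 fi.
pose fp x := 2^-1 * (`|f x| + f x); pose fm x := 2^-1 * (`|f x| - f x).
have fpi : ig fp by apply: igZ; apply: igD => //; exact: ig_abs.
have fmi : ig fm by apply: igZ; apply: igB => //; exact: ig_abs.
have fp0 x : 0 <= fp x.
  by rewrite /fp mulr_ge0// -lerBlDr sub0r -normrN ler_norm.
have fm0 x : 0 <= fm x by rewrite /fm mulr_ge0// subr_ge0 ler_norm.
have [pi pe] := affine_ge0 a b0 (ig_meas fpi) fp0 fpi.
have [mi me] := affine_ge0 a b0 (ig_meas fmi) fm0 fmi.
have E x : f x = fp x - fm x by rewrite /fp /fm; field.
have Ef : (fun x => f (a + b * x)) = (fun x => fp (a + b * x) - fm (a + b * x)).
  by apply/funext => x; rewrite E.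
have Ef' : f = (fun x => fp x - fm x) by apply/funext => x; rewrite E.
by rewrite Ef; split; [exact: igB|rewrite [in RHS]Ef' !IB// pe me mulrBl].
Qed.

Lemma I_shift (a : R) f : ig f -> IR (fun x => f (x + a)) = IR f.
Proof.
move=> fi; have [_ h] := I_affine a (oner_neq0 R) fi.
rewrite normr1 divr1 in h; rewrite -[RHS]h.
by apply: I_ext => x; rewrite mul1r addrC.
Qed.

Lemma ig_opp f : ig f -> ig (fun x => f (- x)).
Proof.
move=> fi; have b0 : (-1 : R) != 0 by rewrite oppr_eq0 oner_neq0.
have [h _] := I_affine 0 b0 fi.
by apply: ig_ext h => x; rewrite add0r mulN1r.
Qed.

Lemma I_opp f : ig f -> IR (fun x => f (- x)) = IR f.
Proof.
move=> fi; have b0 : (-1 : R) != 0 by rewrite oppr_eq0 oner_neq0.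
have [_ h] := I_affine 0 b0 fi.
rewrite normrN normr1 divr1 in h; rewrite -[RHS]h.
by apply: I_ext => x; rewrite add0r mulN1r.
Qed.

Lemma I_odd f : ig f -> (forall x, f (- x) = - f x) -> IR f = 0.
Proof.
move=> fi fo; have := I_opp fi; have := IN fi.
have -> : IR (fun x => f (- x)) = IR (fun x => - f x) by apply: I_ext.
by move=> -> h; lra.
Qed.

(** Domination by a product makes the double integral absolutely convergent. *)
Lemma fubiniR (h : R -> R -> R) a b :
  measurable_fun [set: R * R] (fun z : R * R => h z.1 z.2) -> ig a -> ig b ->
  (forall x y, `|h x y| <= a x * b y) ->
  [/\ ig (fun x => IR (h x)), ig (fun y => IR (fun x => h x y)) &
  IR (fun x => IR (h x)) = IR (fun y => IR (fun x => h x y))].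
Proof.
move=> mh ai bi hab.
have mx x : meas (h x).
  have := measurableT_comp mh (measurable_pair1 x); exact.
have my y : meas (h^~ y).
  have := measurableT_comp mh (measurable_pair2 y); exact.
have hx x : ig (h x) by apply: (ig_le _ (igZ (a x) bi)) => // y; exact: hab.
have hy y : ig (h^~ y) by apply: (ig_le _ (igZr (b y) ai)) => // x; exact: hab.
pose H := fun z : R * R => (h z.1 z.2)%:E.
have mH : measurable_fun [set: R * R] H by exact/measurable_EFinP.
have iH : (leb R \x leb R)%E.-integrable setT H.
  apply/integrable12ltyP => //.
  have : ig (fun x => a x * IR b) by exact: igZr.
  move=> /integrableP[_]; apply: le_lt_trans.
  apply: ge0_le_integral => //.
  - by move=> x _; apply: integral_ge0.
  - apply: (@measurable_fun_fubini_tonelli_F _ _ _ _ _ (leb R) (abse \o H)).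
      exact: measurableT_comp.
    by move=> z; exact: abse_ge0.
  - do 2 apply: measurableT_comp => //; apply: ig_meas; exact: igZr.
  - move=> x _; rewrite /H/=.
    have <- := IRE (ig_abs (hx x)); rewrite lee_fin.
    apply: le_trans (ler_norm _); rewrite -IZ//; apply: I_le => //.
    + exact: ig_abs.
    + exact: igZ.
have FE : (fun x => \int[leb R]_y H (x, y))%E = (fun x => (IR (h x))%:E).
  by apply/funext => x; rewrite IRE.
have GE : (fun y => \int[leb R]_x H (x, y))%E = (fun y => (IR (h^~ y))%:E).
  by apply/funext => x; rewrite IRE.
have iF : ig (fun x => IR (h x)).
  by have := integrable_fubini_F iH; rewrite /fubini_F FE.
have iG : ig (fun y => IR (h^~ y)).
  apply: (ig_le _ (igZ (IR a) bi)) => [|y].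
    by have := measurable_fubini_G iH; rewrite /fubini_G GE => /measurable_EFinP.
  by rewrite -IZr//; apply: I_abs_le => //; exact: igZr.
split => //.
have := Fubini iH; rewrite FE GE -(IRE iF) -(IRE iG) => -[]; exact.
Qed.

End toolbox.

(** * Square-integrable functions *)

Lemma sqr_normr {R : realType} (x : R) : `|x| ^+ 2 = x ^+ 2.
Proof. by rewrite real_normK// num_real. Qed.

(** The discriminant of a non-negative quadratic polynomial is not positive; the
    degenerate case C = 0 is covered. *)
Lemma quad_disc {R : realType} (A B C : R) :
  (forall t, 0 <= A + 2 * t * B + t ^+ 2 * C) -> B ^+ 2 <= A * C.
Proof.
move=> h.
have A0 : 0 <= A by have := h 0; rewrite mulr0 mul0r expr0n mul0r !addr0.
have C0 : 0 <= C.
  rewrite leNgt; apply/negP => C0.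
  have := h ((B + Num.sqrt (B ^+ 2 - (A + 1) * C)) / - C).
  have q0 : 0 <= B ^+ 2 - (A + 1) * C.
    by rewrite addr_ge0 ?sqr_ge0// oppr_ge0 pmulr_rle0 ?ltW// ltr_wpDl.
  have := sqr_sqrtr q0; set q := Num.sqrt _ => qE.
  have Cn : C != 0 by rewrite lt_eqF.
  rewrite [X in 0 <= X](_ : _ = A + (q ^+ 2 - B ^+ 2) / C); last by field.
  rewrite qE.
  rewrite [X in 0 <= X](_ : _ = -1) ?oppr_ge0 ?ler10//; by field.
have [C00|Cn] := eqVneq C 0.
  rewrite C00 mulr0; have [->|Bn] := eqVneq B 0; first by rewrite expr0n.
  have := h (- (A + 1) / (2 * B)); rewrite C00 mulr0 addr0.
  rewrite [X in 0 <= X](_ : _ = -1) ?oppr_ge0 ?ler10//; by field.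
have Cp : 0 < C by rewrite lt_neqAle eq_sym Cn.
have := h (- B / C); rewrite [X in 0 <= X](_ : _ = (A * C - B ^+ 2) / C).
  by rewrite pmulr_lge0 ?invr_gt0// subr_ge0.
by field.
Qed.

Definition sq {R : realType} (f : R -> R) : Prop :=
  meas f /\ ig (fun x => f x ^+ 2).

Definition nsq {R : realType} (f : R -> R) : R := IR (fun x => f x ^+ 2).

Section L2theory.
Context {R : realType}.
Implicit Types f g h : R -> R.

Lemma sq_L2 f : sq f <-> L2 f.
Proof.
split=> [[mf fi]|].
  rewrite /L2 inE; apply/andP; split; first by rewrite inE.
  rewrite inE /finite_norm/= unlock poweR_lty//.
  have /integrableP[_] := fi; apply: le_lt_trans.
  rewrite le_eqVlt; apply/orP; left; apply/eqP.
  by apply: eq_integral => x _ /=; rewrite powR_mulrn// normrX.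
move=> h; split; last exact: Lfun2_integrable_sqr.
by move: h; rewrite /L2 inE => /andP[]; rewrite inE.
Qed.

Lemma nsq_ge0 f : 0 <= nsq f.
Proof. by apply: I_ge0 => x; rewrite sqr_ge0. Qed.

Lemma L2normE f : sq f -> L2norm f = (Num.sqrt (nsq f))%:E.
Proof.
move=> [mf fi]; rewrite /L2norm unlock.
transitivity ((nsq f)%:E `^ 2^-1)%E; last first.
  by rewrite poweR_EFin powR12_sqrt// nsq_ge0.
rewrite /nsq IRE//; congr (_ `^ _)%E.
by apply: eq_integral => x _ /=; rewrite powR_mulrn// sqr_normr.
Qed.

Lemma sq_mul f g : sq f -> sq g -> ig (fun x => f x * g x).
Proof.
move=> [mf fi] [mg gi]; apply: (ig_le _ (igD fi gi)).
  exact: measurable_funM.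
move=> x; rewrite normrM.
have : 0 <= (`|f x| - `|g x|) ^+ 2 by rewrite sqr_ge0.
rewrite -(sqr_normr (f x)) -(sqr_normr (g x)).
have := normr_ge0 (f x); have := normr_ge0 (g x).
by move: `|f x| `|g x| => a b; nra.
Qed.

Lemma sqD f g : sq f -> sq g -> sq (fun x => f x + g x).
Proof.
move=> fs gs; have fg := sq_mul fs gs; case: fs gs => mf fi [mg gi].
split; first exact: measurable_funD.
apply: (ig_ext _ (igD (igD fi gi) (igZ 2 fg))) => x; by ring.
Qed.

Lemma sqZ c f : sq f -> sq (fun x => c * f x).
Proof.
move=> [mf fi]; split; first by apply: measurable_funM.
by apply: (ig_ext _ (igZ (c ^+ 2) fi)) => x; rewrite exprMn.
Qed.

Lemma sqN f : sq f -> sq (fun x => - f x).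
Proof.
by move=> /(sqZ (-1)); congr sq; apply/funext => x; rewrite mulN1r.
Qed.

Lemma sqB f g : sq f -> sq g -> sq (fun x => f x - g x).
Proof. by move=> fs gs; apply: sqD => //; exact: sqN. Qed.

Lemma sq0 : sq (fun _ : R => 0 : R).
Proof.
split; first exact: measurable_cst.
by apply: ig_ext ig0 => x; rewrite expr0n.
Qed.

Lemma sq_le f g : meas f -> sq g -> (forall x, `|f x| <= `|g x|) -> sq f.
Proof.
move=> mf [mg gi] fg; split => //; apply: (ig_le _ gi) => [|x].
  exact: measurable_funX.
by rewrite normrX -(sqr_normr (g x)) lerXn2r// nnegrE.
Qed.

Lemma nsqZ c f : sq f -> nsq (fun x => c * f x) = c ^+ 2 * nsq f.
Proof.
move=> [mf fi]; rewrite /nsq -IZ//; apply: I_ext => x; exact: exprMn.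
Qed.

Lemma nsqN f : nsq (fun x => - f x) = nsq f.
Proof. by apply: I_ext => x; rewrite sqrrN. Qed.

Lemma nsqBC f g : nsq (fun x => f x - g x) = nsq (fun x => g x - f x).
Proof. by apply: I_ext => x; rewrite -sqrrN opprB. Qed.

Lemma nsqD f g : sq f -> sq g ->
  nsq (fun x => f x + g x) = nsq f + 2 * IR (fun x => f x * g x) + nsq g.
Proof.
move=> fs gs; have fg := sq_mul fs gs; case: fs gs => mf fi [mg gi].
rewrite /nsq -IZ// -!ID//; [|exact: igD (igZ _ _)|exact: igZ].
by apply: I_ext => x; ring.
Qed.

Lemma nsqB f g : sq f -> sq g ->
  nsq (fun x => f x - g x) = nsq f - 2 * IR (fun x => f x * g x) + nsq g.
Proof.
move=> fs gs; have fg := sq_mul fs gs; case: fs gs => mf fi [mg gi].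
rewrite /nsq -IZ// -IB//; last exact: igZ.
rewrite -ID//; last by apply: igB => //; exact: igZ.
by apply: I_ext => x; ring.
Qed.

Lemma nsqD_le f g : sq f -> sq g ->
  nsq (fun x => f x + g x) <= 2 * nsq f + 2 * nsq g.
Proof.
move=> fs gs; have := nsqD fs gs; have := nsqB fs gs.
by have := nsq_ge0 (fun x => f x - g x); lra.
Qed.

(** Squared norms are used throughout to avoid square roots; the factor 2 is the
    price in the triangle inequality. *)
Lemma nsq_tri f g h : sq f -> sq g -> sq h ->
  nsq (fun x => f x - h x) <=
  2 * nsq (fun x => f x - g x) + 2 * nsq (fun x => g x - h x).
Proof.
move=> fs gs hs; rewrite (_ : nsq (fun x => f x - h x) =
  nsq (fun x => (f x - g x) + (g x - h x))).
  by apply: nsqD_le; exact: sqB.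
by apply: I_ext => x; rewrite addrA subrK.
Qed.

Lemma cauchy_schwarz f g : sq f -> sq g ->
  IR (fun x => f x * g x) ^+ 2 <= nsq f * nsq g.
Proof.
move=> fs gs; apply: quad_disc => t.
have := nsq_ge0 (fun x => f x + t * g x).
rewrite nsqD//; last exact: sqZ.
rewrite nsqZ//; have -> : IR (fun x => f x * (t * g x)) =
    t * IR (fun x => f x * g x).
  by rewrite -IZ; [apply: I_ext => x; ring|exact: sq_mul].
by rewrite mulrA.
Qed.

Lemma nsq_eq0 f : sq f -> nsq f = 0 -> {ae leb R, forall x, f x = 0}.
Proof.
move=> [mf fi] n0; have := I_eq0 fi (fun x => sqr_ge0 (f x)) n0.
by apply: aeS => x /eqP; rewrite sqrf_eq0 => /eqP.
Qed.

Lemma sq_ae f g : meas g -> {ae leb R, forall x, f x = g x} -> sq f -> sq g.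
Proof.
move=> mg fg [mf fi]; split => //; apply: (ig_ae _ _ fi).
  exact: measurable_funX.
by apply: aeS fg => x ->.
Qed.

Lemma nsq_ae f g : meas f -> meas g -> {ae leb R, forall x, f x = g x} ->
  nsq f = nsq g.
Proof.
move=> mf mg fg; apply: I_ae; [exact: measurable_funX|exact: measurable_funX|].
by apply: aeS fg => x ->.
Qed.

Lemma sq_comp_opp f : sq f -> sq (fun x => f (- x)).
Proof.
move=> [mf fi]; split; last exact: (ig_opp fi).
exact: (measurableT_comp mf (@oppr_measurable R setT)).
Qed.

Lemma nsq_opp f : sq f -> nsq (fun x => f (- x)) = nsq f.
Proof. by move=> [mf fi]; rewrite /nsq (I_opp fi). Qed.

End L2theory.

(** * Convergence in the mean *)

Section L2cvg.
Context {R : realType}.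
Implicit Types f g h : R -> R.

(** Convergence to 0 without filters: most limits below come out of explicit
    estimates. *)
Definition null_seq (a : nat -> R) : Prop :=
  forall e : R, 0 < e -> exists N, forall n, (N <= n)%N -> `|a n| < e.

Lemma null_seqP (a : nat -> R) : null_seq a <-> a n @[n --> \oo] --> 0.
Proof.
split=> [h|/cvgrPdist_lt h e e0].
  apply/cvgrPdist_lt => e e0; have [N hN] := h _ e0; exists N => // n /= Nn.
  by rewrite sub0r normrN hN.
have [N _ hN] := h _ e0; exists N => n Nn.
by have := hN n Nn; rewrite sub0r normrN.
Qed.

Lemma cvg_seqP (a : nat -> R) (l : R) :
  a n @[n --> \oo] --> l <->
  forall e : R, 0 < e -> exists N, forall n, (N <= n)%N -> `|a n - l| < e.
Proof.
split=> [/cvgrPdist_lt h e e0|h].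
  have [N _ hN] := h _ e0; exists N => n Nn; rewrite distrC; exact: hN.
apply/cvgrPdist_lt => e e0; have [N hN] := h _ e0; exists N => // n /= Nn.
by rewrite distrC hN.
Qed.

Lemma null_seq_le (a b : nat -> R) : (forall n, `|a n| <= b n) ->
  null_seq b -> null_seq a.
Proof.
move=> ab hb e e0; have [N hN] := hb _ e0; exists N => n Nn.
by apply: le_lt_trans (hN n Nn); apply: le_trans (ab n) (ler_norm _).
Qed.

Lemma null_seqD (a b : nat -> R) : null_seq a -> null_seq b ->
  null_seq (fun n => a n + b n).
Proof.
move=> /null_seqP ha /null_seqP hb; apply/null_seqP.
by rewrite -(addr0 0); apply: cvgD.
Qed.

Lemma null_seqZ (c : R) (a : nat -> R) : null_seq a ->
  null_seq (fun n => c * a n).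
Proof.
move=> /null_seqP ha; apply/null_seqP.
by rewrite -(mulr0 c); apply: cvgM ha; exact: cvg_cst.
Qed.

Lemma null_seq_sqr (a : nat -> R) : null_seq (fun n => a n ^+ 2) -> null_seq a.
Proof.
move=> h e e0; have [|N hN] := h (e ^+ 2); first by rewrite exprn_gt0.
exists N => n Nn; have := hN n Nn; rewrite normrX.
by rewrite ltr_pXn2r// ?nnegrE// ltW.
Qed.

Lemma null_seq_invS : null_seq (fun n => n.+1%:R^-1).
Proof. apply/null_seqP; exact: (@cvg_harmonic R). Qed.

Lemma cvg_nullP (a : nat -> R) l :
  a n @[n --> \oo] --> l <-> null_seq (fun n => a n - l).
Proof. by rewrite cvg_seqP. Qed.

Lemma nsq_null_prod (f_ : nat -> R -> R) g : (forall n, sq (f_ n)) -> sq g ->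
  null_seq (fun n => nsq (f_ n)) -> null_seq (fun n => IR (fun x => f_ n x * g x)).
Proof.
move=> fs gs h; apply: null_seq_sqr.
apply: null_seq_le (null_seqZ (nsq g) h) => n.
by rewrite ger0_norm ?sqr_ge0// mulrC cauchy_schwarz.
Qed.

Lemma L2cvg_nsq (f_ : nat -> R -> R) f : (forall n, sq (f_ n)) -> sq f ->
  null_seq (fun n => nsq (fun x => f_ n x - f x)) ->
  nsq (f_ n) @[n --> \oo] --> nsq f.
Proof.
move=> fs fs' h; apply/cvg_nullP.
have h1 := nsq_null_prod (fun n => sqB (fs n) fs') fs' h.
have := null_seqD h (null_seqZ 2 h1).
congr null_seq; apply/funext => n.
have -> : nsq (f_ n) = nsq (fun x => (f_ n x - f x) + f x).
  by apply: I_ext => x; rewrite subrK.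
by rewrite (nsqD (sqB (fs n) fs') fs'); ring.
Qed.

Lemma L2normP (f_ : nat -> R -> R) : (forall n, sq (f_ n)) ->
  (L2norm (f_ n) @[n --> \oo] --> 0%E) <-> null_seq (fun n => nsq (f_ n)).
Proof.
move=> fs; have -> : (fun n => L2norm (f_ n)) =
    (fun n => (Num.sqrt (nsq (f_ n)))%:E).
  by apply/funext => n; rewrite L2normE.
split=> [/fine_cvgP[_ /= h]|h].
  have {}h : Num.sqrt (nsq (f_ n)) @[n --> \oo] --> (0 : R) by exact: h.
  apply/null_seqP; rewrite (_ : (fun n => _) =
    (fun n => Num.sqrt (nsq (f_ n)) * Num.sqrt (nsq (f_ n)))); last first.
    by apply/funext => n; rewrite -expr2 sqr_sqrtr// nsq_ge0.
  by rewrite -(mulr0 0); apply: cvgM.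
apply: cvg_EFin; first exact: nearW.
apply/null_seqP; apply: null_seq_sqr; move: h; congr null_seq.
by apply/funext => n; rewrite sqr_sqrtr// nsq_ge0.
Qed.

(** Completeness of L^2.  Along a subsequence whose increments have squared
    norms below 8^-k, the sum of 4^k times the squared increments is
    integrable, hence finite almost everywhere, which makes the increments
    summable at almost every point. *)
Theorem riesz_fischer (f_ : nat -> R -> R) : (forall n, sq (f_ n)) ->
  (forall e : R, 0 < e -> exists N, forall m n, (N <= m)%N -> (N <= n)%N ->
    nsq (fun x => f_ m x - f_ n x) < e) ->
  exists2 f, sq f & null_seq (fun n => nsq (fun x => f_ n x - f x)).
Proof.
move=> fs fC.
have e8 k : 0 < (8^-1 : R) ^+ k by rewrite exprn_gt0// invr_gt0.
have /choice[N hN] : forall k, exists N, forall m n, (N <= m)%N -> (N <= n)%N ->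
    nsq (fun x => f_ m x - f_ n x) < (8^-1 : R) ^+ k by move=> k; exact: fC.
(* A non-decreasing sequence of indices with idx k >= N k and idx k >= k. *)
pose idx k := (\sum_(i < k.+1) (N i).+1)%N.
have idxN k : (N k <= idx k)%N.
  by rewrite /idx big_ord_recr/= (leq_trans (leqnSn _))// leq_addl.
have idxk k : (k <= idx k)%N.
  elim: k => // k IHk; rewrite /idx big_ord_recr/= -/(idx k) addnS ltnS.
  by rewrite (leq_trans IHk)// leq_addr.
have idxS k : (idx k <= idx k.+1)%N by rewrite /idx (big_ord_recr k.+1)/= leq_addr.
have idx_le : {homo idx : i j / (i <= j)%N} by apply: homo_leq leq_trans idxS.
pose d k x := f_ (idx k.+1) x - f_ (idx k) x.
have ds k : sq (d k) by exact: sqB.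
have dn k : nsq (d k) < (8^-1 : R) ^+ k.
  by apply: hN; [exact: leq_trans (idxN k) (idxS k)|exact: idxN].
pose s k x := 4 ^+ k * d k x ^+ 2.
have si k : ig (s k) by apply: igZ; exact: (ds k).2.
have s0 k x : 0 <= s k x by rewrite /s mulr_ge0 ?sqr_ge0// exprn_ge0.
have sI k : IR (s k) <= (2^-1 : R) ^+ k.
  rewrite IZ; last exact: (ds k).2.
  rewrite (_ : (2^-1 : R) ^+ k = 4 ^+ k * 8^-1 ^+ k).
    by rewrite ler_wpM2l ?exprn_ge0// ltW// dn.
  by rewrite -exprMn; congr (_ ^+ _); field.
have sumI : (\int[leb R]_x (\sum_(0 <= k <oo) (s k x)%:E) < +oo)%E.
  rewrite integral_nneseries//; last 2 first.
  - by move=> k; apply/measurable_EFinP; exact: (ig_meas (si k)).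
  - by move=> k x _; rewrite lee_fin.
  apply: (@le_lt_trans _ _ (\sum_(0 <= k <oo) ((2^-1 : R) ^+ k)%:E)%E).
    apply: lee_nneseries => k _.
      by move=> _; apply: integral_ge0 => x _; rewrite lee_fin.
    by rewrite -IRE// lee_fin.
  rewrite (_ : (fun n => _) = EFin \o series (geometric 1 (2^-1 : R))); last first.
    by apply/funext => n; rewrite /= /series/= -sumEFin; apply: eq_bigr => i _;
      rewrite mul1r.
  rewrite EFin_lim ?ltry//; apply: is_cvg_geometric_series.
  by rewrite gtr0_norm ?invr_gt0// invf_lt1// ltr1n.
have msum : meas (fun x => \sum_(0 <= k <oo) (s k x)%:E)%E.
  apply: ge0_emeasurable_sum => [k x _ _|k _]; first by rewrite lee_fin.
  by apply/measurable_EFinP; exact: (ig_meas (si k)).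
have sum_ae : {ae leb R, forall x, ((\sum_(0 <= k <oo) (s k x)%:E) < +oo)%E}.
  have : (leb R).-integrable setT (fun x => \sum_(0 <= k <oo) (s k x)%:E)%E.
    apply/integrableP; split => //; apply: le_lt_trans sumI.
    rewrite le_eqVlt; apply/orP; left; apply/eqP; apply: eq_integral => x _.
    by rewrite gee0_abs//; apply: nneseries_ge0 => k _ _; rewrite lee_fin.
  move=> /(integrable_ae measurableT); apply: aeS => x /(_ I).
  by rewrite ge0_fin_numE//; apply: nneseries_ge0 => k _ _; rewrite lee_fin.
have ptw x : ((\sum_(0 <= k <oo) (s k x)%:E) < +oo)%E ->
    cvgn (fun n => f_ (idx n) x).
  move=> sx; have s_ge0 : (0 <= \sum_(0 <= k <oo) (s k x)%:E)%E.
    by apply: nneseries_ge0 => k _ _; rewrite lee_fin.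
  pose M := fine (\sum_(0 <= k <oo) (s k x)%:E)%E.
  have skM k : s k x <= M.
    rewrite -lee_fin /M fineK ?ge0_fin_numE//.
    apply: le_trans (nneseries_lim_ge k.+1 _) => [|i _]; last by rewrite lee_fin.
    rewrite big_nat_recr//= leeDr//; apply: sume_ge0 => i _.
    by rewrite lee_fin.
  have M0 : 0 <= M by apply: le_trans (skM 0%N).
  have dk k : `|d k x| <= geometric (Num.sqrt M) (2^-1) k.
    rewrite -(@ler_pXn2r _ 2)// ?nnegrE ?mulr_ge0 ?sqrtr_ge0 ?exprn_ge0//.
    rewrite exprMn sqr_sqrtr// sqr_normr -exprM mulnC exprM.
    rewrite -[X in _ <= _ * X]invrK ler_pdivlMr ?invr_gt0 ?exprn_gt0 ?invr_gt0//.
    have := skM k; rewrite /s mulrC; congr (_ * _ <= _).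
    by rewrite -exprVn; congr (_ ^+ _); field.
  have dser : cvgn (series (fun k => d k x)).
    apply: normed_cvg; apply: (series_le_cvg _ _ dk) => [n|n|].
    - by rewrite normr_ge0.
    - by apply: le_trans (dk n); rewrite normr_ge0.
    - apply: is_cvg_geometric_series.
      by rewrite gtr0_norm ?invr_gt0// invf_lt1// ltr1n.
  have E : (fun n => f_ (idx n) x) = (fun n => f_ (idx 0) x + series (fun k => d k x) n).
    apply/funext => n; rewrite /series/= (telescope_sumr (fun k => f_ (idx k) x))//.
    by rewrite addrC subrK.
  by rewrite E; apply: is_cvgD => //; exact: is_cvg_cst.
have [Z [mZ Z0 subZ]] := sum_ae.
(* Cutting off at the null set Z makes the subsequence converge everywhere. *)
pose g_ n x := f_ (idx n) x * \1_(~` Z) x.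
have mg n : meas (g_ n).
  apply: measurable_funM; first exact: (fs _).1.
  by apply: measurable_indic; exact: measurableC.
have cg x : cvgn (g_ ^~ x).
  have [xZ|xZ] := pselect (Z x).
    have i0 : \1_(~` Z) x = 0 :> R by rewrite indicE memNset// => /(_ xZ).
    by rewrite /g_; under eq_fun do rewrite i0 mulr0; exact: is_cvg_cst.
  have i1 : \1_(~` Z) x = 1 :> R by rewrite indicE mem_set.
  rewrite /g_; under eq_fun do rewrite i1 mulr1.
  by apply: ptw; apply: contrapT => /subZ.
pose f x := limn (g_ ^~ x).
have mf : meas f by apply: (measurable_fun_cvg mg) => x _; exact: cg.
have fcv : {ae leb R, forall x, f_ (idx n) x @[n --> \oo] --> f x}.
  exists Z; split => // x /= h; apply: contrapT => xZ; apply: h.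
  have i1 : \1_(~` Z) x = 1 :> R by rewrite indicE mem_set.
  have := cg x; rewrite /f /g_; under eq_fun do rewrite i1 mulr1.
  exact.
have key e : 0 < e -> exists M, forall n, (M <= n)%N ->
    sq (fun x => f_ n x - f x) /\ nsq (fun x => f_ n x - f x) <= e.
  move=> e0; have [M hM] := fC _ e0; exists M => n Mn.
  pose u k x := (f_ n x - f_ (idx (k + M)) x) ^+ 2.
  have [||||||ui uI] := @fatouR _ u (fun x => (f_ n x - f x) ^+ 2) e.
  - by move=> k; exact: (sqB (fs _) (fs _)).2.
  - by move=> k x; exact: sqr_ge0.
  - by apply: measurable_funX; apply: measurable_funB => //; exact: (fs _).1.
  - by move=> x; exact: sqr_ge0.
  - apply: aeS fcv => x hx; rewrite /u expr2; under eq_fun do rewrite expr2.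
    have hx' : f_ n x - f_ (idx (k + M)) x @[k --> \oo] --> f_ n x - f x.
      by apply: cvgB; [exact: cvg_cst|rewrite (cvg_shiftn M (fun k => f_ (idx k) x))].
    exact: cvgM.
  - move=> k; apply: ltW; apply: hM => //.
    by apply: leq_trans (idxk _); exact: leq_addl.
  by split => //; split => //; apply: measurable_funB => //; exact: (fs _).1.
have fsq : sq f.
  have [M hM] := key _ (@ltr01 R); have [h _] := hM M (leqnn M).
  have := sqB (fs M) h; congr sq; apply/funext => x; by ring.
exists f => // e e0; have [M hM] := key (e / 2) (divr_gt0 e0 (ltr0n _ 2)).
exists M => n Mn; rewrite ger0_norm ?nsq_ge0//.
by have [_ h] := hM n Mn; apply: (le_lt_trans h); lra.
Qed.

End L2cvg.

(** * Derivatives of real functions *)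

Section derive_eps.
Context {R : realType}.
Implicit Types f g : R -> R.

Lemma is_derive_epsP f (x l : R) : is_derive x 1 f l <->
  forall e : R, 0 < e -> exists2 d : R, 0 < d & forall h : R, `|h| < d ->
    `|f (x + h) - f x - l * h| <= e * `|h|.
Proof.
have step h e : h != 0 ->
    (`|l - h^-1 *: (f (h *: 1 + x) - f x)| <= e) =
    (`|f (x + h) - f x - l * h| <= e * `|h|).
  move=> h0; have hn : 0 < `|h| by rewrite normr_gt0.
  rewrite -(ler_pM2r hn) -normrM; congr (_ <= _).
  rewrite -normrN; congr (`| _ |).
  rewrite /GRing.scale/= mulr1 (addrC h x); field; exact: h0.
split=> [[df dv] e e0|H].
  have /cvgrPdist_le : h^-1 *: (f (h *: 1 + x) - f x) @[h --> 0^'] --> l.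
    by rewrite -dv; exact: df.
  move=> /(_ e e0); rewrite near_withinE => -[d /= d0 hd].
  exists d => // h hh; have [->|h0] := eqVneq h 0.
    by rewrite addr0 subrr mulr0 subrr normr0 mulr0.
  by rewrite -step//; apply: hd => //=; rewrite sub0r normrN.
have C : h^-1 *: (f (h *: 1 + x) - f x) @[h --> 0^'] --> l.
  apply/cvgrPdist_le => e e0; have [d d0 hd] := H _ e0.
  rewrite near_withinE; exists d => // h /=; rewrite sub0r normrN => hh h0.
  by rewrite step// hd.
split; first by apply/cvg_ex; exists l.
exact: cvg_lim C.
Qed.

Lemma is_derive_near f g (x l d : R) : 0 < d ->
  (forall h, `|h| < d -> f (x + h) = g (x + h)) ->
  is_derive x 1 g l -> is_derive x 1 f l.
Proof.
move=> d0 fg /is_derive_epsP H; apply/is_derive_epsP => e e0.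
have [d' d'0 hd'] := H _ e0; exists (Num.min d d'); first by rewrite lt_min d0.
move=> h; rewrite lt_min => /andP[hd hdd].
rewrite fg// (_ : f x = g x); first exact: hd'.
by have := fg 0; rewrite normr0 addr0; exact.
Qed.

Lemma is_derive_cont f (x l : R) : is_derive x 1 f l -> {for x, continuous f}.
Proof. by move=> [/derivable1_diffP/differentiable_continuous]. Qed.

Lemma is_deriveM_R f g (x df dg : R) : is_derive x 1 f df -> is_derive x 1 g dg ->
  is_derive x 1 (fun y => f y * g y) (df * g x + f x * dg).
Proof.
move=> hf hg; apply: (is_derive_eq (is_deriveM hf hg)); rewrite /GRing.scale/=; ring.
Qed.

Lemma is_deriveD_R f g (x df dg : R) : is_derive x 1 f df -> is_derive x 1 g dg ->
  is_derive x 1 (fun y => f y + g y) (df + dg).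
Proof. by move=> hf hg; exact: is_deriveD. Qed.

Lemma is_derive_comp_R f g (x df dg : R) : is_derive (g x) 1 f df ->
  is_derive x 1 g dg -> is_derive x 1 (fun y => f (g y)) (df * dg).
Proof.
move=> hf hg; by apply: (is_derive_eq (is_derive1_comp hf hg)); rewrite /GRing.scale.
Qed.

Lemma is_derive_affine (a b x : R) : is_derive x 1 (fun y => a * y + b) a.
Proof.
apply/is_derive_epsP => e e0; exists 1 => // h _.
rewrite (_ : _ - _ = 0) ?normr0 ?mulr_ge0// ?ltW//; ring.
Qed.

Lemma is_derive_inv (x : R) : x != 0 -> is_derive x 1 (fun y => y^-1) (- x ^- 2).
Proof.
move=> x0; by apply: (is_derive_eq (is_deriveV x0 (is_derive_id x (1 : R)))); rewrite /GRing.scale/= mulr1.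
Qed.

End derive_eps.

(** * Smooth functions *)
Section smooth.
Context {R : realType}.
Implicit Types f g : R -> R.

Definition smooth f : Prop := forall n x, derivable (derive1n n f) x 1.

(** Smoothness by coinduction: a class of functions that contains a derivative of
    each of its members consists of smooth functions. *)
Lemma smooth_coind (S : (R -> R) -> Prop) :
  (forall f, S f -> exists2 g, S g & forall x : R, is_derive x (1 : R) f (g x)) ->
  forall f, S f -> smooth f.
Proof.
move=> H f Sf n.
have Sn : S (derive1n n f).
  elim: n => // n IHn; rewrite derive1nS; have [g Sg gd] := H _ IHn.
  suff -> : derive1 (derive1n n f) = g by [].
  by apply/funext => x; rewrite derive1E; have [_ ->] := gd x.
by have [g _ gd] := H _ Sn; move=> x; case: (gd x).
Qed.

Lemma smooth_derive f : smooth f ->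
  smooth (derive1 f) /\ forall x : R, is_derive x (1 : R) f (derive1 f x).
Proof.
move=> sf; split=> [n x|x].
  by rewrite -derive1Sn; exact: (sf n.+1).
by rewrite derive1E; apply: derivableP; exact: (sf 0%N).
Qed.

Lemma smooth_continuous f : smooth f -> continuous f.
Proof. by move=> /smooth_derive[_ h] x; apply: is_derive_cont (h x). Qed.

(** Sums of products of smooth functions form a class stable under
    differentiation, which gives the smoothness of products without Leibniz'
    formula. *)
Inductive prodsum : (R -> R) -> Prop :=
| prodsum_mul f g : smooth f -> smooth g -> prodsum (fun x => f x * g x)
| prodsum_add f g : prodsum f -> prodsum g -> prodsum (fun x => f x + g x).

Lemma smooth_prodsum f : prodsum f -> smooth f.
Proof.
apply: smooth_coind => {}f; elim=> [{}f g sf sg|{}f g _ [f' pf df] _ [g' pg dg]].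
  have [sf' df] := smooth_derive sf; have [sg' dg] := smooth_derive sg.
  exists (fun x => derive1 f x * g x + f x * derive1 g x).
    by apply: prodsum_add; exact: prodsum_mul.
  by move=> x; exact: is_deriveM_R.
exists (fun x => f' x + g' x); first exact: prodsum_add.
by move=> x; exact: is_deriveD_R.
Qed.

Lemma smoothM f g : smooth f -> smooth g -> smooth (fun x => f x * g x).
Proof. by move=> sf sg; apply: smooth_prodsum; exact: prodsum_mul. Qed.

Lemma smooth_affine c a b f : smooth f -> smooth (fun x => c * f (a * x + b)).
Proof.
move=> sf; pose S g := exists c h, smooth h /\ g = (fun x => c * h (a * x + b)).
apply: (@smooth_coind S); last by exists c, f.
move=> _ [k [h [sh ->]]]; have [sh' dh] := smooth_derive sh.
exists (fun x => k * a * derive1 h (a * x + b)); first by exists (k * a), (derive1 h).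
move=> x; have d1 : is_derive x 1 (fun y => h (a * y + b)) (derive1 h (a * x + b) * a).
  exact: (is_derive_comp_R (dh _) (is_derive_affine a b x)).
apply: (is_derive_eq (is_deriveM_R (is_derive_cst k x (1 : R)) d1)).
by rewrite mul0r add0r /cst; ring.
Qed.

Lemma smooth_cst c : smooth (fun _ => c).
Proof.
apply: (@smooth_coind (fun f => exists c, f = (fun _ => c))); last by exists c.
move=> _ [k ->]; exists (fun _ => 0); first by exists 0.
by move=> x; exact: is_derive_cst.
Qed.

Lemma smoothD f g : smooth f -> smooth g -> smooth (fun x => f x + g x).
Proof.
move=> sf sg; have -> : (fun x => f x + g x) = (fun x => f x * 1 + g x * 1).
  by apply/funext => x; rewrite !mulr1.
have s1 : smooth (fun _ => 1) by exact: smooth_cst.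
exact: smooth_prodsum (prodsum_add (prodsum_mul sf s1) (prodsum_mul sg s1)).
Qed.

Lemma smoothZ c f : smooth f -> smooth (fun x => c * f x).
Proof. by move=> sf; exact: (smoothM (@smooth_cst c) sf). Qed.

(** The classical flat function exp(-1/x), multiplied by a polynomial in 1/x so
    that the family is stable under differentiation. *)
Definition flat (P : {poly R}) (x : R) : R :=
  if 0 < x then P.[x^-1] * expR (- x^-1) else 0.

(** Since exp y exceeds every power of y = 1/h, the function is O(h^2), hence
    differentiable at 0. *)
Let flat_bound (P : {poly R}) : exists2 C, 0 <= C & forall h, `|h| < 1 ->
  `|flat P h| <= C * h ^+ 2.
Proof.
pose S := \sum_(i < size P) `|P`_i|.
have S0 : 0 <= S by apply: sumr_ge0.
exists (S * (size P).+2`!%:R); first by rewrite mulr_ge0.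
move=> h h1; rewrite /flat; case: ifPn => [h0|_]; last first.
  by rewrite normr0 mulr_ge0 ?sqr_ge0// mulr_ge0.
have y1 : 1 <= h^-1.
  by rewrite invf_ge1//; move: h1; rewrite gtr0_norm// => /ltW.
have hi : h = (h^-1)^-1 by rewrite invrK.
rewrite {3}hi; move: (h^-1) y1 => y y1 {h1 h0 hi h}.
have y0 : 0 < y by apply: lt_le_trans y1.
have PS : `|P.[y]| <= S * y ^+ size P.
  rewrite horner_coef mulr_suml; apply: le_trans (ler_norm_sum _ _ _) _.
  apply: ler_sum => i _; rewrite normrM ler_wpM2l// ger0_norm.
    by apply: ler_weXn2l => //; exact: ltnW.
  by rewrite exprn_ge0// ltW.
have := expR_ge1Dxn (size P).+1 (ltW y0) => ey.
have ey' : y ^+ (size P).+2 / (size P).+2`!%:R <= expR y.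
  by apply: le_trans ey; rewrite lerDr.
rewrite normrM (gtr0_norm (expR_gt0 _)) expRN.
rewrite ler_pdivrMr ?expR_gt0//; apply: (le_trans PS).
rewrite -!mulrA ler_wpM2l//.
rewrite ler_pdivrMr ?ltr0n ?fact_gt0// in ey'.
by rewrite mulrCA ler_pdivlMl// mulrCA ler_pdivlMl// -!exprS mulrC.
Qed.

Lemma is_derive_flat (P : {poly R}) (x : R) : is_derive x (1 : R) (flat P) (flat ('X^2 * (P - P^`())) x).
Proof.
have [x0|x0|->] := ltgtP x 0.
- rewrite [X in is_derive _ _ _ X](_ : _ = 0); last by rewrite /flat ltNge (ltW x0).
  apply: (@is_derive_near _ _ (fun _ => 0) _ _ (- x)); first by rewrite oppr_gt0.
    move=> h hx; rewrite /flat ltNge; case: ifPn => //; rewrite -ltNge => xh.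
    by move: hx; rewrite ltr_norml; lra.
- rewrite {2}/flat x0.
  apply: (@is_derive_near _ _ (fun y => P.[y^-1] * expR (- y^-1)) _ _ x) => //.
    move=> h hx; rewrite /flat ifT//; move: hx; rewrite ltr_norml; lra.
  have xn : x != 0 by rewrite gt_eqF.
  have di := is_derive_inv xn.
  have d1 : is_derive x 1 (fun y : R => P.[y^-1]) (P^`().[x^-1] * (- x ^- 2)).
    exact: (is_derive_comp_R (is_derive_poly P x^-1) di).
  have d2 : is_derive x 1 (fun y : R => expR (- y^-1)) (expR (- x^-1) * x ^- 2).
    have dn : is_derive x 1 (fun y : R => - y^-1) (x ^- 2).
      by apply: (is_derive_eq (is_deriveN di)); rewrite opprK.
    exact: (is_derive_comp_R (is_derive_expR _) dn).
  apply: (is_derive_eq (is_deriveM_R d1 d2)).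
  rewrite hornerM hornerXn hornerD hornerN; field; exact: xn.
- rewrite [X in is_derive _ _ _ X](_ : _ = 0); last by rewrite /flat ltxx.
  have [C C0 hC] := flat_bound P.
  apply/is_derive_epsP => e e0; exists (Num.min 1 (e / (C + 1))).
    by rewrite lt_min ltr01 divr_gt0// ltr_wpDl.
  move=> h; rewrite lt_min => /andP[h1 he].
  rewrite {2}/flat ltxx mul0r !subr0 add0r; apply: (le_trans (hC _ h1)).
  rewrite -sqr_normr expr2 mulrA ler_wpM2r//.
  rewrite ltr_pdivlMr ?ltr_wpDl// in he; apply: le_trans (ltW he).
  by rewrite mulrC ler_wpM2l// lerDl.
Qed.

Lemma smooth_flat P : smooth (flat P).
Proof.
apply: (@smooth_coind (fun f => exists P, f = flat P)); last by exists P.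
by move=> _ [Q ->]; exists (flat ('X^2 * (Q - Q^`()))); [eexists|
  exact: is_derive_flat].
Qed.

End smooth.

(** * Test functions *)

Section compact_support.
Context {R : realType}.
Implicit Types f g phi psi : R -> R.

(** Compactness of the support in the form in which it is used. *)
Definition bsupp f : Prop := exists2 A : R, 0 < A & forall x, A < `|x| -> f x = 0.

Lemma bsuppD f g : bsupp f -> bsupp g -> bsupp (fun x => f x + g x).
Proof.
move=> [A A0 hA] [B B0 hB]; exists (A + B); first exact: addr_gt0.
by move=> x hx; rewrite hA ?hB ?addr0//; lra.
Qed.

Lemma bsuppZ c f : bsupp f -> bsupp (fun x => c * f x).
Proof. by move=> [A A0 hA]; exists A => // x hx; rewrite hA ?mulr0. Qed.

Lemma bsupp_shift a f : bsupp f -> bsupp (fun x => f (x + a)).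
Proof.
move=> [A A0 hA]; exists (A + `|a|); first by rewrite ltr_wpDr.
move=> x hx; apply: hA; have := ler_normB (x + a) a; rewrite addrK; lra.
Qed.

Lemma ig_itv_cst (b0 b1 : bool) (a b : R) c :
  ig (fun x => c * \1_[set` Interval (BSide b0 a) (BSide b1 b)] x).
Proof. by apply: igZ; exact: integrable_indic_itv. Qed.

Lemma bsupp_bounded f : continuous f -> bsupp f ->
  exists2 M, 0 < M & exists2 A, 0 < A &
    forall x, `|f x| <= M * \1_(`[- A, A]) x.
Proof.
move=> cf [A A0 hA].
have cn : {within `[- A, A], continuous (fun x => `|f x|)}.
  by apply: continuous_subspaceT => x; apply: cvg_norm; exact: cf.
have [|c _ hc] := EVT_max _ cn; first by lra.
exists (`|f c| + 1); first by rewrite ltr_wpDl.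
exists A => // x; rewrite indicE; have [xA|xA] := leP `|x| A.
  have xi : x \in `[- A, A]%R by rewrite in_itv/= -ler_norml.
  rewrite mem_set//= mulr1; apply: le_trans (hc x xi) _; lra.
by rewrite hA// normr0 mulr_ge0// addr_ge0.
Qed.

Lemma ig_bsupp f : continuous f -> bsupp f -> ig f.
Proof.
move=> cf bf; have [M M0 [A A0 h]] := bsupp_bounded cf bf.
apply: (ig_le _ (ig_itv_cst _ _ (- A) A M)) => //.
exact: continuous_measurable_fun.
Qed.

Lemma sq_bsupp f : continuous f -> bsupp f -> sq f.
Proof.
move=> cf bf; split; first exact: continuous_measurable_fun.
apply: ig_bsupp => [x|]; first by apply: cvgM; exact: cf.
by have [A A0 h] := bf; exists A => // x hx; rewrite h ?expr0n.
Qed.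

Lemma test_functionP phi : test_function phi <-> smooth phi /\ bsupp phi.
Proof.
split=> [[sphi cphi]|[sphi [A A0 hA]]].
  split => //; have [M [Mr hM]] := compact_bounded cphi.
  exists (`|M| + 1); first by rewrite ltr_wpDl.
  move=> x hx; apply/eqP; apply: contraT => px.
  have := hM (`|M| + 1); rewrite ltr_pwDr ?ler_norm//= => /(_ isT x).
  by rewrite leNgt hx => /(_ (subset_closure _)) => /(_ px).
split => //; apply: (subclosed_compact _ (@segment_compact R (- A) A)).
  exact: closed_closure.
rewrite [X in _ `<=` X](iffLR (closure_id _)); last exact: itv_closed.
apply: closureS => x /= px; rewrite in_itv/= -ler_norml leNgt.
by apply/negP => /hA h; rewrite h eqxx in px.
Qed.

Lemma testD phi psi : test_function phi -> test_function psi ->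
  test_function (fun x => phi x + psi x).
Proof.
move=> /test_functionP[s1 b1] /test_functionP[s2 b2]; apply/test_functionP.
by split; [exact: smoothD|exact: bsuppD].
Qed.

Lemma testZ c phi : test_function phi -> test_function (fun x => c * phi x).
Proof.
move=> /test_functionP[s1 b1]; apply/test_functionP.
by split; [exact: smoothZ|exact: bsuppZ].
Qed.

Lemma testB phi psi : test_function phi -> test_function psi ->
  test_function (fun x => phi x - psi x).
Proof.
move=> h1 h2; have := testD h1 (testZ (-1) h2).
by congr test_function; apply/funext => x; rewrite mulN1r.
Qed.

Lemma test_shift a phi : test_function phi ->
  test_function (fun x => phi (x + a)).
Proof.
move=> /test_functionP[s1 b1]; apply/test_functionP; split.
  have := @smooth_affine _ 1 1 a _ s1; congr smooth; apply/funext => x.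
  by rewrite !mul1r.
exact: bsupp_shift.
Qed.

Lemma test0 : test_function (fun _ : R => 0 : R).
Proof.
by apply/test_functionP; split; [exact: smooth_cst|exists 1 => //].
Qed.

Lemma test_cont phi : test_function phi -> continuous phi.
Proof. by move=> /test_functionP[/smooth_continuous]. Qed.

Lemma test_ig phi : test_function phi -> ig phi.
Proof. by move=> h; apply: ig_bsupp; [exact: test_cont|case/test_functionP: h]. Qed.

Lemma test_sq phi : test_function phi -> sq phi.
Proof. by move=> h; apply: sq_bsupp; [exact: test_cont|case/test_functionP: h]. Qed.

Lemma test_is_derive phi : test_function phi ->
  forall x : R, is_derive x (1 : R) phi (derive1 phi x).
Proof. by move=> /test_functionP[/smooth_derive[]]. Qed.

Lemma test_derive phi : test_function phi -> test_function (derive1 phi).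
Proof.
move=> /test_functionP[s1 [A A0 hA]]; apply/test_functionP; split.
  by have [] := smooth_derive s1.
exists A => // x hx; rewrite derive1E.
have : is_derive x 1 phi 0.
  apply: (@is_derive_near _ _ (fun _ => 0) _ _ (`|x| - A)).
  - by rewrite subr_gt0.
  - move=> h hh; apply: hA.
    have := ler_normB (x + h) h; rewrite addrK; lra.
by move=> [_ ->].
Qed.

End compact_support.

(** * Density of the test functions *)

Section density.
Context {R : realType}.
Implicit Types f g phi psi : R -> R.

(** Membership in the L^2 closure of the test functions. *)
Definition approximable f : Prop := sq f /\ forall e : R, 0 < e ->
  exists2 phi, test_function phi & nsq (fun x => phi x - f x) < e.

Lemma approximableD f g : approximable f -> approximable g ->
  approximable (fun x => f x + g x).
Proof.
move=> [sf hf] [sg hg]; split; first exact: sqD.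
move=> e e0; have e4 : 0 < e / 4 by rewrite divr_gt0.
have [p tp np] := hf _ e4; have [q tq nq] := hg _ e4.
exists (fun x => p x + q x); first exact: testD.
have h := nsqD_le (sqB (test_sq tp) sf) (sqB (test_sq tq) sg).
rewrite (_ : nsq _ = nsq (fun x => (p x - f x) + (q x - g x))).
  by apply: le_lt_trans h _; lra.
by apply: I_ext => x; congr (_ ^+ 2); ring.
Qed.

Lemma approximableZ c f : approximable f -> approximable (fun x => c * f x).
Proof.
move=> [sf hf]; split; first exact: sqZ.
move=> e e0; have c0 : 0 < c ^+ 2 + 1 by rewrite ltr_wpDl ?sqr_ge0.
have [p tp np] := hf _ (divr_gt0 e0 c0).
exists (fun x => c * p x); first exact: testZ.
rewrite (_ : nsq _ = c ^+ 2 * nsq (fun x => p x - f x)).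
  rewrite ltr_pdivlMr// in np; apply: le_lt_trans np.
  by rewrite mulrC ler_wpM2l ?nsq_ge0// lerDl.
rewrite -nsqZ; last by apply: sqB => //; exact: test_sq.
by apply: I_ext => x; rewrite mulrBr.
Qed.

Lemma approximable_test phi : test_function phi -> approximable phi.
Proof.
move=> tp; split=> [|e e0]; first exact: test_sq.
exists phi => //; rewrite /nsq.
by under eq_fun do rewrite subrr expr0n; rewrite I0.
Qed.

Lemma approximable_sum (n : nat) (F : nat -> R -> R) :
  (forall i, approximable (F i)) -> approximable (fun x => \sum_(i < n) F i x).
Proof.
move=> h; elim: n => [|n IHn].
  have -> : (fun x => \sum_(i < 0) F i x) = (fun=> 0).
    by apply/funext => x; rewrite big_ord0.
  split=> [|e e0]; first exact: sq0.
  exists (fun=> 0); first exact: test0.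
  by rewrite /nsq; under eq_fun do rewrite subrr expr0n; rewrite I0.
have -> : (fun x => \sum_(i < n.+1) F i x) =
    (fun x => \sum_(i < n) F i x + F n x).
  by apply/funext => x; rewrite big_ord_recr.
exact: approximableD.
Qed.

Lemma approximable_lim f : sq f ->
  (forall e : R, 0 < e -> exists2 g, approximable g & nsq (fun x => g x - f x) < e) ->
  approximable f.
Proof.
move=> sf h; split => // e e0; have e4 : 0 < e / 4 by rewrite divr_gt0.
have [g [sg hg] ng] := h _ e4; have [p tp np] := hg _ e4.
exists p => //; apply: le_lt_trans (nsq_tri (test_sq tp) sg sf) _; lra.
Qed.

Lemma approximable_seq f (f_ : nat -> R -> R) : sq f ->
  (forall n, approximable (f_ n)) -> null_seq (fun n => nsq (fun x => f_ n x - f x)) ->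
  approximable f.
Proof.
move=> sf h cv; apply: approximable_lim => // e e0; have [N hN] := cv _ e0.
by exists (f_ N) => //; have := hN N (leqnn _); rewrite ger0_norm ?nsq_ge0.
Qed.

Let step (x : R) := flat 1%:P x.

Let step_ge0 x : 0 <= step x.
Proof. by rewrite /step /flat; case: ifP => // _; rewrite hornerC mul1r expR_ge0. Qed.

Let step_le1 x : step x <= 1.
Proof.
rewrite /step /flat; case: ifP => // x0; rewrite hornerC mul1r expR_le1.
by rewrite oppr_le0 invr_ge0 ltW.
Qed.

Let step_le0 x : x <= 0 -> step x = 0.
Proof. by move=> x0; rewrite /step /flat ltNge x0. Qed.

Let step_cvg (c : R) : 0 < c -> step (n.+1%:R * c) @[n --> \oo] --> (1 : R).
Proof.
move=> c0; have E n : step (n.+1%:R * c) = expR (- (n.+1%:R^-1 * c^-1)).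
  by rewrite /step /flat mulr_gt0// hornerC mul1r invfM.
rewrite (_ : (fun n => _) = (fun n => expR (- (n.+1%:R^-1 * c^-1)))); last first.
  exact/funext.
have L : - (n.+1%:R^-1 * c^-1) @[n --> \oo] --> - (0 * c^-1).
  by apply: cvgN; apply: cvgM; [exact: (@cvg_harmonic R)|exact: cvg_cst].
have := cvg_comp _ _ L (@continuous_expR R (- (0 * c^-1))).
by rewrite mul0r oppr0 expR0.
Qed.

(** The products of two smooth steps with increasing slopes converge
    to the indicator of an interval. *)
Lemma approximable_itv (a b : R) : approximable (\1_(`[a, b[) : R -> R).
Proof.
have mi : meas (\1_(`[a, b[) : R -> R) by exact: measurable_indic.
have ii : ig (\1_(`[a, b[) : R -> R) by exact: integrable_indic_itv.
have isq x : (\1_(`[a, b[) x : R) ^+ 2 = \1_(`[a, b[) x.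
  by rewrite indicE; case: (_ \in _); rewrite ?expr0n ?expr1n.
have si : sq (\1_(`[a, b[) : R -> R).
  by split => //; apply: ig_ext ii => x; rewrite isq.
pose p n x := step (n.+1%:R * (x - a)) * step (n.+1%:R * (b - x)).
have tp n : test_function (p n).
  apply/test_functionP; split.
    apply: smoothM.
      have := @smooth_affine _ 1 n.+1%:R (- (n.+1%:R * a)) _ (@smooth_flat R 1%:P).
      by congr smooth; apply/funext => x; rewrite mul1r /step; congr (flat _ _); ring.
    have := @smooth_affine _ 1 (- n.+1%:R) (n.+1%:R * b) _ (@smooth_flat R 1%:P).
    by congr smooth; apply/funext => x; rewrite mul1r /step; congr (flat _ _); ring.
  exists (`|a| + `|b| + 1); first by rewrite ltr_wpDl ?addr_ge0.
  move=> x hx; rewrite /p; have [xa|ax] := leP x a.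
    by rewrite step_le0 ?mul0r// pmulr_rle0// subr_le0.
  rewrite [X in _ * X]step_le0 ?mulr0// pmulr_rle0// subr_le0 leNgt.
  apply/negP => xb; move: hx; apply/negP; rewrite -leNgt ler_norml.
  have := ler_norm b; have := ler_norm (- a); rewrite normrN.
  by have := normr_ge0 a; have := normr_ge0 b; lra.
have out x : ~ (a < x /\ x < b) -> forall n, p n x = 0.
  move=> h n; rewrite /p; have [xa|ax] := leP x a.
    by rewrite step_le0 ?mul0r// pmulr_rle0// subr_le0.
  have [bx|xb] := leP b x; last by exfalso; apply: h.
  by rewrite [X in _ * X]step_le0 ?mulr0// pmulr_rle0// subr_le0.
have p01 n x : 0 <= p n x <= 1.
  by rewrite mulr_ge0//= -[leRHS]mulr1 ler_pM.
apply: (@approximable_seq _ p) => // [n|].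
  exact: approximable_test.
(* At the left end point p n a = 0, which differs from the indicator. *)
have cv : {ae leb R, forall x,
    (p n x - \1_(`[a, b[) x) ^+ 2 @[n --> \oo] --> (0 : R)}.
  exists [set a]; split => //; first exact: lebesgue_measure_set1.
  move=> x /= h; apply: contrapT => xa; apply: h.
  have [[ax xb]|nx] := pselect (a < x /\ x < b).
    rewrite indicE mem_set/=; last by rewrite in_itv/= (ltW ax) xb.
    rewrite [X in _ --> X](_ : _ = (1 * 1 - 1) ^+ 2); last first.
      by rewrite mulr1 subrr expr0n.
    have L : p n x - 1 @[n --> \oo] --> (1 * 1 - 1 : R).
      apply: cvgB; last exact: cvg_cst.
      by apply: cvgM; apply: step_cvg; rewrite subr_gt0.
    by rewrite expr2; under eq_fun do rewrite expr2; exact: cvgM.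
  rewrite indicE memNset/=; last first.
    rewrite in_itv/= => /andP[ax xb]; apply: nx; split => //.
    rewrite lt_neqAle ax andbT; apply/eqP => ax'; exact/xa/esym.
  under eq_fun do rewrite out// subrr expr0n; exact: cvg_cst.
apply/null_seqP; have [||_] := DCT _ (measurable_cst _) cv ii.
- move=> n; apply: measurable_funX; apply: measurable_funB => //.
  by apply: continuous_measurable_fun; exact: test_cont.
- move=> n x; rewrite ger0_norm ?sqr_ge0//.
  rewrite indicE; case: (boolP (x \in _)) => xi /=.
    by have /andP[h0 h1] := p01 n x; nra.
  rewrite out ?subrr ?expr0n// => -[ax xb]; move/negP: xi; apply.
  by rewrite inE/= in_itv/= (ltW ax) xb.
- by rewrite I0.
Qed.

(** Step functions sampled on finer and finer grids of a bounded interval converge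
    to g there, and the interval grows. *)
Theorem test_dense g : continuous g -> sq g -> approximable g.
Proof.
move=> cg sg.
(* Reduction to truncations of g to bounded intervals. *)
suff trunc (K : nat) : approximable (fun x => g x * \1_(`[- K%:R, K%:R[) x).
  apply: (@approximable_seq _ (fun K x => g x * \1_(`[- K%:R, K%:R[) x)) => //.
  apply/null_seqP; have [mg gi] := sg.
  have [||||_] := @DCTe _ (fun K x => (g x * \1_(`[- K%:R, K%:R[) x - g x) ^+ 2)
    (fun=> 0) (fun x => g x ^+ 2).
  - move=> n; apply: measurable_funX; apply: measurable_funB => //.
    by apply: measurable_funM => //; exact: measurable_indic.
  - move=> x; apply/null_seqP => e e0.
    exists (Num.truncn `|x|).+1 => n hn; rewrite indicE mem_set/=.
      by rewrite mulr1 subrr expr0n normr0.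
    have xn : `|x| < n%:R.
      by apply: lt_le_trans (truncnS_gt _) _; rewrite ler_nat.
    by move: xn; rewrite ltr_norml in_itv/= => /andP[/ltW -> ->].
  - exact: gi.
  - move=> n x; rewrite ger0_norm ?sqr_ge0//.
    rewrite indicE; case: (_ \in _); rewrite ?mulr1 ?mulr0.
      by rewrite subrr expr0n sqr_ge0.
    by rewrite sub0r sqrrN.
  - by rewrite I0.
have [->|K0] := eqVneq K 0%N.
  rewrite (_ : (fun x => _) = (fun=> 0)); first exact: approximable_test test0.
  apply/funext => x; rewrite indicE memNset ?mulr0//= in_itv/=.
  by rewrite oppr0 => /andP[]; rewrite leNgt => /negP.
have Kp : 0 < K%:R :> R by rewrite ltr0n lt0n.
(* The grid of mesh 1/(N+1) on [-K, K]. *)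
pose xx (N i : nat) : R := - K%:R + i%:R / N.+1%:R.
pose s N x := \sum_(i < (K + K) * N.+1) g (xx N i) * \1_(`[xx N i, xx N i.+1[) x.
have as_ N : approximable (s N).
  apply: (@approximable_sum _
    (fun i x => g (xx N i) * \1_(`[xx N i, xx N i.+1[) x)) => i.
  by apply: approximableZ; exact: approximable_itv.
have xx_mono N i j : (i <= j)%N -> xx N i <= xx N j.
  by move=> ij; rewrite lerD2l ler_pM2r ?invr_gt0// ler_nat.
have s_in N x : - K%:R <= x < K%:R -> exists2 i : nat,
    s N x = g (xx N i) & `|x - xx N i| <= N.+1%:R^-1 /\ (- K%:R <= xx N i <= K%:R).
  move=> /andP[Kx xK]; pose y := (x + K%:R) * N.+1%:R.
  have y0 : 0 <= y by rewrite mulr_ge0//; lra.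
  pose i := Num.truncn y; have /andP[iy yi] := truncn_itv y0.
  have N0 : 0 < N.+1%:R :> R by rewrite ltr0n.
  have xi : xx N i <= x.
    by rewrite /xx -lerBrDl opprK ler_pdivrMr.
  have ix : x < xx N i.+1.
    by rewrite /xx -ltrBlDl opprK ltr_pdivlMr.
  have ilt : (i < (K + K) * N.+1)%N.
    rewrite -(ltr_nat R) natrM natrD; apply: le_lt_trans iy _.
    by rewrite /y ltr_pM2r//; lra.
  exists i.
    rewrite /s (bigD1 (Ordinal ilt))//= indicE mem_set/=; last by rewrite in_itv/= xi.
    rewrite mulr1 big1 ?addr0// => j ji; rewrite indicE memNset ?mulr0//=.
    rewrite in_itv/= => /andP[jx xj].
    have ji' : val j != i by apply: contraNneq ji => h; apply/eqP/val_inj.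
    have [h|h|h] := ltngtP (val j) i.
    - by have := le_lt_trans (le_trans (xx_mono N _ _ h) xi) xj; rewrite ltxx.
    - by have := lt_le_trans ix (le_trans (xx_mono N _ _ h) jx); rewrite ltxx.
    - by rewrite h eqxx in ji'.
  split.
    rewrite ger0_norm ?subr_ge0// lerBlDr addrC; apply: ltW; apply: lt_le_trans ix _.
    by rewrite /xx -addrA lerD2l -natr1 mulrDl mul1r.
  by rewrite (le_trans xi (ltW xK)) andbT /xx lerDl divr_ge0// ltW.
have s_out N x : ~~ (- K%:R <= x < K%:R) -> s N x = 0.
  move=> hx; rewrite /s big1// => j _; rewrite indicE memNset ?mulr0//=.
  rewrite in_itv/= => /andP[jx xj]; move/negP: hx; apply.
  apply/andP; split.
    by apply: le_trans jx; rewrite /xx lerDl divr_ge0.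
  apply: lt_le_trans xj _; rewrite /xx -lerBrDl opprK ler_pdivrMr ?ltr0n//.
  by rewrite -natrD -natrM ler_nat.
have cn : {within `[- K%:R, K%:R : R], continuous (fun x => `|g x|)}.
  by apply: continuous_subspaceT => x; apply: cvg_norm; exact: cg.
have [|c _ hc] := EVT_max _ cn; first by lra.
have [mg gi] := sg.
have mK : meas (\1_(`[- K%:R, K%:R[) : R -> R) by exact: measurable_indic.
apply: (@approximable_seq _ s) => //.
  apply: (sq_le _ sg); first exact: measurable_funM.
  move=> x; rewrite normrM indicE; case: (_ \in _); rewrite ?normr1 ?mulr1//.
  by rewrite normr0 mulr0.
apply/null_seqP.
have GI := ig_itv_cst true false (- K%:R) K%:R ((2 * `|g c|) ^+ 2).
have [|||_] := @DCTe _
  (fun N x => (s N x - g x * \1_(`[- K%:R, K%:R[) x) ^+ 2) (fun=> 0) _ _ _ GI _.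
- move=> N; apply: measurable_funX; apply: measurable_funB => //.
    exact: (as_ N).1.1.
  exact: measurable_funM.
- move=> x; have [xK|xK] := boolP (- K%:R <= x < K%:R); last first.
    have i0 : \1_(`[- K%:R, K%:R[) x = 0 :> R.
      by rewrite indicE memNset//= in_itv/=; apply/negP.
    under eq_fun do rewrite s_out// i0 mulr0 subrr expr0n.
    exact: cvg_cst.
  have i1 : \1_(`[- K%:R, K%:R[) x = 1 :> R by rewrite indicE mem_set//= in_itv.
  apply/null_seqP; rewrite i1 mulr1.
  suff h : null_seq (fun N => s N x - g x).
    move/null_seqP: h => h; apply/null_seqP.
    have h2 := cvgM h h; rewrite mulr0 in h2; exact: h2.
  move=> e e0; have /cvgrPdist_lt/(_ _ e0)[d /= d0 hd] := cg x.
  have [N hN] := @null_seq_invS R _ d0; exists N => n Nn.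
  have [i -> [xi _]] := s_in n x xK; rewrite distrC; apply: hd => /=.
  apply: le_lt_trans xi _; have := hN n Nn.
  by rewrite ger0_norm// invr_ge0.
- move=> N x; rewrite ger0_norm ?sqr_ge0//.
  have [xK|xK] := boolP (- K%:R <= x < K%:R); last first.
    rewrite s_out// !indicE memNset; last by rewrite /= in_itv/=; exact/negP.
    rewrite mulr0 subrr expr0n; exact: mulr_ge0 (sqr_ge0 _) _.
  have xKc : `[- K%:R, K%:R]%classic x.
    by rewrite /= in_itv/=; have /andP[-> /ltW ->] := xK.
  rewrite !indicE !mem_set//.
  have [i -> [_ iK]] := s_in N x xK; rewrite !mulr1.
  rewrite -sqr_normr lerXn2r ?nnegrE ?mulr_ge0//.
  apply: le_trans (ler_normB _ _) _; rewrite mulr_natl mulr2n lerD//.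
    by apply: hc; rewrite in_itv.
  by apply: hc; rewrite in_itv/=; have /andP[-> /ltW ->] := xK.
- by rewrite I0.
Qed.

End density.

(** * Integrals from antiderivatives *)

Section kernels.
Context {R : realType}.
Implicit Types f g F : R -> R.

Lemma seq_lim_unique (a : nat -> R) (l l' : R) :
  a n @[n --> \oo] --> l -> a n @[n --> \oo] --> l' -> l = l'.
Proof. by move=> h1 h2; rewrite -(cvg_lim _ h1)// -(cvg_lim _ h2). Qed.

Lemma FTC_itv f F (a b : R) : a < b -> continuous f -> continuous F ->
  (forall x : R, a < x -> is_derive x (1 : R) F (f x)) ->
  IR (fun x => f x * \1_(`[a, b]) x) = F b - F a.
Proof.
move=> ab cf cF dF.
have -> : IR (fun x => f x * \1_(`[a, b]) x) = Rintegral (leb R) `[a, b] f.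
  by rewrite Rintegral_mkcond patch_indic.
rewrite /Rintegral (@continuous_FTC2 _ f F a b ab)//.
- exact: continuous_subspaceT.
- split.
  + by move=> x; rewrite in_itv/= => /andP[/dF[]].
  + exact/cvg_at_right_filter/cF.
  + exact/cvg_at_left_filter/cF.
- by move=> x; rewrite in_itv/= => /andP[/dF[_ dFx] _]; rewrite derive1E.
Qed.

Lemma I_derive_bsupp f F : continuous f -> (forall x : R, is_derive x (1 : R) F (f x)) ->
  bsupp F -> bsupp f -> IR f = 0.
Proof.
move=> cf dF [A A0 hA] [B B0 hB].
have cF : continuous F by move=> x; exact: is_derive_cont (dF x).
have AB : - (A + B) < A + B by rewrite gtrN// addr_gt0.
have := FTC_itv AB cf cF (fun x _ => dF x).
pose C := A + B + 1.
have CC : - C < C by rewrite gtrN// /C; lra.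
have := FTC_itv CC cf cF (fun x _ => dF x); rewrite hA; last by rewrite ger0_norm /C; lra.
rewrite hA ?subr0; last by rewrite normrN ger0_norm /C; lra.
move=> <- _; apply: I_ext => x; rewrite indicE.
have [xC|xC] := leP `|x| C.
  by rewrite mem_set ?mulr1//= in_itv/= -ler_norml.
by rewrite hB ?mul0r//; rewrite /C in xC; lra.
Qed.

(** The integral over [0, n] is F n - F 0, and dominated convergence gives the
    limit n -> oo. *)
Lemma I_halfline f F (l : R) G : continuous f -> continuous F ->
  (forall x : R, 0 < x -> is_derive x (1 : R) F (f x)) ->
  F n.+1%:R @[n --> \oo] --> l -> ig G -> (forall x, 0 <= x -> `|f x| <= G x) ->
  (forall x, 0 <= G x) ->
  ig (fun x => f x * \1_(`[0, +oo[) x) /\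
  IR (fun x => f x * \1_(`[0, +oo[) x) = l - F 0.
Proof.
move=> cf cF dF Fl Gi fG G0.
have mf : meas f by exact: continuous_measurable_fun.
have [|||i c] := @DCTe _ (fun n x => f x * \1_(`[0, n.+1%:R]) x)
  (fun x => f x * \1_(`[0, +oo[) x) _ _ _ Gi _.
- by move=> n; apply: measurable_funM => //; exact: measurable_indic.
- move=> x; apply: cvgM; first exact: cvg_cst.
  apply/cvg_seqP => e e0; exists (Num.truncn `|x|) => n hn.
  have xn : `|x| <= n.+1%:R.
    by apply: le_trans (ltW (truncnS_gt _)) _; rewrite ler_nat ltnS.
  rewrite !indicE; have [x0|x0] := leP 0 x.
    rewrite !mem_set ?subrr ?normr0//= in_itv/= x0//=.
    by move: xn; rewrite ger0_norm.
  by rewrite !memNset ?subrr ?normr0//= in_itv/= leNgt x0.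
- move=> n x; rewrite indicE; case: (boolP (x \in _)) => xi.
    rewrite mulr1; apply: fG; move: xi; rewrite inE/= in_itv/= => /andP[]; exact.
  by rewrite mulr0 normr0.
split => //; apply: (seq_lim_unique c).
have -> : (fun n => IR (fun x => f x * \1_(`[0, n.+1%:R]) x)) =
    (fun n => F n.+1%:R - F 0).
  by apply/funext => n; apply: FTC_itv => //; rewrite ltr0n.
by apply: cvgB => //; exact: cvg_cst.
Qed.

(** For a non-negative integrand, the boundedness of the partial integrals takes
    the place of a dominating function. *)
Lemma I_halfline_ge0 f F (l : R) : continuous f -> continuous F ->
  (forall x : R, 0 < x -> is_derive x (1 : R) F (f x)) ->
  F n.+1%:R @[n --> \oo] --> l -> (forall x, 0 <= f x) ->
  ig (fun x => f x * \1_(`[0, +oo[) x) /\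
  IR (fun x => f x * \1_(`[0, +oo[) x) = l - F 0.
Proof.
move=> cf cF dF Fl f0.
have mf : meas f by exact: continuous_measurable_fun.
have hi n : ig (fun x => f x * \1_(`[0, n.+1%:R]) x).
  have n0 : (0 : R) < n.+1%:R by rewrite ltr0n.
  have [||c _ hc] := @EVT_max _ f 0 n.+1%:R; first exact: ltW.
    exact: continuous_subspaceT.
  apply: (ig_le _ (ig_itv_cst true false 0 n.+1%:R (f c))).
    by apply: measurable_funM => //; exact: measurable_indic.
  move=> x; rewrite normrM indicE; case: (boolP (x \in _)) => xi.
    rewrite normr1 !mulr1 ger0_norm//; apply: hc.
    by move: xi; rewrite inE.
  by rewrite normr0 !mulr0.
have E n : IR (fun x => f x * \1_(`[0, n.+1%:R]) x) = F n.+1%:R - F 0.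
  by apply: FTC_itv => //; rewrite ltr0n.
have Fmono x y : 0 <= x -> x < y -> F x <= F y.
  move=> x0 xy; have E' := FTC_itv xy cf cF (fun z xz => dF z (le_lt_trans x0 xz)).
  rewrite -subr_ge0 -E'; apply: I_ge0 => z.
  by rewrite mulr_ge0.
have Fb n : F n.+1%:R <= l.
  rewrite -(cvg_lim _ Fl)//; apply: nondecreasing_cvgn_le; last exact: cvgP Fl.
  apply/nondecreasing_seqP => k; apply: Fmono; first exact: ler0n.
  by rewrite ltr_nat.
have [|||||hig _] := @fatouR _ (fun n x => f x * \1_(`[0, n.+1%:R]) x)
  (fun x => f x * \1_(`[0, +oo[) x) (l - F 0) hi.
- by move=> n x; rewrite mulr_ge0.
- by apply: measurable_funM => //; exact: measurable_indic.
- by move=> x; rewrite mulr_ge0.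
- apply: aeT => x; apply: cvgM; first exact: cvg_cst.
  apply/cvg_seqP => e e0; exists (Num.truncn `|x|) => n hn.
  have xn : `|x| <= n.+1%:R.
    by apply: le_trans (ltW (truncnS_gt _)) _; rewrite ler_nat ltnS.
  rewrite !indicE; have [x0|x0] := leP 0 x.
    rewrite !mem_set ?subrr ?normr0//= in_itv/= x0//=.
    by move: xn; rewrite ger0_norm.
  by rewrite !memNset ?subrr ?normr0//= in_itv/= leNgt x0.
- by move=> n; rewrite E lerB.
apply: (I_halfline cf cF dF Fl hig) => x; last by rewrite mulr_ge0.
by move=> x0; rewrite indicE mem_set ?mulr1 ?ger0_norm//= in_itv/= andbT.
Qed.

Lemma I_even f : meas f -> (forall x, f (- x) = f x) ->
  ig (fun x => f x * \1_(`[0, +oo[) x) ->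
  ig f /\ IR f = 2 * IR (fun x => f x * \1_(`[0, +oo[) x).
Proof.
move=> mf ef hi.
pose h x := f x * \1_(`[0, +oo[) x.
have ho := ig_opp hi.
have hs : ig (fun x => h x + h (- x)) by exact: igD.
have ae : {ae leb R, forall x, h x + h (- x) = f x}.
  exists [set 0]; split => //; first exact: lebesgue_measure_set1.
  move=> x /= hx; apply: contrapT => x0; apply: hx.
  rewrite /h ef !indicE; have [xp|xn|xz] := ltgtP x 0; last by rewrite xz in x0.
    rewrite memNset ?mem_set ?mulr0 ?mulr1 ?add0r//= in_itv/= andbT.
      by rewrite oppr_ge0 ltW.
    by rewrite leNgt xp.
  rewrite mem_set ?memNset ?mulr0 ?mulr1 ?addr0//= in_itv/= andbT ?oppr_ge0 ?leNgt ?xn//.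
  by rewrite -leNgt ltW.
split; first exact: (ig_ae mf ae hs).
rewrite -(I_ae (ig_meas hs) mf ae) ID// (I_opp hi).
by rewrite mulr2n mulrDl !mul1r.
Qed.

End kernels.

(** * The Poisson kernel *)

Section poisson.
Context {R : realType}.
Implicit Types f g K : R -> R.

(** The kernel of the Hartley transform, the real-valued counterpart of the
    Fourier kernel: it is symmetric in x and w when applied to xw, and the
    transform with this kernel is its own inverse up to the factor 2 pi. *)
Definition cas (z : R) : R := cos z + sin z.

Lemma cas_le2 z : `|cas z| <= 2.
Proof.
apply: le_trans (ler_normD _ _) _; rewrite -[leRHS]/(1 + 1 : R).
by rewrite lerD// ?cos_max ?sin_max.
Qed.

Lemma continuous_cas : continuous cas.
Proof. by move=> z; apply: cvgD; [exact: continuous_cos|exact: continuous_sin]. Qed.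

Lemma casN z : cas (- z) = cos z - sin z.
Proof. by rewrite /cas cosN sinN. Qed.

Lemma is_derive_cas (x : R) : is_derive x (1 : R) cas (cas (- x)).
Proof.
rewrite casN addrC; exact: (is_deriveD_R (is_derive_cos x) (is_derive_sin x)).
Qed.

(** An integrable damping factor, which makes Fubini's theorem applicable to the
    iterated transform; its cosine transform is the Poisson kernel. *)
Definition damp (e w : R) : R := expR (- (e * `|w|)).

Definition poisson (e y : R) : R := 2 * e / (e ^+ 2 + y ^+ 2).

Lemma damp_ge0 e w : 0 <= damp e w. Proof. exact: expR_ge0. Qed.

Lemma damp_le1 e w : 0 <= e -> damp e w <= 1.
Proof. by move=> e0; rewrite /damp expR_le1 oppr_le0 mulr_ge0. Qed.

Lemma measurable_damp e : meas (damp e).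
Proof.
apply: continuous_measurable_fun => x; rewrite /damp.
apply: (@continuous_comp _ _ _ (fun w => - (e * `|w|)) expR); last exact: continuous_expR.
by apply: cvgN; apply: cvgM; [exact: cvg_cst|exact: cvg_norm].
Qed.

Lemma exp_null (e : R) : 0 < e -> null_seq (fun n => expR (- (e * n.+1%:R))).
Proof.
move=> e0; apply: null_seq_le (null_seqZ e^-1 (@null_seq_invS R)) => n.
rewrite gtr0_norm ?expR_gt0// expRN -invfM lef_pV2 ?posrE ?expR_gt0//; last first.
  by rewrite mulr_gt0.
by apply: le_trans (expR_ge1Dx _); rewrite lerDr.
Qed.

Let is_derive_lin (c x : R) : is_derive x (1 : R) (fun w => c * w) c.
Proof.
by have := is_derive_affine c 0 x; congr is_derive; apply/funext => w; rewrite addr0.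
Qed.

Lemma damp_half (e : R) : 0 < e ->
  ig (fun w => expR (- e * w) * \1_(`[0, +oo[) w).
Proof.
move=> e0; have en : - e != 0 by rewrite oppr_eq0 gt_eqF.
have d (x : R) : is_derive x (1 : R) (fun w => expR (- e * w) * (- e)^-1) (expR (- e * x)).
  have := is_deriveM_R (is_derive_comp_R (is_derive_expR _) (is_derive_lin (- e) x))
     (is_derive_cst (- e)^-1 x (1 : R)).
  by move=> h; apply: (is_derive_eq h); rewrite mulr0 addr0 mulfK.
have [||| i _] := I_halfline_ge0 (l := 0) _ (fun x => is_derive_cont (d x)) (fun x _ => d x); last exact: i.
- by move=> x; apply: is_derive_cont;
    exact: (is_derive_comp_R (is_derive_expR _) (is_derive_lin (- e) x)).
- apply/null_seqP.
  have := null_seqZ (- e)^-1 (exp_null e0); congr null_seq.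
  by apply/funext => n; rewrite mulrC mulNr.
- by move=> x; exact: expR_ge0.
Qed.

Lemma ig_damp (e : R) : 0 < e -> ig (damp e).
Proof.
move=> e0; have [|| i _] := @I_even _ (damp e) (@measurable_damp e); last exact: i.
  by move=> x; rewrite /damp normrN.
have := damp_half e0; congr ig; apply/funext => x; rewrite indicE.
case: (boolP (x \in _)) => xi; last by rewrite !mulr0.
move: xi; rewrite inE/= in_itv/= andbT => x0.
by rewrite /damp ger0_norm// mulNr.
Qed.

Lemma ig_damp_cos (e y : R) : 0 < e -> ig (fun w => damp e w * cos (y * w)).
Proof.
move=> e0; apply: (ig_le _ (ig_damp e0)) => [|w].
  apply: measurable_funM; first exact: measurable_damp.
  apply: continuous_measurable_fun => w.
  apply: (@continuous_comp _ _ _ (fun w => y * w) cos); last exact: continuous_cos.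
  by apply: cvgM; [exact: cvg_cst|exact: cvg_id].
by rewrite normrM ger0_norm ?damp_ge0// -[leRHS]mulr1 ler_wpM2l ?damp_ge0 ?cos_max.
Qed.

(** The integrand has an explicit antiderivative on the half-line and is even. *)
Lemma I_damp_cos (e y : R) : 0 < e ->
  IR (fun w => damp e w * cos (y * w)) = poisson e y.
Proof.
move=> e0; have D0 : e ^+ 2 + y ^+ 2 != 0.
  by rewrite gt_eqF// ltr_pwDl ?exprn_gt0 ?sqr_ge0.
have [mf gi] : meas (fun w => damp e w * cos (y * w)) /\
    ig (fun w => damp e w * cos (y * w)).
  by split; [apply: ig_meas|]; exact: ig_damp_cos.
(* The antiderivative, by integrating by parts twice. *)
pose F (w : R) := expR (- e * w) * ((y * sin (y * w) - e * cos (y * w)) / (e ^+ 2 + y ^+ 2)).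
have ds (x : R) : is_derive x (1 : R) (fun w => sin (y * w)) (cos (y * x) * y).
  exact: (is_derive_comp_R (is_derive_sin _) (is_derive_lin y x)).
have dc (x : R) : is_derive x (1 : R) (fun w => cos (y * w)) (- sin (y * x) * y).
  exact: (is_derive_comp_R (is_derive_cos _) (is_derive_lin y x)).
have de (x : R) : is_derive x (1 : R) (fun w => expR (- e * w)) (expR (- e * x) * - e).
  exact: (is_derive_comp_R (is_derive_expR _) (is_derive_lin (- e) x)).
have d (x : R) : is_derive x (1 : R) F (expR (- e * x) * cos (y * x)).
  have h1 := is_deriveM_R (is_derive_cst y x (1 : R)) (ds x).
  have h2 := is_deriveM_R (is_derive_cst (- e) x (1 : R)) (dc x).
  have h3 := is_deriveM_R (is_deriveD_R h1 h2)
    (is_derive_cst (e ^+ 2 + y ^+ 2)^-1 x (1 : R)).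
  have h := is_deriveM_R (de x) h3.
  have -> : F = (fun w => expR (- e * w) * ((y * sin (y * w) + - e * cos (y * w)) *
      (e ^+ 2 + y ^+ 2)^-1)).
    by apply/funext => w; rewrite /F (mulNr e (cos _)).
  by apply: (is_derive_eq h); rewrite /cst; field.
have E : (fun x => damp e x * cos (y * x) * \1_(`[0, +oo[) x) =
    (fun x => expR (- e * x) * cos (y * x) * \1_(`[0, +oo[) x).
  apply/funext => x; rewrite indicE; case: (boolP (x \in _)) => xi; last by rewrite !mulr0.
  move: xi; rewrite inE/= in_itv/= andbT => x0.
  by rewrite /damp ger0_norm// mulNr.
have [||||i1 i2] := I_halfline (l := 0) _ (fun x => is_derive_cont (d x))
  (fun x _ => d x) _ (ig_damp e0).
- by move=> x; apply: cvgM; [exact: (is_derive_cont (de x))|exact: (is_derive_cont (dc x))].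
- apply/null_seqP.
  apply: null_seq_le (null_seqZ ((`|y| + e) / (e ^+ 2 + y ^+ 2)) (exp_null e0)) => n.
  rewrite /F normrM gtr0_norm ?expR_gt0// mulNr mulrC ler_wpM2r ?expR_ge0//.
  rewrite normrM [X in _ * X]gtr0_norm ?invr_gt0 ?ltr_pwDl ?exprn_gt0 ?sqr_ge0//.
  rewrite ler_wpM2r ?invr_ge0 ?addr_ge0 ?sqr_ge0//.
  apply: le_trans (ler_normB _ _) _; rewrite !normrM (gtr0_norm e0).
  have := sin_max (y * n.+1%:R); have := cos_max (y * n.+1%:R).
  by have := normr_ge0 y; nra.
- move=> x x0; have -> : damp e x = expR (- e * x) by rewrite /damp ger0_norm// mulNr.
  by rewrite normrM gtr0_norm ?expR_gt0// -[leRHS]mulr1 ler_wpM2l ?expR_ge0 ?cos_max.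
- by move=> x; exact: damp_ge0.
have [||_ ->] := I_even mf _ _.
- by move=> x; rewrite /damp normrN mulrN cosN.
- by rewrite E.
rewrite E i2 /F mulr0 mulr0 expR0 sin0 cos0 /poisson; field; exact: D0.
Qed.

Lemma I_damp_sin (e y : R) : 0 < e -> IR (fun w => damp e w * sin (y * w)) = 0 /\
  ig (fun w => damp e w * sin (y * w)).
Proof.
move=> e0; have i : ig (fun w => damp e w * sin (y * w)).
  apply: (ig_le _ (ig_damp e0)) => [|w].
    apply: measurable_funM; first exact: measurable_damp.
    apply: continuous_measurable_fun => w.
    apply: (@continuous_comp _ _ _ (fun w => y * w) sin); last exact: continuous_sin.
    by apply: cvgM; [exact: cvg_cst|exact: cvg_id].
  by rewrite normrM ger0_norm ?damp_ge0// -[leRHS]mulr1 ler_wpM2l ?damp_ge0 ?sin_max.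
by split => //; apply: I_odd => // w; rewrite /damp normrN mulrN sinN mulrN.
Qed.

(** The product cas(xw) cas(yw) is cos((x - y)w) + sin((x + y)w), and the sine
    term is odd in w. *)
Lemma I_damp_cas2 (e x y : R) : 0 < e ->
  IR (fun w => damp e w * cas (x * w) * cas (y * w)) = poisson e (x - y).
Proof.
move=> e0; have [s0 si] := I_damp_sin (x + y) e0.
rewrite -I_damp_cos// -[RHS]addr0 -s0 -ID//; last exact: ig_damp_cos.
apply: I_ext => w.
rewrite (_ : (x - y) * w = x * w - y * w); last by ring.
rewrite (_ : (x + y) * w = x * w + y * w); last by ring.
by rewrite cosB sinD /cas; ring.
Qed.

(** The antiderivative is 2 atan. *)
Lemma I_cauchy : ig (fun z : R => 2 / (1 + z ^+ 2)) /\
  IR (fun z : R => 2 / (1 + z ^+ 2)) = 2 * pi.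
Proof.
have p0 (z : R) : 0 < 1 + z ^+ 2 by rewrite ltr_pwDl ?sqr_ge0.
have cz : continuous (fun z : R => 2 / (1 + z ^+ 2)).
  move=> z; apply: cvgM; first exact: cvg_cst.
  apply: cvgV; first by rewrite gt_eqF.
  apply: cvgD; first exact: cvg_cst.
  by apply: cvgM; exact: cvg_id.
have d (x : R) : is_derive x (1 : R) (fun z => 2 * atan z) (2 / (1 + x ^+ 2)).
  have da : is_derive x (1 : R) (@atan R) (1 + x ^+ 2)^-1.
    exact: is_derive1_atan.
  have := is_deriveM_R (is_derive_cst (2 : R) x (1 : R)) da.
  by move=> h; apply: (is_derive_eq h); rewrite mul0r add0r.
have l : 2 * atan n.+1%:R @[n --> \oo] --> (pi : R).
  have -> : (pi : R) = 2 * (pi / 2) by field.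
  apply: cvgM; first exact: cvg_cst.
  apply: (cvg_comp (fun n => n.+1%:R)); last exact: cvgy_atan.
  by apply/cvgryPge => A; exists (Num.truncn `|A|) => // n /= hn;
    apply: le_trans (ler_norm _) _; apply: le_trans (ltW (truncnS_gt _)) _;
    rewrite ler_nat ltnS.
have [|i1 i2] := I_halfline_ge0 cz (fun x => is_derive_cont (d x)) (fun x _ => d x) l.
  by move=> x; rewrite divr_ge0// ltW.
have [||i3 i4] := I_even _ _ i1; first exact: continuous_measurable_fun.
  by move=> x; rewrite sqrrN.
by split => //; rewrite i4 i2 atan0 mulr0 subr0.
Qed.

(** With z = (n+1)(x - y) the kernel becomes 2/(1 + z^2), of total mass 2 pi, and
    K(x - z/(n+1)) tends to K x. *)
Lemma poisson_conv K (M x : R) : meas K -> (forall y, `|K y| <= M) ->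
  {for x, continuous K} ->
  (forall n, ig (fun y => K y * poisson n.+1%:R^-1 (x - y)) /\
    `|IR (fun y => K y * poisson n.+1%:R^-1 (x - y))| <= M * (2 * pi)) /\
  IR (fun y => K y * poisson n.+1%:R^-1 (x - y)) @[n --> \oo] --> 2 * pi * K x.
Proof.
move=> mK KM cK.
have [ci cI] := I_cauchy.
have p0 (z : R) : 0 < 1 + z ^+ 2 by rewrite ltr_pwDl ?sqr_ge0.
have M0 : 0 <= M by apply: le_trans (KM 0).
pose h n z := K (x - n.+1%:R^-1 * z) * (2 / (1 + z ^+ 2)).
have mh n : meas (h n).
  apply: measurable_funM; last exact: ig_meas.
  apply: (measurableT_comp mK); apply: continuous_measurable_fun => z.
  apply: cvgB; first exact: cvg_cst.
  by apply: cvgM; [exact: cvg_cst|exact: cvg_id].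
have hb n z : `|h n z| <= M * (2 / (1 + z ^+ 2)).
  rewrite /h normrM [X in _ * X]gtr0_norm ?divr_gt0// ler_wpM2r//.
  by rewrite divr_ge0// ltW.
have Gi : ig (fun z : R => M * (2 / (1 + z ^+ 2))) by exact: igZ.
have hi n : ig (h n) by exact: ig_le (mh n) Gi (hb n).
have e0 n : 0 < n.+1%:R^-1 :> R by rewrite invr_gt0 ltr0n.
have key n : ig (fun y => K y * poisson n.+1%:R^-1 (x - y)) /\
    IR (fun y => K y * poisson n.+1%:R^-1 (x - y)) = IR (h n).
  have en : (n.+1%:R : R) != 0 by rewrite pnatr_eq0.
  have b0 : - n.+1%:R != 0 :> R by rewrite oppr_eq0.
  have [ai aI] := I_affine (n.+1%:R * x) b0 (hi n).
  have E y : n.+1%:R * h n (n.+1%:R * x + - n.+1%:R * y) =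
      K y * poisson n.+1%:R^-1 (x - y).
    rewrite /h (_ : x - _ = y); last by move: en; move: (n.+1%:R : R) => N N0; field.
    rewrite mulrCA; congr (_ * _); rewrite /poisson.
    have n1 : 1 + (n.+1%:R * x + - n.+1%:R * y) ^+ 2 != 0 by rewrite gt_eqF.
    have n2 : n.+1%:R ^- 2 + (x - y) ^+ 2 != 0.
      by rewrite gt_eqF// ltr_pwDl ?sqr_ge0// invr_gt0 exprn_gt0// ltr0n.
    rewrite exprVn; apply/eqP; rewrite mulrA eqr_div//; apply/eqP.
    move: n2 n1 en; move: (n.+1%:R) => N _ _ N0; field; exact: N0.
  have := igZ n.+1%:R ai; have := IZ n.+1%:R ai; rewrite aI.
  rewrite normrN ger0_norm//= (_ : (fun y => n.+1%:R * _) =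
    (fun y => K y * poisson n.+1%:R^-1 (x - y))); last exact/funext.
  by move=> -> ii; split => //; rewrite mulrC divfK.
split=> [n|].
  have [i ->] := key n; split => //.
  by rewrite -cI -IZ//; exact: I_abs_le.
have -> : (fun n => IR (fun y => K y * poisson n.+1%:R^-1 (x - y))) = (fun n => IR (h n)).
  by apply/funext => n; case: (key n).
have -> : 2 * pi * K x = IR (fun z => K x * (2 / (1 + z ^+ 2))).
  by rewrite IZ// cI mulrC.
have [|_ c] := @DCTe _ h (fun z => K x * (2 / (1 + z ^+ 2))) _ mh _ Gi hb; last exact: c.
move=> z; apply: cvgM; last exact: cvg_cst.
have L : x - n.+1%:R^-1 * z @[n --> \oo] --> x - 0 * z.
  apply: cvgB; first exact: cvg_cst.
  by apply: cvgM; [exact: (@cvg_harmonic R)|exact: cvg_cst].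
rewrite mul0r subr0 in L; exact: (cvg_comp _ _ L cK).
Qed.

End poisson.

(** * The Hartley transform *)

Section hartley.
Context {R : realType}.
Implicit Types f g K phi : R -> R.

(** If C and S are the cosine and sine transforms, the Fourier transform is C - iS
    and this one is C + S; for real functions both carry the same information. *)
Definition hartley f (w : R) : R := IR (fun x => f x * cas (x * w)).

Lemma cont_casM (w : R) : continuous (fun x : R => cas (x * w)).
Proof.
move=> x; apply: (@continuous_comp _ _ _ (fun x : R => x * w) cas).
  by apply: cvgM; [exact: cvg_id|exact: cvg_cst].
exact: continuous_cas.
Qed.

Lemma hartley_ig f w : ig f -> ig (fun x => f x * cas (x * w)).
Proof.
move=> fi; apply: (ig_le _ (igZ 2 (ig_abs fi))) => [|x].
  apply: measurable_funM; first exact: ig_meas.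
  by apply: continuous_measurable_fun; exact: cont_casM.
by rewrite normrM mulrC ler_wpM2r// cas_le2.
Qed.

Lemma hartley_bound f w : ig f -> `|hartley f w| <= 2 * IR (fun x => `|f x|).
Proof.
move=> fi; rewrite -IZ; last exact: ig_abs.
apply: I_abs_le; [exact: hartley_ig|exact: igZ (ig_abs fi)|].
by move=> x; rewrite normrM mulrC ler_wpM2r// cas_le2.
Qed.

Lemma hartley_cont f : ig f -> continuous (hartley f).
Proof.
move=> fi w; apply/(@cvg_nbhsP _ R^o) => w_ cw.
have [|||_ c] := @DCTe _ (fun n x => f x * cas (x * w_ n)) (fun x => f x * cas (x * w))
  (fun x => 2 * `|f x|) _ _ (igZ 2 (ig_abs fi)) _; last exact: c.
- by move=> n; apply: ig_meas; exact: hartley_ig.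
- move=> x; apply: cvgM; first exact: cvg_cst.
  apply: (cvg_comp (fun n => x * w_ n)); last exact: continuous_cas.
  by apply: cvgM => //; exact: cvg_cst.
- by move=> n x; rewrite normrM mulrC ler_wpM2r// cas_le2.
Qed.

Lemma hartley_meas f : ig f -> meas (hartley f).
Proof. by move=> fi; apply: continuous_measurable_fun; exact: hartley_cont. Qed.

Lemma hartleyD f g w : ig f -> ig g ->
  hartley (fun x => f x + g x) w = hartley f w + hartley g w.
Proof.
move=> fi gi; rewrite /hartley -ID; try exact: hartley_ig.
by apply: I_ext => x; rewrite mulrDl.
Qed.

Lemma hartleyZ c f w : ig f -> hartley (fun x => c * f x) w = c * hartley f w.
Proof.
move=> fi; rewrite /hartley -IZ; last exact: hartley_ig.
by apply: I_ext => x; rewrite mulrA.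
Qed.

Let meas_cas2 : measurable_fun [set: R * R] (fun z : R * R => cas (z.1 * z.2)).
Proof.
apply: (@measurableT_comp _ _ _ _ _ _ cas).
  by apply: continuous_measurable_fun; exact: continuous_cas.
by apply: measurable_funM; [exact: measurable_fst|exact: measurable_snd].
Qed.

(** Fubini's theorem: the inner integral of damp(w) cas(yw) cas(xw) over w is the
    Poisson kernel. *)
Lemma hartley_damp K (e x : R) : 0 < e -> ig K ->
  IR (fun w => damp e w * hartley K w * cas (x * w)) =
  IR (fun y => K y * poisson e (x - y)).
Proof.
move=> e0 Ki.
pose h w y := damp e w * cas (x * w) * (K y * cas (y * w)).
have mh : measurable_fun [set: R * R] (fun z : R * R => h z.1 z.2).
  apply: measurable_funM; apply: measurable_funM.
  - exact: (measurableT_comp (@measurable_damp R e) measurable_fst).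
  - have m : meas (fun w => cas (x * w)).
      have := @continuous_measurable_fun R (fun w => cas (w * x)) (@cont_casM x).
      by congr measurable_fun; apply/funext => w; rewrite mulrC.
    exact: (measurableT_comp m measurable_fst).
  - exact: (measurableT_comp (ig_meas Ki) measurable_snd).
  - have := measurableT_comp meas_cas2 (@measurable_swap _ _ R R).
    exact.
have hb w y : `|h w y| <= (2 * damp e w) * (2 * `|K y|).
  rewrite /h !normrM (ger0_norm (damp_ge0 e w)).
  rewrite [2 * damp e w]mulrC [2 * `|K y|]mulrC.
  by rewrite ler_pM ?mulr_ge0 ?damp_ge0// ler_wpM2l ?damp_ge0 ?cas_le2.
have [_ _ E] := fubiniR mh (igZ 2 (ig_damp e0)) (igZ 2 (ig_abs Ki)) hb.
transitivity (IR (fun w => IR (h w))).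
  apply: I_ext => w; rewrite /h IZ; last exact: hartley_ig.
  by rewrite mulrAC.
rewrite E; apply: I_ext => y; rewrite -I_damp_cas2// -IZ.
  by apply: I_ext => w; rewrite /h; ring.
apply: (ig_le _ (igZ 4 (ig_damp e0))).
  apply: measurable_funM.
    apply: measurable_funM; first exact: measurable_damp.
    have := @continuous_measurable_fun R (fun w => cas (w * x)) (@cont_casM x).
    by congr measurable_fun; apply/funext => w; rewrite mulrC.
  have := @continuous_measurable_fun R (fun w => cas (w * y)) (@cont_casM y).
  by congr measurable_fun; apply/funext => w; rewrite mulrC.
move=> w; rewrite !normrM (ger0_norm (damp_ge0 e w)).
have := cas_le2 (x * w); have := cas_le2 (y * w); have := damp_ge0 e w.
have := normr_ge0 (cas (x * w)); have := normr_ge0 (cas (y * w)).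
move: `|_| `|cas _| (damp e w) => a b c a0 b0 c0 a2 b2.
rewrite -mulrA mulrC ler_wpM2r//; nra.
Qed.

Lemma sq_bounded f (M : R) : ig f -> (forall x, `|f x| <= M) -> sq f.
Proof.
move=> fi fM; split; first exact: ig_meas.
apply: (ig_le _ (igZ M (ig_abs fi))) => [|x].
  by apply: measurable_funX; exact: ig_meas.
by rewrite expr2 normrM ler_wpM2r.
Qed.

Lemma damp_cvg1 (w : R) : damp n.+1%:R^-1 w @[n --> \oo] --> (1 : R).
Proof.
have L : - (n.+1%:R^-1 * `|w|) @[n --> \oo] --> - (0 * `|w|).
  by apply: cvgN; apply: cvgM; [exact: (@cvg_harmonic R)|exact: cvg_cst].
have := cvg_comp _ _ L (@continuous_expR R (- (0 * `|w|))).
by rewrite mul0r oppr0 expR0.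
Qed.

(** The damped integral of the squared transform equals, by Fubini's theorem, the
    integral of K against its Poisson means, which tend to 2 pi K. Fatou's lemma
    then shows that the transform is square integrable, and dominated
    convergence removes the damping. The origin is exempted because K will involve
    the sign of w. *)
Theorem plancherel K (M : R) : ig K -> (forall y, `|K y| <= M) ->
  (forall x, x != 0 -> {for x, continuous K}) ->
  sq (hartley K) /\ nsq (hartley K) = 2 * pi * nsq K.
Proof.
move=> Ki KM Kc.
have mK := ig_meas Ki; have mT := hartley_meas Ki.
have [mK2 iK2] := sq_bounded Ki KM.
have M0 : 0 <= M by apply: le_trans (KM 0).
have e0 n : 0 < n.+1%:R^-1 :> R by rewrite invr_gt0 ltr0n.
pose B := 2 * IR (fun x => `|K x|).
have TB w : `|hartley K w| <= B by exact: hartley_bound.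
pose A n w := damp n.+1%:R^-1 w * hartley K w ^+ 2.
have Ai n : ig (A n).
  apply: (ig_le _ (igZ (B ^+ 2) (ig_damp (e0 n)))).
    by apply: measurable_funM; [exact: measurable_damp|exact: measurable_funX].
  move=> w; rewrite /A normrM ger0_norm ?damp_ge0// mulrC ler_wpM2r ?damp_ge0//.
  by rewrite normrX lerXn2r// nnegrE// (le_trans _ (TB 0)).
pose Q n x := IR (fun y => K y * poisson n.+1%:R^-1 (x - y)).
have AQ n : ig (fun x => K x * Q n x) /\ IR (A n) = IR (fun x => K x * Q n x).
  pose h w x := damp n.+1%:R^-1 w * hartley K w * (K x * cas (x * w)).
  have mh : measurable_fun [set: R * R] (fun z : R * R => h z.1 z.2).
    apply: measurable_funM; apply: measurable_funM.
    - exact: (measurableT_comp (@measurable_damp R _) measurable_fst).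
    - exact: (measurableT_comp mT measurable_fst).
    - exact: (measurableT_comp mK measurable_snd).
    - have := measurableT_comp meas_cas2 (@measurable_swap _ _ R R).
      exact.
  have hb w x : `|h w x| <= (B * damp n.+1%:R^-1 w) * (2 * `|K x|).
    rewrite /h !normrM (ger0_norm (damp_ge0 _ w)).
    rewrite [B * damp _ w]mulrC [2 * `|K x|]mulrC.
    by rewrite ler_pM ?mulr_ge0 ?damp_ge0// ler_wpM2l ?damp_ge0 ?cas_le2.
  have [_ i E] := fubiniR mh (igZ B (ig_damp (e0 n))) (igZ 2 (ig_abs Ki)) hb.
  have E2 x : IR (h^~ x) = K x * Q n x.
    rewrite /Q -hartley_damp// -IZ.
      by apply: I_ext => w; rewrite /h; ring.
    apply: (ig_le _ (igZ (2 * B) (ig_damp (e0 n)))).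
      apply: measurable_funM.
        by apply: measurable_funM => //; exact: measurable_damp.
      have := @continuous_measurable_fun R (fun w => cas (w * x)) (@cont_casM x).
      by congr measurable_fun; apply/funext => w; rewrite mulrC.
    move=> w; rewrite !normrM (ger0_norm (damp_ge0 _ w)).
    have := cas_le2 (x * w); have := TB w; have := damp_ge0 n.+1%:R^-1 w.
    have := normr_ge0 (cas (x * w)); have := normr_ge0 (hartley K w).
    move: `|hartley _ _| `|cas _| (damp _ w) => a b c a0 b0 c0 a2 b2.
    rewrite -mulrA mulrC ler_wpM2r// mulrC ler_pM//.
  split; first by apply: ig_ext i.
  transitivity (IR (fun w => IR (h w))).
    apply: I_ext => w; rewrite /h IZ; last exact: hartley_ig.
    by rewrite /A expr2 mulrA.
  by rewrite E; apply: I_ext.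
have Qx x : x != 0 -> Q n x @[n --> \oo] --> 2 * pi * K x.
  by move=> x0; have [_] := poisson_conv mK KM (Kc x x0).
have c1 : continuous (fun _ : R => 0 : R) by move=> ?; exact: cvg_cst.
have Qb n x : x != 0 -> `|Q n x| <= M * (2 * pi).
  by move=> x0; have [/(_ n)[]] := poisson_conv mK KM (Kc x x0).
have Acv : IR (A n) @[n --> \oo] --> 2 * pi * nsq K.
  rewrite (_ : (fun n => IR (A n)) = (fun n => IR (fun x => K x * Q n x))); last first.
    by apply/funext => n; case: (AQ n).
  rewrite /nsq -IZ//.
  have z0 n x : (if x == 0 then 0 else K x * Q n x) = (fun x => K x * Q n x) x \/ x = 0.
    by case: eqVneq; [right|left].
  (* The Poisson means converge only away from 0, which is a null set. *)
  pose k n x := if x == 0 then 0 else K x * Q n x.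
  have aek n : {ae leb R, forall x, K x * Q n x = k n x}.
    exists [set 0]; split => //; first exact: lebesgue_measure_set1.
    move=> x /= hx; apply: contrapT => /eqP x0; apply: hx.
    by rewrite /k (negbTE x0).
  have mk n : meas (k n).
    apply: measurable_fun_if => //.
    - apply: (measurable_fun_bool true).
      rewrite setTI (_ : _ @^-1` _ = [set 0]); first exact: measurable_set1.
      by apply/seteqP; split => x /=; [move=> /eqP|move=> ->; rewrite eqxx].
    - by apply: measurable_funS (ig_meas (AQ n).1).
  rewrite (_ : (fun n => _) = (fun n => IR (k n))); last first.
    by apply/funext => n; apply: I_ae => //; apply: ig_meas; case: (AQ n).
  have [||||_ c] := @DCT _ k (fun x => 2 * pi * K x ^+ 2)
    (fun x => M * (2 * pi) * `|K x|) mk; last exact: c.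
  - by apply: ig_meas; exact: igZ.
  - exists [set 0]; split => //; first exact: lebesgue_measure_set1.
    move=> x /= hx; apply: contrapT => /eqP x0; apply: hx.
    rewrite /k (negbTE x0) (_ : 2 * pi * K x ^+ 2 = K x * (2 * pi * K x)); last by ring.
    by apply: cvgM; [exact: cvg_cst|exact: Qx].
  - by apply: igZ; exact: ig_abs.
  - move=> n x; rewrite /k; case: eqVneq => x0.
      by rewrite normr0 !mulr_ge0// pi_ge0.
    by rewrite normrM mulrC ler_wpM2r// Qb.
have Acv2 w : A n w @[n --> \oo] --> hartley K w ^+ 2.
  rewrite -[X in _ --> X]mul1r; apply: cvgM; last exact: cvg_cst.
  exact: damp_cvg1.
have A0 n w : 0 <= A n w by rewrite mulr_ge0 ?sqr_ge0 ?damp_ge0.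
have [Bd hBd] : exists Bd, forall n, IR (A n) <= Bd.
  have /cvg_seq_bounded[Bd [Br hB]] : cvgn (fun n => IR (A n)) by apply: cvgP Acv.
  exists (Bd + 1) => n; have := hB (Bd + 1); rewrite ltrDl ltr01 => /(_ isT n I).
  by apply: le_trans; exact: ler_norm.
have [||||Ti _] := @fatouR _ A (fun w => hartley K w ^+ 2) Bd Ai A0.
- exact: measurable_funX.
- by move=> w; exact: sqr_ge0.
- by apply: aeT.
- exact: hBd.
split => //.
have [||_ c] := @DCTe _ A (fun w => hartley K w ^+ 2) (fun w => hartley K w ^+ 2) _ Acv2 Ti.
- by move=> n; exact: ig_meas.
- move=> n w; rewrite ger0_norm// /A -[leRHS]mul1r ler_wpM2r ?sqr_ge0//.
  by rewrite damp_le1// ltW.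
exact: seq_lim_unique c Acv.
Qed.

(** The damped iterated transform is a Poisson mean of K, and the integrability of
    the transform removes the damping. *)
Theorem hartley_inv K (M : R) : ig K -> (forall y, `|K y| <= M) ->
  continuous K -> ig (hartley K) -> forall x, hartley (hartley K) x = 2 * pi * K x.
Proof.
move=> Ki KM Kc Ti x.
have e0 n : 0 < n.+1%:R^-1 :> R by rewrite invr_gt0 ltr0n.
have [_ c] := poisson_conv (ig_meas Ki) KM (Kc x).
have E : (fun n => IR (fun y => K y * poisson n.+1%:R^-1 (x - y))) =
   (fun n => IR (fun w => damp n.+1%:R^-1 w * hartley K w * cas (x * w))).
  by apply/funext => n; rewrite hartley_damp.
rewrite E in c; apply: seq_lim_unique c.
have mc : meas (fun w => cas (x * w)).
  have := @continuous_measurable_fun R (fun w => cas (w * x)) (@cont_casM x).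
  by congr measurable_fun; apply/funext => w; rewrite mulrC.
have [|||_ c] := @DCTe _
  (fun n w => damp n.+1%:R^-1 w * hartley K w * cas (x * w))
  (fun w => hartley K w * cas (w * x)) (fun w => 2 * `|hartley K w|) _ _
  (igZ 2 (ig_abs Ti)); last exact: c.
- move=> n; apply: measurable_funM => //; apply: measurable_funM; last exact: ig_meas.
  exact: measurable_damp.
- move=> w; rewrite (mulrC w x) -{2}(mul1r (hartley K w)).
  apply: cvgM; last exact: cvg_cst.
  by apply: cvgM; [exact: damp_cvg1|exact: cvg_cst].
- move=> n w; rewrite normrM mulrC; apply: ler_pM => //; first exact: cas_le2.
  rewrite normrM -[leRHS]mul1r ler_wpM2r// ger0_norm ?damp_ge0//.
  by rewrite damp_le1// ltW.
Qed.

End hartley.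

(** * The transform of a test function *)

Section hartley_test.
Context {R : realType}.
Implicit Types f g K phi psi : R -> R.

(** Integration by parts; the derivative of cas at z is cas(-z). *)
Lemma hartley_derive phi w : test_function phi ->
  hartley (derive1 phi) w = - w * hartley phi (- w).
Proof.
move=> tp; have tp' := test_derive tp.
have i1 := hartley_ig w (test_ig tp'); have i2 := hartley_ig (- w) (test_ig tp).
pose F x := phi x * cas (x * w).
have dF (x : R) : is_derive x (1 : R) F
    (derive1 phi x * cas (x * w) + w * (phi x * cas (x * - w))).
  have dl : is_derive x (1 : R) (fun y => y * w) w.
    have := is_derive_affine w 0 x.
    by congr is_derive; apply/funext => y; rewrite addr0 mulrC.
  have := is_deriveM_R (test_is_derive tp x)
    (is_derive_comp_R (f := cas) (g := fun y : R => y * w)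
      (is_derive_cas (x * w)) dl).
  by move=> h; apply: (is_derive_eq h); rewrite mulrN; ring.
have bs f v : bsupp f -> bsupp (fun x => f x * cas (x * v)).
  by move=> [A A0 hA]; exists A => // x hx; rewrite hA// mul0r.
have [_ b] := (test_functionP phi).1 tp.
have [_ b'] := (test_functionP (derive1 phi)).1 tp'.
have : IR (fun x => derive1 phi x * cas (x * w) + w * (phi x * cas (x * - w))) = 0.
  apply: (I_derive_bsupp _ dF).
  - move=> x; apply: cvgD; first by apply: cvgM; [exact: test_cont|exact: cont_casM].
    apply: cvgM; first exact: cvg_cst.
    by apply: cvgM; [exact: test_cont|exact: cont_casM].
  - exact: bs.
  - by apply: bsuppD; [exact: bs|apply: bsuppZ; exact: bs].
rewrite ID//; last exact: igZ.
rewrite IZ// /hartley => h; lra.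
Qed.

(** Differentiating phi twice multiplies its transform by - w^2. *)
Lemma hartley_test_decay phi : test_function phi ->
  exists2 C, 0 <= C & forall w, `|hartley phi w| <= C * (1 + w ^+ 2)^-1.
Proof.
move=> tp; have t1 := test_derive tp; have t2 := test_derive t1.
exists (2 * IR (fun x => `|phi x|) + 2 * IR (fun x => `|derive1 (derive1 phi) x|)).
  by rewrite addr_ge0// mulr_ge0// I_ge0.
move=> w; rewrite ler_pdivlMr ?ltr_pwDl ?sqr_ge0//.
have := hartley_bound w (test_ig t2); have := hartley_bound w (test_ig tp).
rewrite hartley_derive// hartley_derive// opprK !normrM normrN mulrDr mulr1.
move=> h1 h2; apply: lerD => //; apply: le_trans h2.
rewrite -sqr_normr le_eqVlt; apply/orP; left; apply/eqP.
by ring.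
Qed.

Lemma ig_invsq : ig (fun w : R => (1 + w ^+ 2)^-1).
Proof.
have [i _] := @I_cauchy R; apply: ig_ext (igZ 2^-1 i) => w.
by rewrite mulrA mulVf ?mul1r.
Qed.

Lemma hartley_test_ig phi : test_function phi -> ig (hartley phi).
Proof.
move=> tp; have [C C0 hC] := hartley_test_decay tp.
by apply: (ig_le _ (igZ C ig_invsq) hC); apply: hartley_meas; exact: test_ig.
Qed.

Lemma test_bounded phi : test_function phi -> exists2 M, 0 < M & forall x, `|phi x| <= M.
Proof.
move=> tp; have [_ b] := (test_functionP phi).1 tp.
have [M M0 [A _ h]] := bsupp_bounded (test_cont tp) b.
exists M => // x; apply: (le_trans (h x)); rewrite indicE.
by case: (_ \in _); rewrite ?mulr1 ?mulr0// ltW.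
Qed.

Lemma hartley_test_sq phi : test_function phi ->
  sq (hartley phi) /\ nsq (hartley phi) = 2 * pi * nsq phi.
Proof.
move=> tp; have [M _ hM] := test_bounded tp.
by apply: (plancherel (test_ig tp) hM) => x _; exact: test_cont.
Qed.

Lemma hartley_test_inv phi x : test_function phi ->
  hartley (hartley phi) x = 2 * pi * phi x.
Proof.
move=> tp; have [M _ hM] := test_bounded tp.
apply: (hartley_inv (test_ig tp) hM); first exact: test_cont.
exact: hartley_test_ig.
Qed.

(** Fubini's theorem, as the kernel cas(xw) is symmetric. *)
Lemma hartley_sym f g : ig f -> ig g ->
  IR (fun w => hartley f w * g w) = IR (fun x => f x * hartley g x).
Proof.
move=> fi gi.
pose h w x := g w * (f x * cas (x * w)).
have m2 : measurable_fun [set: R * R] (fun z : R * R => cas (z.2 * z.1)).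
  apply: (@measurableT_comp _ _ _ _ _ _ cas).
    by apply: continuous_measurable_fun; exact: continuous_cas.
  by apply: measurable_funM; [exact: measurable_snd|exact: measurable_fst].
have mh : measurable_fun [set: R * R] (fun z : R * R => h z.1 z.2).
  apply: measurable_funM; last apply: measurable_funM => //.
  - exact: (measurableT_comp (ig_meas gi) measurable_fst).
  - exact: (measurableT_comp (ig_meas fi) measurable_snd).
have hb w x : `|h w x| <= `|g w| * (2 * `|f x|).
  by rewrite /h !normrM ler_wpM2l// mulrC ler_wpM2r// cas_le2.
have [_ _ E] := fubiniR mh (ig_abs gi) (igZ 2 (ig_abs fi)) hb.
transitivity (IR (fun w => IR (h w))).
  apply: I_ext => w; rewrite /h IZ; last exact: hartley_ig.
  by rewrite mulrC.
rewrite E; apply: I_ext => x; rewrite /hartley -IZ; last exact: hartley_ig.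
by apply: I_ext => w; rewrite /h (mulrC w x); ring.
Qed.

End hartley_test.

(** * The weight |w|^alpha *)
Section weight.
Context {R : realType}.
Variable alpha : R.
Hypotheses (alpha_gt : 1 / 2 < alpha) (alpha_lt : alpha < 1).
Implicit Types phi psi : R -> R.

Let alpha0 : 0 < alpha.
Proof. by apply: lt_trans alpha_gt; rewrite divr_gt0. Qed.

Definition wt (w : R) : R := `|w| `^ alpha.

Lemma wt_ge0 w : 0 <= wt w. Proof. exact: powR_ge0. Qed.

Lemma wtN w : wt (- w) = wt w. Proof. by rewrite /wt normrN. Qed.

Lemma wt_le w : wt w <= 1 + `|w|.
Proof.
rewrite /wt; have [w1|w1] := leP `|w| 1.
  have h : `|w| `^ alpha <= 1 `^ alpha.
    by apply: ge0_ler_powR => //; rewrite ?nnegrE// ltW.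
  by apply: (le_trans h); rewrite powR1 lerDl.
have h : `|w| `^ alpha <= `|w| `^ 1 by rewrite ler_powR// ltW.
by apply: (le_trans h); rewrite powRr1// lerDr.
Qed.

Lemma wt_cont w : w != 0 -> {for w, continuous wt}.
Proof.
move=> w0; have wp : 0 < `|w| by rewrite normr_gt0.
apply: (@continuous_comp _ _ _ (fun x : R => `|x|) (fun y => y `^ alpha)).
  exact: norm_continuous.
exact: (is_derive_cont (is_derive1_powR alpha wp)).
Qed.

Lemma measurable_wt : meas wt.
Proof.
apply: (measurableT_comp (measurable_powR alpha)).
by apply: continuous_measurable_fun; exact: norm_continuous.
Qed.

(** Comparison with (1 + |w|)^(- 2 alpha), which is integrable since
    alpha > 1/2. *)
Lemma ig_inv_wt : ig (fun w => (1 + wt w ^+ 2)^-1).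
Proof.
have ag := alpha_gt; have al := alpha_lt.
pose f (w : R) := (1 + `|w|) `^ (- (2 * alpha)).
pose F (w : R) := (1 - 2 * alpha)^-1 * (1 + `|w|) `^ (1 - 2 * alpha).
have pw (w : R) : 0 < 1 + `|w| by rewrite ltr_pwDl.
have cw : continuous (fun w : R => 1 + `|w|).
  by move=> w; apply: cvgD; [exact: cvg_cst|exact: norm_continuous].
have cpow b : continuous (fun w : R => (1 + `|w|) `^ b).
  move=> w; apply: (@continuous_comp _ _ _ (fun x : R => 1 + `|x|) (fun y => y `^ b)).
    exact: cw.
  exact: (is_derive_cont (is_derive1_powR b (pw w))).
have a2 : 1 - 2 * alpha != 0 by rewrite lt_eqF//; lra.
have cF : continuous F by move=> w; apply: cvgM; [exact: cvg_cst|exact: cpow].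
have dF (x : R) : 0 < x -> is_derive x (1 : R) F (f x).
  move=> x0; have px : 0 < 1 * x + 1 by rewrite mul1r ltr_wpDl // ltW.
  have d1 := is_derive_comp_R (f := fun y : R => y `^ (1 - 2 * alpha))
    (g := fun w : R => 1 * w + 1) (is_derive1_powR (1 - 2 * alpha) px)
    (is_derive_affine 1 1 x).
  have d2 := is_deriveM_R (is_derive_cst (1 - 2 * alpha)^-1 x (1 : R)) d1.
  have d3 : is_derive x (1 : R) (fun w => (1 - 2 * alpha)^-1 * (1 * w + 1) `^ (1 - 2 * alpha)) (f x).
    apply: (is_derive_eq d2).
    rewrite /f mul0r add0r mulr1 mulrA /cst mulVf// mul1r gtr0_norm// mul1r (addrC x).
    by congr (_ `^ _); ring.
  apply: (is_derive_near x0 _ d3) => h; rewrite ltr_norml => /andP[h1 h2].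
  have xh : 0 <= x + h by rewrite ltW// -ltrBlDl sub0r.
  by rewrite /F ger0_norm// mul1r (addrC 1 (x + h)).
have lF : F n.+1%:R @[n --> \oo] --> (0 : R).
  apply/null_seqP; apply/null_seqP.
  rewrite -(mulr0 (1 - 2 * alpha)^-1); apply: cvgM; first exact: cvg_cst.
  have b0 : 0 < 2 * alpha - 1 by lra.
  have h1 : n.+1%:R^-1 `^ (2 * alpha - 1) @[n --> \oo] --> (0 : R).
    apply: ((cvg_at_rightP (fun a => a `^ (2 * alpha - 1)) 0 0).1 (powR_cvg0 b0)).
    by split; [move=> n; rewrite invr_gt0|exact: (@cvg_harmonic R)].
  have/null_seqP h1' := h1; apply/null_seqP; apply: null_seq_le h1' => n.
  rewrite ger0_norm ?powR_ge0// -(opprB _ 1) powRN -powR_inv1 ?powR_ge0//.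
  rewrite -powRrM mulrC powRrM powR_inv1; last by rewrite ltW.
  apply: ge0_ler_powR; rewrite ?nnegrE ?invr_ge0 ?(ltW b0) ?(ltW (pw _))//.
  by rewrite lef_pV2 ?posrE// ger0_norm// lerDr.
have [i1 _] := I_halfline_ge0 (cpow (- (2 * alpha))) cF dF lF (fun x => powR_ge0 _ _).
have [||i2 _] := I_even _ _ i1.
- by apply: continuous_measurable_fun; exact: cpow.
- by move=> x; rewrite normrN.
apply: (ig_le _ (igZ (2 `^ (2 * alpha)) i2)).
  rewrite (_ : (fun w => _) = (fun w => (1 + wt w ^+ 2) `^ (-1))); last first.
    by apply/funext => w; rewrite powR_inv1// addr_ge0 ?sqr_ge0.
  apply: (measurableT_comp (measurable_powR (-1))).
  by apply: measurable_funD => //; apply: measurable_funX; exact: measurable_wt.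
move=> w; have p1 : 0 < 1 + wt w ^+ 2 by rewrite ltr_pwDl ?sqr_ge0.
rewrite ger0_norm; last by rewrite invr_ge0 ltW.
rewrite powRN ler_pdivlMr ?powR_gt0// mulrC ler_pdivrMr//.
have E : wt w ^+ 2 = `|w| `^ (2 * alpha).
  by rewrite /wt -powR_mulrn ?powR_ge0// -powRrM mulrC.
rewrite E; have b2 : 0 <= 2 * alpha by lra.
have [w1|w1] := leP `|w| 1.
  apply: (@le_trans _ _ (2 `^ (2 * alpha))).
    apply: ge0_ler_powR; rewrite ?nnegrE ?(ltW (pw _))//.
    by rewrite -[leRHS]/(1 + 1) lerD2l.
  by rewrite ler_peMr ?powR_ge0// lerDl powR_ge0.
apply: (@le_trans _ _ ((2 * `|w|) `^ (2 * alpha))).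
  apply: ge0_ler_powR; rewrite ?nnegrE ?(ltW (pw _)) ?mulr_ge0 ?(ltW alpha0)//.
  by rewrite mulr_natl mulr2n lerD2r ltW.
by rewrite powRM// ler_wpM2l ?powR_ge0// lerDr.
Qed.

Lemma wt_hartley_bound phi : test_function phi -> exists2 C, 0 <= C &
  forall w, `|wt w * hartley phi w| <= C * (1 + w ^+ 2)^-1.
Proof.
move=> tp; have [C C0 hC] := hartley_test_decay tp.
have [C' C'0 hC'] := hartley_test_decay (test_derive tp).
exists (C + C'); first exact: addr_ge0.
move=> w; rewrite normrM (ger0_norm (wt_ge0 w)).
apply: (@le_trans _ _ ((1 + `|w|) * `|hartley phi w|)).
  by rewrite ler_wpM2r// wt_le.
rewrite !mulrDl mul1r lerD//; have := hC' (- w).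
by rewrite hartley_derive// opprK normrM sqrrN.
Qed.

Lemma wt_hartley_meas phi : test_function phi -> meas (fun w => wt w * hartley phi w).
Proof.
move=> tp; apply: measurable_funM; first exact: measurable_wt.
by apply: hartley_meas; exact: test_ig.
Qed.

Lemma wt_hartley_ig phi : test_function phi -> ig (fun w => wt w * hartley phi w).
Proof.
move=> tp; have [C C0 hC] := wt_hartley_bound tp.
exact: (ig_le (wt_hartley_meas tp) (igZ C ig_invsq) hC).
Qed.

Lemma wt_hartley_sq phi : test_function phi -> sq (fun w => wt w * hartley phi w).
Proof.
move=> tp; have [C C0 hC] := wt_hartley_bound tp.
apply: (sq_bounded (wt_hartley_ig tp) (M := C)) => w.
apply: (le_trans (hC w)); rewrite -[leRHS]mulr1 ler_wpM2l// invf_le1 ?lerDl ?sqr_ge0//.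
by rewrite ltr_pwDl ?sqr_ge0.
Qed.

(** The Hartley symbol of the fractional derivative of a test function: the
    multiplier rotates by the angle pi alpha / 2 between the transform and its
    reflection. *)
Definition LW_symbol phi (w : R) : R :=
  cos (pi * alpha * Num.sg w / 2) * (wt w * hartley phi w) -
  sin (pi * alpha * Num.sg w / 2) * (wt w * hartley phi (- w)).

Lemma measurable_sg : meas (fun w : R => Num.sg w).
Proof.
have -> : (fun w : R => Num.sg w) = (fun w => \1_(`]0, +oo[) w - \1_(`]-oo, 0[) w).
  apply/funext => w; rewrite !indicE; have [w0|w0|->] := ltgtP w 0.
  - by rewrite ltr0_sg// memNset ?mem_set ?sub0r//= in_itv/= ?andbT// ltNge (ltW w0).
  - by rewrite gtr0_sg// mem_set ?memNset ?subr0//= in_itv/= ?andbT// ltNge (ltW w0).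
  - by rewrite sgr0 !memNset ?subrr//= in_itv/= ltxx.
by apply: measurable_funB; exact: measurable_indic.
Qed.

Lemma wt_hartley_cont phi w : w != 0 -> test_function phi ->
  {for w, continuous (fun w => wt w * hartley phi w)}.
Proof.
move=> w0 tp; apply: cvgM; first exact: wt_cont.
by apply: hartley_cont; exact: test_ig.
Qed.

Lemma LW_symbol_props phi : test_function phi ->
  [/\ ig (LW_symbol phi), exists M, forall w, `|LW_symbol phi w| <= M &
      forall w, w != 0 -> {for w, continuous (LW_symbol phi)}].
Proof.
move=> tp; have [C C0 hC] := wt_hartley_bound tp.
have hC' w : `|wt w * hartley phi (- w)| <= C * (1 + w ^+ 2)^-1.
  by have := hC (- w); rewrite wtN sqrrN.
have mt : meas (fun w : R => pi * alpha * Num.sg w / 2).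
  by apply: measurable_funM => //; apply: measurable_funM => //; exact: measurable_sg.
have mc : meas (fun w : R => cos (pi * alpha * Num.sg w / 2)).
  apply: (measurableT_comp _ mt).
  by apply: continuous_measurable_fun; exact: continuous_cos.
have ms : meas (fun w : R => sin (pi * alpha * Num.sg w / 2)).
  apply: (measurableT_comp _ mt).
  by apply: continuous_measurable_fun; exact: continuous_sin.
have mN : meas (fun w : R => wt w * hartley phi (- w)).
  have := measurableT_comp (wt_hartley_meas tp) (@oppr_measurable R setT).
  by congr measurable_fun; apply/funext => w /=; rewrite wtN.
have mS : meas (LW_symbol phi).
  apply: measurable_funB; apply: measurable_funM => //; exact: wt_hartley_meas.
have b w : `|LW_symbol phi w| <= 2 * C * (1 + w ^+ 2)^-1.
  apply: le_trans (ler_normB _ _) _; rewrite !(normrM (cos _)) !(normrM (sin _)).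
  rewrite (_ : 2 * C * (1 + w ^+ 2)^-1 =
    C * (1 + w ^+ 2)^-1 + C * (1 + w ^+ 2)^-1); last by ring.
  apply: lerD.
    by rewrite -[leRHS]mul1r ler_pM ?cos_max.
  by rewrite -[leRHS]mul1r ler_pM ?sin_max.
split.
- exact: (ig_le mS (igZ (2 * C) ig_invsq) b).
- exists (2 * C) => w; apply: (le_trans (b w)).
  rewrite -[leRHS]mulr1 ler_wpM2l ?mulr_ge0// invf_le1 ?lerDl ?sqr_ge0//.
  by rewrite ltr_pwDl ?sqr_ge0.
- move=> w w0.
  have sgc : {for w, continuous (fun w : R => Num.sg w)}.
    have [wn|wp|wz] := ltgtP w 0; last by rewrite wz eqxx in w0.
      apply: (@is_derive_cont _ _ _ 0).
      apply: (@is_derive_near _ _ (fun=> -1) _ _ (- w)); first by rewrite oppr_gt0.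
        by move=> h; rewrite ltr_norml => /andP[_ h2]; rewrite ltr0_sg//; lra.
    apply: (@is_derive_cont _ _ _ 0).
    apply: (@is_derive_near _ _ (fun=> 1) _ _ w) => //.
      by move=> h; rewrite ltr_norml => /andP[h1 _]; rewrite gtr0_sg//; lra.
  have tc : {for w, continuous (fun w : R => pi * alpha * Num.sg w / 2)}.
    apply: cvgM; last exact: cvg_cst.
    by apply: cvgM; [exact: cvg_cst|exact: sgc].
  apply: cvgB; apply: cvgM.
  + exact: (continuous_comp tc (@continuous_cos _ _)).
  + exact: wt_hartley_cont.
  + exact: (continuous_comp tc (@continuous_sin _ _)).
  + apply: cvgM; first exact: wt_cont.
    apply: (@continuous_comp _ _ _ (fun x : R => - x) (hartley phi)).
      exact: oppr_continuous.
    by apply: hartley_cont; exact: test_ig.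
Qed.

End weight.

(** * The graph of the Fourier transform on L^2 *)

Section fourier_graph.
Context {R : realType}.
Implicit Types (f u v g h phi psi : R -> R) (U V G : R -> R[i]).

Definition reF U : R -> R := fun w => complex.Re (U w).
Definition imF U : R -> R := fun w => complex.Im (U w).

Definition sqC U : Prop := sq (reF U) /\ sq (imF U).
Definition nsqC U : R := nsq (reF U) + nsq (imF U).

Lemma nsqC_ge0 U : 0 <= nsqC U.
Proof. by rewrite addr_ge0// nsq_ge0. Qed.

Lemma sqC_L2C U : sqC U <-> L2C U.
Proof. by rewrite /sqC /L2C -!sq_L2. Qed.

Lemma sqCD U V : sqC U -> sqC V -> sqC (fun w => U w + V w).
Proof.
move=> [u1 u2] [v1 v2]; split.
- by have := sqD u1 v1; congr sq; apply/funext => w; rewrite /reF; case: (U w) (V w) => ? ? [].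
- by have := sqD u2 v2; congr sq; apply/funext => w; rewrite /imF; case: (U w) (V w) => ? ? [].
Qed.

Lemma sqCB U V : sqC U -> sqC V -> sqC (fun w => U w - V w).
Proof.
move=> [u1 u2] [v1 v2]; split.
- by have := sqB u1 v1; congr sq; apply/funext => w; rewrite /reF; case: (U w) (V w) => ? ? [].
- by have := sqB u2 v2; congr sq; apply/funext => w; rewrite /imF; case: (U w) (V w) => ? ? [].
Qed.

Lemma reFB U V : reF (fun w => U w - V w) = (fun w => reF U w - reF V w).
Proof. by apply/funext => w; rewrite /reF; case: (U w) (V w) => ? ? []. Qed.

Lemma imFB U V : imF (fun w => U w - V w) = (fun w => imF U w - imF V w).
Proof. by apply/funext => w; rewrite /imF; case: (U w) (V w) => ? ? []. Qed.

Lemma reFZ (c : R) U : reF (fun w => c%:C * U w)%C = (fun w => c * reF U w).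
Proof. by apply/funext => w; rewrite /reF; case: (U w) => a b /=; rewrite mul0r subr0. Qed.

Lemma imFZ (c : R) U : imF (fun w => c%:C * U w)%C = (fun w => c * imF U w).
Proof. by apply/funext => w; rewrite /imF; case: (U w) => a b /=; rewrite mul0r addr0. Qed.

Lemma reFD U V : reF (fun w => U w + V w) = (fun w => reF U w + reF V w).
Proof. by apply/funext => w; rewrite /reF; case: (U w) (V w) => ? ? []. Qed.

Lemma imFD U V : imF (fun w => U w + V w) = (fun w => imF U w + imF V w).
Proof. by apply/funext => w; rewrite /imF; case: (U w) (V w) => ? ? []. Qed.

Lemma sqCZ (c : R) U : sqC U -> sqC (fun w => c%:C * U w)%C.
Proof. by move=> [u1 u2]; split; rewrite ?reFZ ?imFZ; exact: sqZ. Qed.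

Lemma nsqCZ (c : R) U : sqC U -> nsqC (fun w => c%:C * U w)%C = c ^+ 2 * nsqC U.
Proof. by move=> [u1 u2]; rewrite /nsqC reFZ imFZ !nsqZ// -mulrDr. Qed.

Lemma nsqCBC U V : nsqC (fun w => U w - V w) = nsqC (fun w => V w - U w).
Proof. by rewrite /nsqC !reFB !imFB nsqBC (nsqBC (imF U)). Qed.

Lemma nsqCD_le U V : sqC U -> sqC V ->
  nsqC (fun w => U w + V w) <= 2 * nsqC U + 2 * nsqC V.
Proof.
move=> [u1 u2] [v1 v2]; rewrite /nsqC reFD imFD.
have := nsqD_le u1 v1; have := nsqD_le u2 v2; lra.
Qed.

Lemma nsqC_tri U V G : sqC U -> sqC V -> sqC G ->
  nsqC (fun w => U w - G w) <=
  2 * nsqC (fun w => U w - V w) + 2 * nsqC (fun w => V w - G w).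
Proof.
move=> [u1 u2] [v1 v2] [g1 g2]; rewrite /nsqC !reFB !imFB.
have := nsq_tri u1 v1 g1; have := nsq_tri u2 v2 g2; lra.
Qed.

Lemma normc_sq U : sqC U ->
  sq (fun w => Normc.normc (U w)) /\ nsq (fun w => Normc.normc (U w)) = nsqC U.
Proof.
move=> [[m1 i1] [m2 i2]].
have E w : Normc.normc (U w) ^+ 2 = reF U w ^+ 2 + imF U w ^+ 2.
  by rewrite /reF /imF; case: (U w) => a b /=; rewrite sqr_sqrtr// addr_ge0 ?sqr_ge0.
split; last by rewrite /nsqC /nsq -ID//; apply: I_ext.
split; last by apply: ig_ext (igD i1 i2) => w; rewrite E.
rewrite (_ : (fun w => _) = (fun w => (reF U w ^+ 2 + imF U w ^+ 2) `^ (2^-1))).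
  apply: (measurableT_comp (measurable_powR _)).
  by apply: measurable_funD; exact: measurable_funX.
apply/funext => w; rewrite powR12_sqrt ?addr_ge0 ?sqr_ge0// -E sqrtr_sqr ger0_norm//.
by rewrite /Normc.normc; case: (U w) => a b; rewrite sqrtr_ge0.
Qed.

Lemma L2CnormP (U_ : nat -> R -> R[i]) : (forall n, sqC (U_ n)) ->
  (L2Cnorm (U_ n) @[n --> \oo] --> 0%E) <-> null_seq (fun n => nsqC (U_ n)).
Proof.
move=> h; rewrite /L2Cnorm.
rewrite (L2normP (f_ := fun n w => Normc.normc (U_ n w))); last first.
  by move=> n; case: (normc_sq (h n)).
by split; congr null_seq; apply/funext => n; case: (normc_sq (h n)).
Qed.

Lemma complex_eq (z : R[i]) (a b : R) : complex.Re z = a -> complex.Im z = b ->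
  z = (a +i* b)%C.
Proof. by case: z => x y /= -> ->. Qed.

Lemma fourier_re phi w : ig phi ->
  reF (fourier phi) w = (hartley phi w + hartley phi (- w)) / 2.
Proof.
move=> fi; rewrite /hartley -ID; try exact: hartley_ig.
rewrite -IZr; last by apply: igD; exact: hartley_ig.
rewrite /reF /fourier /Cintegral /=; apply: I_ext => x /=.
by rewrite mulr0 subr0 mulrN casN /cas cosN; field.
Qed.

Lemma fourier_im phi w : ig phi ->
  imF (fourier phi) w = (hartley phi (- w) - hartley phi w) / 2.
Proof.
move=> fi; rewrite /hartley -IB; try exact: hartley_ig.
rewrite -IZr; last by apply: igB; exact: hartley_ig.
rewrite /imF /fourier /Cintegral /=; apply: I_ext => x /=.
by rewrite mulr0 add0r mulrN casN /cas sinN; field.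
Qed.

Lemma fourierD phi psi w : ig phi -> ig psi ->
  fourier (fun x => phi x + psi x) w = fourier phi w + fourier psi w.
Proof.
move=> p q; have pq := igD p q.
rewrite (complex_eq (fourier_re w pq) (fourier_im w pq)).
rewrite [in RHS](complex_eq (fourier_re w p) (fourier_im w p)).
rewrite [in RHS](complex_eq (fourier_re w q) (fourier_im w q)).
rewrite !hartleyD//; by apply/eqP; rewrite eq_complex /=; apply/andP; split; apply/eqP; field.
Qed.

Lemma fourierZ c phi w : ig phi ->
  fourier (fun x => c * phi x) w = (c%:C * fourier phi w)%C.
Proof.
move=> p; have pq := igZ c p.
rewrite (complex_eq (fourier_re w pq) (fourier_im w pq)).
rewrite [in RHS](complex_eq (fourier_re w p) (fourier_im w p)).
rewrite !hartleyZ//; by apply/eqP; rewrite eq_complex /=; apply/andP; split; apply/eqP; field.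
Qed.

(** The Fourier transform of a real function has an even real part and an odd
    imaginary part, so that it is encoded by their difference f; the cross terms
    f(w) f(-w) cancel in the squared modulus. *)
Lemma hermitian_nsq f : sq f ->
  [/\ sq (fun w => (f w + f (- w)) / 2), sq (fun w => (f (- w) - f w) / 2) &
  nsq (fun w => (f w + f (- w)) / 2) + nsq (fun w => (f (- w) - f w) / 2) = nsq f].
Proof.
move=> sf; have so := sq_comp_opp sf.
have zr h : sq h -> sq (fun w => h w / 2).
  by move=> /(sqZ 2^-1); congr sq; apply/funext => w; rewrite mulrC.
have s1 := zr _ (sqD sf so); have s2 := zr _ (sqB so sf); split => //.
rewrite /nsq -ID; [|exact: s1.2|exact: s2.2].
transitivity (IR (fun w => 2^-1 * (f w ^+ 2 + f (- w) ^+ 2))).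
  by apply: I_ext => w; field.
rewrite IZ; last by apply: igD; [exact: sf.2|exact: so.2].
rewrite ID; [|exact: sf.2|exact: so.2].
by have := nsq_opp sf; rewrite /nsq => ->; field.
Qed.

Lemma nsqC_hermitian U f : sq f -> (forall w, reF U w = (f w + f (- w)) / 2) ->
  (forall w, imF U w = (f (- w) - f w) / 2) -> sqC U /\ nsqC U = nsq f.
Proof.
move=> sf /funext hr /funext hi; have [s1 s2 e] := hermitian_nsq sf.
by rewrite /sqC /nsqC hr hi.
Qed.

Lemma fourier_test phi : test_function phi ->
  sqC (fourier phi) /\ nsqC (fourier phi) = 2 * pi * nsq phi.
Proof.
move=> tp; have [s e] := hartley_test_sq tp; rewrite -e.
by apply: nsqC_hermitian => // w; [apply: fourier_re|apply: fourier_im]; exact: test_ig.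
Qed.

(** The sequences in the definition of [is_fourierL2] are replaced by arbitrarily
    good approximations, which compose without diagonal arguments. *)
Definition isF u U : Prop := [/\ sq u, sqC U & forall e : R, 0 < e ->
  exists phi, [/\ test_function phi, nsq (fun x => phi x - u x) < e &
    nsqC (fun w => fourier phi w - U w) < e]].

Lemma is_fourierP u U : is_fourierL2 u U <-> isF u U.
Proof.
split=> [[su sU [p [tp cu cU]]]|[su sU h]].
  move/sq_L2: su => su; move/sqC_L2C : sU => sU; split => // e e0.
  have s1 n : sq (fun x => p n x - u x) by apply: sqB => //; exact: test_sq.
  have s2 n : sqC (fun w => fourier (p n) w - U w).
    by apply: sqCB => //; case: (fourier_test (tp n)).
  have [N hN] := (L2normP s1).1 cu e e0; have [M hM] := (L2CnormP s2).1 cU e e0.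
  exists (p (N + M)%N); split => //.
    by have := hN _ (leq_addr M N); rewrite ger0_norm ?nsq_ge0.
  by have := hM _ (leq_addl N M); rewrite ger0_norm ?nsqC_ge0.
split; [exact/sq_L2|exact/sqC_L2C|].
have e0 n : 0 < n.+1%:R^-1 :> R by rewrite invr_gt0.
have /choice[p hp] : forall n : nat, exists phi, [/\ test_function phi,
    nsq (fun x => phi x - u x) < n.+1%:R^-1 &
    nsqC (fun w => fourier phi w - U w) < n.+1%:R^-1] by move=> n; exact: h.
exists p; split; first by move=> n; case: (hp n).
  apply/L2normP; first by move=> n; apply: sqB => //; apply: test_sq; case: (hp n).
  apply: null_seq_le (@null_seq_invS R) => n.
  by rewrite ger0_norm ?nsq_ge0// ltW//; case: (hp n).
apply/L2CnormP.
  by move=> n; apply: sqCB => //; have [/fourier_test[]] := hp n.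
apply: null_seq_le (@null_seq_invS R) => n.
by rewrite ger0_norm ?nsqC_ge0// ltW//; case: (hp n).
Qed.

Lemma isF_test phi : test_function phi -> isF phi (fourier phi).
Proof.
move=> tp; have [s _] := fourier_test tp; split => //; first exact: test_sq.
move=> e e0; exists phi; split => //.
  by rewrite /nsq; under eq_fun do rewrite subrr expr0n; rewrite I0.
rewrite /nsqC reFB imFB /nsq.
by do 2 (under eq_fun do rewrite subrr expr0n; rewrite I0); rewrite addr0.
Qed.

(** A test function close to v, with transform close to V, is also close to u and
    its transform to U. *)
Lemma isF_closed u U : sq u -> sqC U -> (forall e : R, 0 < e ->
  exists v V, [/\ isF v V, nsq (fun x => v x - u x) < e &
    nsqC (fun w => V w - U w) < e]) -> isF u U.
Proof.
move=> su sU h; split => // e e0; have e4 : 0 < e / 4 by rewrite divr_gt0.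
have [v [V [[sv sV hv] vu VU]]] := h _ e4.
have [p [tp pv pV]] := hv _ e4; exists p; split => //.
  apply: le_lt_trans (nsq_tri (test_sq tp) sv su) _; lra.
apply: le_lt_trans (nsqC_tri (fourier_test tp).1 sV sU) _; lra.
Qed.

Lemma isFD u v U V : isF u U -> isF v V ->
  isF (fun x => u x + v x) (fun w => U w + V w).
Proof.
move=> [su sU hu] [sv sV hv]; split; [exact: sqD|exact: sqCD|].
move=> e e0; have e4 : 0 < e / 4 by rewrite divr_gt0.
have [p [tp pu pU]] := hu _ e4; have [q [tq qv qV]] := hv _ e4.
exists (fun x => p x + q x); split; first exact: testD.
- rewrite (_ : (fun x => _) = (fun x => (p x - u x) + (q x - v x))); last first.
    by apply/funext => x; ring.
  by apply: le_lt_trans (nsqD_le (sqB (test_sq tp) su) (sqB (test_sq tq) sv)) _; lra.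
- rewrite (_ : (fun x => _) = (fun w => (fourier p w - U w) + (fourier q w - V w))).
    apply: le_lt_trans (nsqCD_le (sqCB (fourier_test tp).1 sU)
      (sqCB (fourier_test tq).1 sV)) _; lra.
  by apply/funext => w; rewrite fourierD; [ring|exact: test_ig|exact: test_ig].
Qed.

Lemma isFZ c u U : isF u U -> isF (fun x => c * u x) (fun w => c%:C * U w)%C.
Proof.
move=> [su sU hu]; split; [exact: sqZ|exact: sqCZ|].
move=> e e0; have c0 : 0 < c ^+ 2 + 1 by rewrite ltr_wpDl ?sqr_ge0.
have cl x : 0 <= x -> x < e / (c ^+ 2 + 1) -> c ^+ 2 * x < e.
  move=> x0; rewrite ltr_pdivlMr// => /(le_lt_trans _); apply.
  by rewrite mulrC ler_wpM2l// lerDl.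
have [p [tp pu pU]] := hu _ (divr_gt0 e0 c0).
exists (fun x => c * p x); split; first exact: testZ.
- rewrite (_ : (fun x => _) = (fun x => c * (p x - u x))); last first.
    by apply/funext => x; rewrite mulrBr.
  rewrite nsqZ; last by apply: sqB => //; exact: test_sq.
  by apply: cl => //; exact: nsq_ge0.
- rewrite (_ : (fun x => _) = (fun w => c%:C * (fourier p w - U w))%C).
    rewrite nsqCZ; last by apply: sqCB => //; case: (fourier_test tp).
    by apply: cl => //; exact: nsqC_ge0.
  by apply/funext => w; rewrite fourierZ ?mulrBr//; exact: test_ig.
Qed.

Lemma nsqC_cvg (U_ : nat -> R -> R[i]) U : (forall n, sqC (U_ n)) -> sqC U ->
  null_seq (fun n => nsqC (fun w => U_ n w - U w)) ->
  nsqC (U_ n) @[n --> \oo] --> nsqC U.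
Proof.
move=> h [s1 s2] cv; apply: cvgD.
  apply: L2cvg_nsq => // [n|]; first by case: (h n).
  apply: null_seq_le cv => n; rewrite ger0_norm ?nsq_ge0// /nsqC reFB lerDl nsq_ge0//.
apply: L2cvg_nsq => // [n|]; first by case: (h n).
apply: null_seq_le cv => n; rewrite ger0_norm ?nsq_ge0// /nsqC imFB lerDr nsq_ge0//.
Qed.

(** Both sides are continuous along the approximating test functions. *)
Lemma isF_nsq u U : isF u U -> nsqC U = 2 * pi * nsq u.
Proof.
move=> [su sU h].
have e0 n : 0 < n.+1%:R^-1 :> R by rewrite invr_gt0.
have /choice[p hp] : forall n : nat, exists phi, [/\ test_function phi,
    nsq (fun x => phi x - u x) < n.+1%:R^-1 &
    nsqC (fun w => fourier phi w - U w) < n.+1%:R^-1] by move=> n; exact: h.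
have tp n : test_function (p n) by case: (hp n).
have c1 : nsqC (fourier (p n)) @[n --> \oo] --> nsqC U.
  apply: nsqC_cvg => // [n|]; first by case: (fourier_test (tp n)).
  apply: null_seq_le (@null_seq_invS R) => n.
  by rewrite ger0_norm ?nsqC_ge0// ltW//; case: (hp n).
have c2 : 2 * pi * nsq (p n) @[n --> \oo] --> 2 * pi * nsq u.
  apply: cvgM; first exact: cvg_cst.
  apply: L2cvg_nsq => // [n|]; first exact: test_sq.
  apply: null_seq_le (@null_seq_invS R) => n.
  by rewrite ger0_norm ?nsq_ge0// ltW//; case: (hp n).
apply: (seq_lim_unique c1).
rewrite (_ : (fun n => _) = (fun n => 2 * pi * nsq (p n))) //.
by apply/funext => n; case: (fourier_test (tp n)).
Qed.

End fourier_graph.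

(** * The graph of the fractional derivative *)

Section completeness_C.
Context {R : realType}.
Implicit Types (u g : R -> R) (U V G : R -> R[i]).

Lemma riesz_fischerC (U_ : nat -> R -> R[i]) : (forall n, sqC (U_ n)) ->
  (forall e : R, 0 < e -> exists N, forall m n, (N <= m)%N -> (N <= n)%N ->
    nsqC (fun w => U_ m w - U_ n w) < e) ->
  exists2 U, sqC U & null_seq (fun n => nsqC (fun w => U_ n w - U w)).
Proof.
move=> s C.
have [|e e0|a sa ha] := @riesz_fischer R (fun n => reF (U_ n)).
- by move=> n; case: (s n).
- have [N hN] := C _ e0; exists N => m n Nm Nn.
  by apply: le_lt_trans (hN m n Nm Nn); rewrite /nsqC reFB lerDl nsq_ge0.
have [|e e0|b sb hb] := @riesz_fischer R (fun n => imF (U_ n)).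
- by move=> n; case: (s n).
- have [N hN] := C _ e0; exists N => m n Nm Nn.
  by apply: le_lt_trans (hN m n Nm Nn); rewrite /nsqC imFB lerDr nsq_ge0.
exists (fun w => (a w +i* b w)%C); first by split.
have := null_seqD ha hb; congr null_seq; apply/funext => n.
by rewrite /nsqC reFB imFB.
Qed.

(** By Plancherel's identity the transforms form a Cauchy sequence; its limit is
    the transform of u because the graph is closed. *)
Lemma isF_lim (u_ : nat -> R -> R) (U_ : nat -> R -> R[i]) u :
  (forall n, isF (u_ n) (U_ n)) -> sq u ->
  null_seq (fun n => nsq (fun x => u_ n x - u x)) ->
  exists2 U, isF u U & null_seq (fun n => nsqC (fun w => U_ n w - U w)).
Proof.
move=> h su cu.
have sun n : sq (u_ n) by case: (h n).
have sUn n : sqC (U_ n) by case: (h n).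
have hB m n : isF (fun x => u_ m x - u_ n x) (fun w => U_ m w - U_ n w).
  have := isFD (h m) (isFZ (-1) (h n)); congr isF.
    by apply/funext => x; rewrite mulN1r.
  apply/funext => w; congr (_ + _); case: (U_ n w) => a b.
  by apply/eqP; rewrite eq_complex /= !mul0r !mulN1r subr0 addr0 !eqxx.
have pi2 : 0 < 2 * pi :> R by rewrite mulr_gt0 ?pi_gt0.
have [e e0|U sU hU] := riesz_fischerC sUn.
  have e4 : 0 < e / (2 * pi) / 4 by rewrite !divr_gt0.
  have [N hN] := cu _ e4; exists N => m n Nm Nn.
  rewrite (isF_nsq (hB m n)) mulrC -ltr_pdivlMr//.
  apply: le_lt_trans (nsq_tri (sun m) su (sun n)) _.
  have := hN m Nm; have := hN n Nn; rewrite !ger0_norm ?nsq_ge0// (nsqBC u); lra.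
exists U => //; apply: isF_closed => // e e0.
have [N hN] := cu _ e0; have [M hM] := hU _ e0.
exists (u_ (N + M)%N), (U_ (N + M)%N); split => //.
  by have := hN _ (leq_addr M N); rewrite ger0_norm ?nsq_ge0.
by have := hM _ (leq_addl N M); rewrite ger0_norm ?nsqC_ge0.
Qed.

End completeness_C.

Section LW.
Context {R : realType}.
Variable alpha : R.
Hypotheses (alpha_gt : 1 / 2 < alpha) (alpha_lt : alpha < 1).
Implicit Types (f u v g h phi psi : R -> R) (U V G : R -> R[i]).

Notation wt := (wt alpha).

Definition mult U (w : R) : R[i] := iw_pow alpha w * U w.
Definition wtC U (w : R) : R[i] := ((wt w)%:C * U w)%C.
Let ang (w : R) : R := pi * alpha * Num.sg w / 2.

Lemma reF_mult U w :
  reF (mult U) w = cos (ang w) * (wt w * reF U w) - sin (ang w) * (wt w * imF U w).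
Proof.
rewrite /reF /imF /mult /iw_pow /expi -/(ang w) /wt; case: (U w) => a b /=.
ring.
Qed.

Lemma imF_mult U w :
  imF (mult U) w = cos (ang w) * (wt w * imF U w) + sin (ang w) * (wt w * reF U w).
Proof.
rewrite /reF /imF /mult /iw_pow /expi -/(ang w) /wt; case: (U w) => a b /=.
ring.
Qed.

Lemma reF_wtC U w : reF (wtC U) w = wt w * reF U w.
Proof. by rewrite /wtC /reF; case: (U w) => a b /=; rewrite mul0r subr0. Qed.

Lemma imF_wtC U w : imF (wtC U) w = wt w * imF U w.
Proof. by rewrite /wtC /imF; case: (U w) => a b /=; rewrite mul0r addr0. Qed.

Let meas_ang : meas ang.
Proof.
by apply: measurable_funM => //; apply: measurable_funM => //; exact: measurable_sg.
Qed.

Let meas_cos : meas (fun w => cos (ang w)).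
Proof.
apply: (measurableT_comp _ meas_ang).
by apply: continuous_measurable_fun; exact: continuous_cos.
Qed.

Let meas_sin : meas (fun w => sin (ang w)).
Proof.
apply: (measurableT_comp _ meas_ang).
by apply: continuous_measurable_fun; exact: continuous_sin.
Qed.

(** The multiplier has modulus |w|^alpha. *)
Lemma nsqC_mult U : sqC (wtC U) -> sqC (mult U) /\ nsqC (mult U) = nsqC (wtC U).
Proof.
move=> [sa sb].
have Er : reF (mult U) =
    (fun w => cos (ang w) * reF (wtC U) w - sin (ang w) * imF (wtC U) w).
  by apply/funext => w; rewrite reF_mult reF_wtC imF_wtC.
have Ei : imF (mult U) =
    (fun w => cos (ang w) * imF (wtC U) w + sin (ang w) * reF (wtC U) w).
  by apply/funext => w; rewrite imF_mult reF_wtC imF_wtC.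
have sc h : sq h -> sq (fun w => cos (ang w) * h w).
  move=> sh; apply: (sq_le _ sh); first by apply: measurable_funM => //; case: sh.
  by move=> w; rewrite normrM -[leRHS]mul1r ler_wpM2r ?cos_max.
have ss h : sq h -> sq (fun w => sin (ang w) * h w).
  move=> sh; apply: (sq_le _ sh); first by apply: measurable_funM => //; case: sh.
  by move=> w; rewrite normrM -[leRHS]mul1r ler_wpM2r ?sin_max.
have s1 : sq (reF (mult U)) by rewrite Er; apply: sqB; [exact: sc|exact: ss].
have s2 : sq (imF (mult U)) by rewrite Ei; apply: sqD; [exact: sc|exact: ss].
split => //; rewrite /nsqC /nsq -ID; [|exact: s1.2|exact: s2.2].
rewrite -ID; [|exact: sa.2|exact: sb.2].
rewrite Er Ei; apply: I_ext => w.
have := cos2Dsin2 (ang w).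
move: (cos _) (sin _) (reF _ w) (imF _ w) => c s a b cs.
transitivity ((c ^+ 2 + s ^+ 2) * (a ^+ 2 + b ^+ 2)); first by ring.
by rewrite cs mul1r.
Qed.

Lemma wtC_test phi : test_function phi -> sqC (wtC (fourier phi)) /\
  nsqC (wtC (fourier phi)) = nsq (fun w => wt w * hartley phi w).
Proof.
move=> tp; apply: nsqC_hermitian; first exact: wt_hartley_sq.
  by move=> w; rewrite reF_wtC fourier_re ?wtN; [field|exact: test_ig].
by move=> w; rewrite imF_wtC fourier_im ?wtN; [field|exact: test_ig].
Qed.

(** The derivative is (2 pi)^-1 times the Hartley transform of the symbol K. It is
    a continuous function of L^2, so it is approximated by test functions psi;
    expanding the squared norm of T psi - K, where T is the Hartley transform,
    with Plancherel's identity and the symmetry of T gives 2 pi times the squared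
    norm of psi - g. *)
Lemma mult_test phi : test_function phi -> exists g, isF g (mult (fourier phi)).
Proof.
move=> tp; have [Ki [M KM] Kc] := LW_symbol_props alpha_gt alpha_lt tp.
set K := LW_symbol alpha phi in Ki KM Kc.
have [sTK nTK] := plancherel Ki KM Kc.
have sK := sq_bounded Ki KM.
have pi0 : (pi : R) != 0 by rewrite gt_eqF ?pi_gt0.
have pi2 : 0 < 2 * pi :> R by rewrite mulr_gt0 ?pi_gt0.
pose g x := (2 * pi)^-1 * hartley K x.
have sg : sq g by exact: sqZ.
have ng : 2 * pi * nsq g = nsq K.
  by rewrite /g nsqZ// nTK; move: pi0; move: (pi : R) => p p0; field.
have cg : continuous g.
  by move=> x; apply: cvgM; [exact: cvg_cst|exact: hartley_cont].
have [_ hg] := test_dense cg sg.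
have [sw _] := wtC_test tp; have [sm _] := nsqC_mult sw.
have Kp w : K w = cos (ang w) * (wt w * hartley phi w) -
    sin (ang w) * (wt w * hartley phi (- w)) by [].
have angN w : ang (- w) = - ang w by rewrite /ang sgrN mulrN !mulNr.
have Kn w : K (- w) = cos (ang w) * (wt w * hartley phi (- w)) +
    sin (ang w) * (wt w * hartley phi w).
  rewrite /K /LW_symbol -/(ang (- w)) angN wtN cosN sinN opprK; ring.
exists g; split => // e e0.
have [psi tpsi npsi] := hg _ (divr_gt0 e0 (ltr_pwDl ltr01 (ltW pi2))).
have tpi := test_ig tpsi.
have n1 : nsq (fun x => psi x - g x) < e.
  apply: (lt_le_trans npsi); rewrite ler_pdivrMr; last by rewrite ltr_pwDl// ltW.
  by rewrite ler_peMr ?lerDl// ltW.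
exists psi; split => //.
have sT := hartley_test_sq tpsi.
have [] := @nsqC_hermitian R (fun w => fourier psi w - mult (fourier phi) w)
  (fun w => hartley psi w - K w); first by apply: sqB => //; case: sT.
- move=> w; rewrite reFB (fourier_re _ tpi) reF_mult.
  by rewrite (fourier_re _ (test_ig tp)) (fourier_im _ (test_ig tp)) (Kp w) (Kn w); field.
- move=> w; rewrite imFB (fourier_im _ tpi) imF_mult.
  by rewrite (fourier_re _ (test_ig tp)) (fourier_im _ (test_ig tp)) (Kp w) (Kn w); field.
move=> _ ->; rewrite nsqB//; last by case: sT.
have -> : IR (fun w => hartley psi w * K w) = 2 * pi * IR (fun x => psi x * g x).
  rewrite hartley_sym// -IZ; last by apply: sq_mul => //; exact: test_sq.
  by apply: I_ext => x; rewrite /g; move: pi0; move: (pi : R) => p p0; field.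
rewrite (_ : _ + _ = 2 * pi * nsq (fun x => psi x - g x)).
  rewrite ltr_pdivlMr in npsi; last by rewrite ltr_pwDl// ltW.
  apply: le_lt_trans npsi; rewrite mulrC ler_wpM2l ?nsq_ge0// lerDr ler01//.
by rewrite (nsqB (test_sq tpsi) sg) sT.2 -ng; ring.
Qed.

Definition isLW u g : Prop := exists2 U, isF u U & isF g (mult U).

Lemma is_LWderiveP u g : is_LWderive alpha u g <-> isLW u g.
Proof.
by split=> -[U /is_fourierP h1 /is_fourierP h2]; exists U.
Qed.

Lemma isLW_sq u g : isLW u g -> sq u /\ sq g.
Proof. by move=> [U [su _ _] [sg _ _]]. Qed.

Lemma isLW_test phi : test_function phi -> exists g, isLW phi g.
Proof.
move=> tp; have [g hg] := mult_test tp; exists g; exists (fourier phi) => //.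
exact: isF_test.
Qed.

Lemma isLWD u v g h : isLW u g -> isLW v h ->
  isLW (fun x => u x + v x) (fun x => g x + h x).
Proof.
move=> [U uU gG] [V vV hH]; exists (fun w => U w + V w); first exact: isFD.
have := isFD gG hH; congr isF; apply/funext => w.
by rewrite /mult mulrDr.
Qed.

Lemma isLWZ c u g : isLW u g -> isLW (fun x => c * u x) (fun x => c * g x).
Proof.
move=> [U uU gG]; exists (fun w => c%:C * U w)%C; first exact: isFZ.
have := isFZ c gG; congr isF; apply/funext => w.
by rewrite /mult mulrCA.
Qed.

Lemma isLWB u v g h : isLW u g -> isLW v h ->
  isLW (fun x => u x - v x) (fun x => g x - h x).
Proof.
move=> h1 h2; have := isLWD h1 (isLWZ (-1) h2).
by congr isLW; apply/funext => x; rewrite mulN1r.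
Qed.

Lemma nsqC_eq0 U : sqC U -> nsqC U = 0 -> {ae leb R, forall w, U w = 0}.
Proof.
move=> [s1 s2] /eqP; rewrite paddr_eq0 ?nsq_ge0// => /andP[/eqP n1 /eqP n2].
apply: aeS2 (nsq_eq0 s1 n1) (nsq_eq0 s2 n2) => w; rewrite /reF /imF.
by case: (U w) => a b /= -> ->.
Qed.

(** Through Plancherel's identity: a null function has a null transform. With
    linearity this determines the derivative almost everywhere. *)
Lemma isLW_null u g : isLW u g -> nsq u = 0 -> nsq g = 0.
Proof.
move=> [U uU gG] u0; have := isF_nsq uU; rewrite u0 mulr0 => U0.
have [_ sU _] := uU; have [sg smU _] := gG.
have aU := nsqC_eq0 sU U0.
have pi2 : 2 * pi != 0 :> R by rewrite gt_eqF// mulr_gt0 ?pi_gt0.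
have /eqP : 2 * pi * nsq g = 0.
  rewrite -(isF_nsq gG).
  have z w : U w = 0 -> reF (mult U) w = 0 /\ imF (mult U) w = 0.
    by rewrite /reF /imF /mult => ->; rewrite mulr0.
  have sq00 := (@sq0 R).
  have n0 : nsq (fun _ : R => 0) = 0 :> R.
    by rewrite /nsq; under eq_fun do rewrite expr0n; rewrite I0.
  rewrite /nsqC (@nsq_ae _ (reF (mult U)) (fun=> 0)); last 3 first.
  - by case: smU => -[].
  - by case: sq00.
  - by apply: aeS aU => w /z[].
  rewrite (@nsq_ae _ (imF (mult U)) (fun=> 0)); last 3 first.
  - by case: smU => _ [].
  - by case: sq00.
  - by apply: aeS aU => w /z[].
  by rewrite n0 addr0.
by rewrite mulf_eq0 (negbTE pi2) => /eqP.
Qed.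

Lemma isLW_uniq u g h : isLW u g -> isLW u h -> {ae leb R, forall x, g x = h x}.
Proof.
move=> h1 h2; have h3 := isLWB h1 h2.
have n0 : nsq (fun x => u x - u x) = 0.
  by rewrite /nsq; under eq_fun do rewrite subrr expr0n; rewrite I0.
have [_ s] := isLW_sq h3.
by apply: aeS (nsq_eq0 s (isLW_null h3 n0)) => x /eqP; rewrite subr_eq0 => /eqP.
Qed.

(** Dividing by 1 + |w|^alpha turns the multiplier into a bounded one, so that the
    limits of the two sequences of transforms can be compared. *)
Lemma isLW_closed (u_ g_ : nat -> R -> R) u g : (forall n, isLW (u_ n) (g_ n)) ->
  sq u -> sq g -> null_seq (fun n => nsq (fun x => u_ n x - u x)) ->
  null_seq (fun n => nsq (fun x => g_ n x - g x)) -> isLW u g.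
Proof.
move=> h su sg cu cg.
have /choice[U_ hU] : forall n, exists U, isF (u_ n) U /\ isF (g_ n) (mult U).
  by move=> n; have [U] := h n; exists U.
have [U uU cU] := isF_lim (fun n => (hU n).1) su cu.
have [G gG cG] := isF_lim (fun n => (hU n).2) sg cg.
exists U => //.
have sU n : sqC (U_ n) by case: (hU n) => -[].
have sG n : sqC (mult (U_ n)) by case: (hU n) => _ [].
have [_ sUU _] := uU; have [_ sGG _] := gG.
(* Multiplication by q is bounded on L^2, also after the multiplier. *)
pose q w := (1 + wt w)^-1.
have p1 w : 0 < 1 + wt w by rewrite ltr_pwDl ?wt_ge0.
have q01 w : 0 < q w <= 1.
  by rewrite invr_gt0 p1/= invf_le1// lerDl wt_ge0.
have mq : meas q.
  rewrite (_ : q = (fun w => (1 + wt w) `^ (-1))); last first.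
    by apply/funext => w; rewrite powR_inv1// ltW.
  apply: (measurableT_comp (measurable_powR (-1))).
  by apply: measurable_funD => //; exact: measurable_wt.
pose qC V w := ((q w)%:C * V w)%C.
have req V : reF (qC V) = (fun w => q w * reF V w).
  by apply/funext => w; rewrite /qC /reF; case: (V w) => a b /=; rewrite mul0r subr0.
have imq V : imF (qC V) = (fun w => q w * imF V w).
  by apply/funext => w; rewrite /qC /imF; case: (V w) => a b /=; rewrite mul0r addr0.
have sq_q (k a : R -> R) : (forall w, `|k w| <= 1) -> meas k -> sq a ->
    sq (fun w => k w * a w) /\ nsq (fun w => k w * a w) <= nsq a.
  move=> k1 mk sa.
  have b w : `|k w * a w| <= `|a w|.
    by rewrite normrM -[leRHS]mul1r ler_wpM2r.
  have s : sq (fun w => k w * a w).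
    by apply: (sq_le _ sa) => //; apply: measurable_funM => //; case: sa.
  split => //; apply: I_le; [exact: s.2|exact: sa.2|].
  move=> w; rewrite -(sqr_normr (k w * a w)) -(sqr_normr (a w)).
  by rewrite lerXn2r// nnegrE.
have qn w : `|q w| <= 1 by have /andP[q0 q1] := q01 w; rewrite ger0_norm// ltW.
have sqV V : sqC V -> sqC (qC V) /\ nsqC (qC V) <= nsqC V.
  move=> [a b]; have [s1 n1] := sq_q q _ qn mq a; have [s2 n2] := sq_q q _ qn mq b.
  by rewrite /sqC /nsqC req imq; split => //; exact: lerD.
have qwn w : `|q w * wt w| <= 1.
  rewrite ger0_norm; last by rewrite mulr_ge0 ?wt_ge0// ltW//; case/andP: (q01 w).
  by rewrite /q mulrC ler_pdivrMr// mul1r lerDr.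
have mqw : meas (fun w => q w * wt w).
  by apply: measurable_funM => //; exact: measurable_wt.
have wtq V : sqC V -> sqC (wtC (qC V)) /\ nsqC (wtC (qC V)) <= nsqC V.
  move=> [a b]; have [s1 n1] := sq_q _ _ qwn mqw a.
  have [s2 n2] := sq_q _ _ qwn mqw b.
  have e1 : reF (wtC (qC V)) = (fun w => q w * wt w * reF V w).
    by apply/funext => w; rewrite reF_wtC req; ring.
  have e2 : imF (wtC (qC V)) = (fun w => q w * wt w * imF V w).
    by apply/funext => w; rewrite imF_wtC imq; ring.
  by rewrite /sqC /nsqC e1 e2; split => //; exact: lerD.
have mqE V : qC (mult V) = mult (qC V).
  by apply/funext => w; rewrite /qC /mult mulrCA.
have qsub V V' : (fun w => qC V w - qC V' w) = qC (fun w => V w - V' w).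
  by apply/funext => w; rewrite /qC mulrBr.
have msub V V' : (fun w => mult V w - mult V' w) = mult (fun w => V w - V' w).
  by apply/funext => w; rewrite /mult mulrBr.
have smq V : sqC V -> sqC (mult (qC V)) by move=> /wtq[/nsqC_mult[]].
have e0 : nsqC (fun w => qC G w - mult (qC U) w) = 0.
  apply/eqP; rewrite eq_le nsqC_ge0 andbT; apply/ler_addgt0Pr => e e0.
  have e4 : 0 < e / 4 by rewrite divr_gt0.
  have [N hN] := cU _ e4; have [M hM] := cG _ e4.
  pose k := (N + M)%N.
  have hk1 := hN k (leq_addr M N); have hk2 := hM k (leq_addl N M).
  rewrite ger0_norm ?nsqC_ge0// in hk1; rewrite ger0_norm ?nsqC_ge0// in hk2.
  have sGk := sqV _ (sG k); have sqG := sqV _ sGG.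
  apply: (le_trans (nsqC_tri sqG.1 sGk.1 (smq _ sUU))).
  have b1 : nsqC (fun w => qC G w - qC (mult (U_ k)) w) < e / 4.
    rewrite nsqCBC qsub; apply: le_lt_trans hk2.
    by case: (sqV _ (sqCB (sG k) sGG)).
  have b2 : nsqC (fun w => qC (mult (U_ k)) w - mult (qC U) w) < e / 4.
    rewrite mqE msub qsub; have [sw nw] := wtq _ (sqCB (sU k) sUU).
    by rewrite (nsqC_mult sw).2; apply: le_lt_trans hk1.
  rewrite add0r; lra.
have aeG : {ae leb R, forall w, G w = mult U w}.
  have s := sqCB (sqV _ sGG).1 (smq _ sUU).
  apply: aeS (nsqC_eq0 s e0) => w /eqP; rewrite subr_eq0 -mqE => /eqP.
  have qw0 : (q w)%:C%C != 0.
    by rewrite eq_complex /= negb_and gt_eqF//; case/andP: (q01 w).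
  by move/(mulfI qw0).
have [_ [sg1 sg2] hgG] := gG.
have m1 : meas (reF (mult U)).
  rewrite (_ : reF _ = (fun w => cos (ang w) * (wt w * reF U w) -
    sin (ang w) * (wt w * imF U w))); last by apply/funext => w; exact: reF_mult.
  by apply: measurable_funB; apply: measurable_funM => //;
    (apply: measurable_funM; [exact: measurable_wt|]); [case: sUU => -[]|case: sUU => _ []].
have m2 : meas (imF (mult U)).
  rewrite (_ : imF _ = (fun w => cos (ang w) * (wt w * imF U w) +
    sin (ang w) * (wt w * reF U w))); last by apply/funext => w; exact: imF_mult.
  by apply: measurable_funD; apply: measurable_funM => //;
    (apply: measurable_funM; [exact: measurable_wt|]); [case: sUU => _ []|case: sUU => -[]].
have smU : sqC (mult U).
  by split; [apply: (sq_ae m1 _ sg1)|apply: (sq_ae m2 _ sg2)];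
    apply: aeS aeG => w; rewrite /reF /imF => ->.
split => // e e0'; have [p [tp pg pG]] := hgG _ e0'; exists p; split => //.
apply: le_lt_trans pG; rewrite le_eqVlt; apply/orP; left; apply/eqP.
have [[[mp1 _] [mp2 _]] _] := fourier_test tp.
rewrite /nsqC !reFB !imFB; congr (_ + _); apply: nsq_ae.
- by apply: measurable_funB.
- by apply: measurable_funB => //; case: sg1.
- by apply: aeS aeG => w; rewrite /reF => ->.
- by apply: measurable_funB.
- by apply: measurable_funB => //; case: sg2.
- by apply: aeS aeG => w; rewrite /imF => ->.
Qed.

Definition Dom u : Prop := exists g, isLW u g.

Lemma LWderive_isLW u : Dom u -> isLW u (LWderive alpha u).
Proof.
move=> [g hg]; apply/is_LWderiveP; rewrite /LWderive.
have ex : exists g, [set g | is_LWderive alpha u g] g by exists g; exact/is_LWderiveP.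
exact: (xgetPex (fun=> 0) ex).
Qed.

End LW.

(** * The energy space *)

Section energy.
Context {R : realType}.
Variable alpha : R.
Hypotheses (alpha_gt : 1 / 2 < alpha) (alpha_lt : alpha < 1).
Implicit Types (f u v g h phi psi : R -> R).

Notation wt := (wt alpha).
Notation D := (LWderive alpha).
Notation isLW := (isLW alpha).
Notation Dom := (Dom alpha).

Definition ip u v : R := IR (fun x => u x * v x) + IR (fun x => D u x * D v x).
Definition en u : R := nsq u + nsq (D u).

Lemma ip_en u : ip u u = en u. Proof. by []. Qed.

Lemma en_ge0 u : 0 <= en u. Proof. by rewrite addr_ge0 ?nsq_ge0. Qed.

Lemma Dom_LW u : Dom u -> isLW u (D u). Proof. exact: LWderive_isLW. Qed.

Lemma Dom_sq u : Dom u -> sq u /\ sq (D u).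
Proof. by move=> /Dom_LW/isLW_sq. Qed.

(** Any representative of the derivative may be used. *)
Lemma ipE u v g h : isLW u g -> isLW v h ->
  ip u v = IR (fun x => u x * v x) + IR (fun x => g x * h x).
Proof.
move=> ug vh; congr (_ + _).
have du : Dom u by exists g.
have dv : Dom v by exists h.
have [_ [mg _]] := isLW_sq ug; have [_ [mh _]] := isLW_sq vh.
have [_ [mDu _]] := Dom_sq du; have [_ [mDv _]] := Dom_sq dv.
apply: I_ae; try exact: measurable_funM.
by apply: aeS2 (isLW_uniq (Dom_LW du) ug) (isLW_uniq (Dom_LW dv) vh) => x -> ->.
Qed.

Lemma enE u g : isLW u g -> en u = nsq u + nsq g.
Proof. by move=> h; rewrite -ip_en (ipE h h). Qed.

Lemma DomD u v : Dom u -> Dom v -> Dom (fun x => u x + v x).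
Proof. by move=> [g hg] [h hh]; exists (fun x => g x + h x); exact: isLWD. Qed.

Lemma DomZ c u : Dom u -> Dom (fun x => c * u x).
Proof. by move=> [g hg]; exists (fun x => c * g x); exact: isLWZ. Qed.

Lemma DomB u v : Dom u -> Dom v -> Dom (fun x => u x - v x).
Proof. by move=> [g hg] [h hh]; exists (fun x => g x - h x); exact: isLWB. Qed.

Lemma Dom_test phi : test_function phi -> Dom phi.
Proof. exact: isLW_test. Qed.

Lemma ipC u v : ip u v = ip v u.
Proof. by congr (_ + _); apply: I_ext => x; rewrite mulrC. Qed.

Lemma ipDl u v w : Dom u -> Dom v -> Dom w ->
  ip (fun x => u x + v x) w = ip u w + ip v w.
Proof.
move=> du dv dw; have [su sDu] := Dom_sq du; have [sv sDv] := Dom_sq dv.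
have [sw sDw] := Dom_sq dw.
rewrite (ipE (isLWD (Dom_LW du) (Dom_LW dv)) (Dom_LW dw)) /ip addrACA.
by congr (_ + _); rewrite -ID; try exact: sq_mul; apply: I_ext => x; rewrite mulrDl.
Qed.

Lemma ipZl c u w : Dom u -> Dom w -> ip (fun x => c * u x) w = c * ip u w.
Proof.
move=> du dw; have [su sDu] := Dom_sq du; have [sw sDw] := Dom_sq dw.
rewrite (ipE (isLWZ c (Dom_LW du)) (Dom_LW dw)) /ip mulrDr.
by congr (_ + _); rewrite -IZ; try exact: sq_mul; apply: I_ext => x; rewrite mulrA.
Qed.

Lemma enD_le u v : Dom u -> Dom v ->
  en (fun x => u x + v x) <= 2 * en u + 2 * en v.
Proof.
move=> du dv; rewrite (enE (isLWD (Dom_LW du) (Dom_LW dv))).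
have [su sDu] := Dom_sq du; have [sv sDv] := Dom_sq dv.
have := nsqD_le su sv; have := nsqD_le sDu sDv; rewrite /en.
by do 6 move: (nsq _) => ?; lra.
Qed.

Lemma enN u : Dom u -> en (fun x => - u x) = en u.
Proof.
move=> du; have := isLWZ (-1) (Dom_LW du).
under eq_fun do rewrite mulN1r; under [X in isLW _ X]eq_fun do rewrite mulN1r.
by move=> /enE ->; rewrite !nsqN.
Qed.

Lemma enBC u v : Dom u -> Dom v -> en (fun x => u x - v x) = en (fun x => v x - u x).
Proof.
move=> du dv; rewrite -(enN (DomB du dv)); congr en.
by apply/funext => x; rewrite opprB.
Qed.

Lemma en_tri u v w : Dom u -> Dom v -> Dom w ->
  en (fun x => u x - w x) <=
  2 * en (fun x => u x - v x) + 2 * en (fun x => v x - w x).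
Proof.
move=> du dv dw; rewrite (_ : (fun x => u x - w x) =
  (fun x => (u x - v x) + (v x - w x))).
  by apply: enD_le; exact: DomB.
by apply/funext => x; rewrite addrA subrK.
Qed.

Lemma en_cvg (u_ : nat -> R -> R) u : (forall n, Dom (u_ n)) -> Dom u ->
  null_seq (fun n => en (fun x => u_ n x - u x)) -> en (u_ n) @[n --> \oo] --> en u.
Proof.
move=> dn du h.
have E n : en (fun x => u_ n x - u x) =
    nsq (fun x => u_ n x - u x) + nsq (fun x => D (u_ n) x - D u x).
  exact: (enE (isLWB (Dom_LW (dn n)) (Dom_LW du))).
apply: cvgD; apply: L2cvg_nsq.
- by move=> n; case: (Dom_sq (dn n)).
- by case: (Dom_sq du).
- by apply: null_seq_le h => n; rewrite E ger0_norm ?nsq_ge0// lerDl nsq_ge0.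
- by move=> n; case: (Dom_sq (dn n)).
- by case: (Dom_sq du).
- by apply: null_seq_le h => n; rewrite E ger0_norm ?nsq_ge0// lerDr nsq_ge0.
Qed.

Lemma pi2_gt0 : 0 < 2 * pi :> R. Proof. by rewrite mulr_gt0 ?pi_gt0. Qed.

Lemma nsq_D_test phi : test_function phi ->
  2 * pi * nsq (D phi) = nsq (fun w => wt w * hartley phi w).
Proof.
move=> tp; have [g hg] := mult_test alpha_gt alpha_lt tp.
have lw : isLW phi g by exists (fourier phi) => //; exact: isF_test.
have -> : nsq (D phi) = nsq g.
  have [_ [mD _]] := Dom_sq (Dom_test tp); have [_ [mg _]] := isLW_sq lw.
  by apply: nsq_ae => //; exact: isLW_uniq (Dom_LW (Dom_test tp)) lw.
rewrite -(isF_nsq hg).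
have [sw nw] := wtC_test alpha_gt alpha_lt tp.
by rewrite (nsqC_mult sw).2 nw.
Qed.

(** Plancherel's identity for phi and for its derivative. *)
Lemma en_test phi : test_function phi ->
  ig (fun w => (1 + wt w ^+ 2) * hartley phi w ^+ 2) /\
  IR (fun w => (1 + wt w ^+ 2) * hartley phi w ^+ 2) = 2 * pi * en phi.
Proof.
move=> tp; have [[m1 i1] e1] := hartley_test_sq tp.
have [m2 i2] := wt_hartley_sq alpha_gt alpha_lt tp.
have E w : hartley phi w ^+ 2 + (wt w * hartley phi w) ^+ 2 =
  (1 + wt w ^+ 2) * hartley phi w ^+ 2 by rewrite exprMn mulrDl mul1r.
split; first exact: ig_ext (igD i1 i2).
rewrite /en mulrDr nsq_D_test// -e1 -ID//; exact: I_ext.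
Qed.

Definition winv (k : R -> R) (w : R) : R := k w ^+ 2 / (1 + wt w ^+ 2).

Let wp (w : R) : 0 < 1 + wt w ^+ 2.
Proof. by rewrite ltr_pwDl ?sqr_ge0. Qed.

Lemma winv_ig (k : R -> R) (M : R) : meas k -> (forall w, `|k w| <= M) -> ig (winv k).
Proof.
move=> mk kM; have i := ig_inv_wt alpha_gt alpha_lt.
apply: (ig_le _ (igZ (M ^+ 2) i)).
  by apply: measurable_funM; [exact: measurable_funX|exact: ig_meas].
move=> w; rewrite /winv normrM ler_pM//.
  by rewrite normrX lerXn2r// nnegrE// (le_trans _ (kM 0)).
by rewrite ger0_norm// invr_ge0 ltW.
Qed.

(** The Cauchy-Schwarz inequality with the weight 1 + |w|^(2 alpha) and its
    reciprocal; the latter is integrable by [ig_inv_wt]. *)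
Lemma hartley_CS phi (k : R -> R) (M : R) : test_function phi -> meas k ->
  (forall w, `|k w| <= M) ->
  IR (fun w => hartley phi w * k w) ^+ 2 <= 2 * pi * en phi * IR (winv k).
Proof.
move=> tp mk kM; have [i e] := en_test tp; rewrite -e.
(* The integrand is split as (m times the transform) times (k / m). *)
pose m w := Num.sqrt (1 + wt w ^+ 2).
have mm : meas m.
  rewrite (_ : m = (fun w => (1 + wt w ^+ 2) `^ 2^-1)).
    apply: (measurableT_comp (measurable_powR _)).
    by apply: measurable_funD => //; apply: measurable_funX; exact: measurable_wt.
  by apply/funext => w; rewrite powR12_sqrt// ltW.
have m0 w : 0 < m w by rewrite sqrtr_gt0.
have m2 w : m w ^+ 2 = 1 + wt w ^+ 2 by rewrite sqr_sqrtr// ltW.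
have mi : meas (fun w => (m w)^-1).
  rewrite (_ : (fun w => _) = (fun w => m w `^ (-1))).
    exact: (measurableT_comp (measurable_powR (-1))).
  by apply/funext => w; rewrite powR_inv1// ltW.
have mT := hartley_meas (test_ig tp).
have E1 w : (m w * hartley phi w) ^+ 2 = (1 + wt w ^+ 2) * hartley phi w ^+ 2.
  by rewrite exprMn m2.
have E2 w : (k w * (m w)^-1) ^+ 2 = winv k w by rewrite exprMn exprVn m2.
have s1 : sq (fun w => m w * hartley phi w).
  by split; [exact: measurable_funM|apply: ig_ext i => w].
have s2 : sq (fun w => k w * (m w)^-1).
  by split; [exact: measurable_funM|apply: ig_ext (winv_ig mk kM) => w].
have := cauchy_schwarz s1 s2.
rewrite /nsq (I_ext E1) (I_ext E2); congr (_ ^+ 2 <= _); apply: I_ext => w.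
have := lt0r_neq0 (m0 w); move: (m w) (hartley _ _) (k w) => a b c a0; by field.
Qed.

Let meas_cas (x : R) : meas (fun w : R => cas (w * x)).
Proof. by apply: continuous_measurable_fun; exact: cont_casM. Qed.

(** The constant that [hartley_CS] gives for point evaluations, as |cas| <= 2. *)
Definition sup_cst : R := (2 * pi)^-1 * IR (winv (fun=> 2)).

(** The squared modulus of continuity of the unit ball. *)
Definition equi (x y : R) : R :=
  (2 * pi)^-1 * IR (winv (fun w => cas (w * x) - cas (w * y))).

Let half_bound (a b e : R) : (2 * pi * a) ^+ 2 <= 2 * pi * e * b ->
  a ^+ 2 <= (2 * pi)^-1 * b * e.
Proof.
have := pi2_gt0; move: (2 * pi) => q q0 h.
rewrite -(ler_pM2l (mulr_gt0 q0 q0)).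
rewrite (_ : q * q * a ^+ 2 = (q * a) ^+ 2); last by ring.
rewrite (_ : q * q * (q^-1 * b * e) = q * e * b)//.
by have := lt0r_neq0 q0 => qn; field.
Qed.

(** By inversion, 2 pi phi(x) is the integral of the transform against
    cas(wx). *)
Lemma test_sup phi x : test_function phi -> phi x ^+ 2 <= sup_cst * en phi.
Proof.
move=> tp; apply: half_bound; rewrite -(hartley_test_inv x tp).
apply: (le_trans (hartley_CS tp (meas_cas x) (fun w => cas_le2 _))).
rewrite ler_wpM2l ?mulr_ge0 ?en_ge0 ?pi_ge0//; apply: I_le.
- exact: winv_ig (meas_cas x) (fun w => cas_le2 _).
- by apply: (@winv_ig _ 2) => // w; rewrite ger0_norm.
- move=> w; rewrite /winv ler_pM2r ?invr_gt0// -sqr_normr lerXn2r ?nnegrE//.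
  exact: cas_le2.
Qed.

Lemma test_equi phi x y : test_function phi ->
  (phi x - phi y) ^+ 2 <= equi x y * en phi.
Proof.
move=> tp; apply: half_bound; rewrite mulrBr -(hartley_test_inv x tp) -(hartley_test_inv y tp).
have iT := hartley_test_ig tp.
have -> : hartley (hartley phi) x - hartley (hartley phi) y =
    IR (fun w => hartley phi w * (cas (w * x) - cas (w * y))).
  have ix := hartley_ig x iT; have iy := hartley_ig y iT.
  rewrite [hartley (hartley phi) x]/(IR _) [hartley (hartley phi) y]/(IR _) -IB//.
  by apply: I_ext => w; rewrite mulrBr.
apply: (hartley_CS (M := 4) tp); first exact: measurable_funB.
move=> w; apply: le_trans (ler_normB _ _) _.
have := cas_le2 (w * x); have := cas_le2 (w * y); lra.
Qed.

Lemma equi_cvg x (y_ : nat -> R) : y_ n @[n --> \oo] --> x ->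
  null_seq (fun n => equi x (y_ n)).
Proof.
move=> hy; apply: null_seqZ; apply/null_seqP.
have b4 y w : `|cas (w * x) - cas (w * y)| <= 4.
  apply: le_trans (ler_normB _ _) _.
  have := cas_le2 (w * x); have := cas_le2 (w * y); lra.
have mb y : meas (fun w : R => cas (w * x) - cas (w * y)) by exact: measurable_funB.
have m4 : ig (winv (fun=> 4)) by apply: (@winv_ig _ 4) => // w; rewrite ger0_norm.
have [|||_ c] := @DCTe R (fun n => winv (fun w => cas (w * x) - cas (w * y_ n)))
  (fun=> 0) (winv (fun=> 4)) _ _ m4; last by rewrite I0 in c.
- by move=> n; exact: ig_meas (winv_ig (mb _) (b4 _)).
- move=> w; rewrite /winv.
  have L : cas (w * x) - cas (w * y_ n) @[n --> \oo] --> (cas (w * x) - cas (w * x) : R).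
    apply: cvgB; first exact: cvg_cst.
    apply: (cvg_comp (fun n => w * y_ n)); last exact: continuous_cas.
    by apply: cvgM => //; exact: cvg_cst.
  rewrite subrr in L.
  have L3 : (cas (w * x) - cas (w * y_ n)) * (cas (w * x) - cas (w * y_ n)) *
      (1 + wt w ^+ 2)^-1 @[n --> \oo] --> (0 * 0 * (1 + wt w ^+ 2)^-1 : R).
    by apply: cvgM; [apply: cvgM|exact: cvg_cst].
  rewrite mulr0 mul0r in L3; exact: L3.
- move=> n w; rewrite /winv normrM ger0_norm ?sqr_ge0// [X in _ * X]ger0_norm; last first.
    by rewrite invr_ge0 ltW.
  by rewrite ler_pM2r ?invr_gt0// -sqr_normr lerXn2r ?nnegrE.
Qed.

(** The convergence at every point selects the continuous representative. *)
Definition approx_by (p : nat -> R -> R) u : Prop :=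
  [/\ forall n, test_function (p n), Dom u,
      null_seq (fun n => en (fun x => p n x - u x)) &
      forall x, null_seq (fun n => p n x - u x)].

Definition Hs u : Prop := exists p, approx_by p u.

Lemma Hs_Dom u : Hs u -> Dom u. Proof. by move=> [p []]. Qed.

Lemma approx_en p u : approx_by p u -> en (p n) @[n --> \oo] --> en u.
Proof. by move=> [tp du h _]; apply: en_cvg => // n; exact: Dom_test. Qed.

Lemma Hs_sup u x : Hs u -> u x ^+ 2 <= sup_cst * en u.
Proof.
move=> [p ap]; have [tp du _ /(_ x)/cvg_nullP hx] := ap.
have h1 : p n x ^+ 2 @[n --> \oo] --> u x ^+ 2 by rewrite expr2; exact: cvgM.
have h2 : sup_cst * en (p n) @[n --> \oo] --> sup_cst * en u.
  by apply: cvgM (approx_en ap); exact: cvg_cst.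
apply: ler_cvg_to h1 h2 _; apply: nearW => n; exact: test_sup.
Qed.

Lemma Hs_equi u x y : Hs u -> (u x - u y) ^+ 2 <= equi x y * en u.
Proof.
move=> [p ap]; have [tp du _ hp] := ap.
have /cvg_nullP hx := hp x; have /cvg_nullP hy := hp y.
have h0 : p n x - p n y @[n --> \oo] --> u x - u y by exact: cvgB.
have h1 : (p n x - p n y) ^+ 2 @[n --> \oo] --> (u x - u y) ^+ 2.
  by rewrite expr2; exact: cvgM.
have h2 : equi x y * en (p n) @[n --> \oo] --> equi x y * en u.
  by apply: cvgM (approx_en ap); exact: cvg_cst.
apply: ler_cvg_to h1 h2 _; apply: nearW => n; exact: test_equi.
Qed.

(** The supremum bound gives the pointwise limit, completeness of L^2 the limit of
    the derivatives, and the closed graph identifies the second as the derivative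
    of the first. *)
Lemma test_complete (p : nat -> R -> R) : (forall n, test_function (p n)) ->
  (forall e : R, 0 < e -> exists N, forall m n, (N <= m)%N -> (N <= n)%N ->
    en (fun x => p m x - p n x) < e) -> exists u, approx_by p u.
Proof.
move=> tp C.
have dn n := Dom_test (tp n).
have s0 : 0 <= sup_cst.
  rewrite mulr_ge0 ?invr_ge0 ?(ltW pi2_gt0)// I_ge0// => w.
  by rewrite /winv divr_ge0 ?sqr_ge0// ltW.
have E m n : en (fun x => p m x - p n x) =
    nsq (fun x => p m x - p n x) + nsq (fun x => D (p m) x - D (p n) x).
  exact: (enE (isLWB (Dom_LW (dn m)) (Dom_LW (dn n)))).
have ptw x : cvgn (fun n => p n x).
  apply: cauchy_cvg; apply/cauchyP => e e0.
  have e2 : 0 < e ^+ 2 / (sup_cst + 1).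
    by rewrite divr_gt0 ?exprn_gt0// ltr_wpDl.
  have [N hN] := C _ e2; exists (p N x); exists N => // n /= Nn.
  suff : `|p N x - p n x| < e by [].
  rewrite -(@ltr_pXn2r _ 2)// ?nnegrE// ?(ltW e0)// sqr_normr.
  have := test_sup x (testB (tp N) (tp n)) => h; apply: (le_lt_trans h).
  have := hN N n (leqnn _) Nn; rewrite ltr_pdivlMr ?ltr_wpDl// => h2.
  by apply: le_lt_trans h2; rewrite mulrC ler_wpM2l ?en_ge0// lerDl.
pose u x := limn (fun n => p n x).
have mp n : meas (p n) by case: (test_sq (tp n)).
have mu : meas u by apply: (measurable_fun_cvg mp) => x _; exact: ptw.
have key e : 0 < e -> exists M, forall n, (M <= n)%N ->
    sq (fun x => p n x - u x) /\ nsq (fun x => p n x - u x) <= e.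
  move=> e0; have [M hM] := C _ e0; exists M => n Mn.
  pose k j x := (p n x - p (j + M)%N x) ^+ 2.
  have [||||ui uI] := @fatouR _ k (fun x => (p n x - u x) ^+ 2) e
    (fun j => (test_sq (testB (tp n) (tp (j + M)%N))).2) (fun j x => sqr_ge0 _).
  - by apply: measurable_funX; exact: measurable_funB.
  - by move=> x; exact: sqr_ge0.
  - apply: aeT => x; rewrite /k expr2; under eq_fun do rewrite expr2.
    have hx' : p n x - p (j + M)%N x @[j --> \oo] --> p n x - u x.
      apply: cvgB; first exact: cvg_cst.
      by rewrite (cvg_shiftn M (fun j => p j x)); exact: ptw.
    exact: cvgM.
  - move=> j; apply: ltW; apply: le_lt_trans (hM n (j + M)%N Mn (leq_addl _ _)).
    by rewrite E lerDl nsq_ge0.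
  by split => //; split => //; exact: measurable_funB.
have su : sq u.
  have [M hM] := key _ (@ltr01 R); have [h _] := hM M (leqnn M).
  have := sqB (test_sq (tp M)) h; congr sq; apply/funext => x; by ring.
have cu : null_seq (fun n => nsq (fun x => p n x - u x)).
  move=> e e0; have [M hM] := key (e / 2) (divr_gt0 e0 (ltr0n _ 2)).
  exists M => n Mn; rewrite ger0_norm ?nsq_ge0//.
  by have [_ h] := hM n Mn; apply: (le_lt_trans h); lra.
have [|e e0|g sg cg] := @riesz_fischer R (fun n => D (p n)).
- by move=> n; case: (Dom_sq (dn n)).
- have [N hN] := C _ e0; exists N => m n Nm Nn.
  by apply: le_lt_trans (hN m n Nm Nn); rewrite E lerDr nsq_ge0.
have lu : isLW u g := isLW_closed (fun n => Dom_LW (dn n)) su sg cu cg.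
exists u; split => //; first by exists g.
- have := null_seqD cu cg; congr null_seq; apply/funext => n.
  by rewrite (enE (isLWB (Dom_LW (dn n)) lu)).
- by move=> x; apply/cvg_nullP; exact: ptw.
Qed.

Lemma approx_cauchy p u : approx_by p u ->
  forall e : R, 0 < e -> exists N, forall m n, (N <= m)%N -> (N <= n)%N ->
    en (fun x => p m x - p n x) < e.
Proof.
move=> [tp du h _] e e0; have [N hN] := h _ (divr_gt0 e0 (ltr0n _ 4)).
exists N => m n Nm Nn; have dn k := Dom_test (tp k).
apply: le_lt_trans (en_tri (dn m) du (dn n)) _.
have := hN m Nm; have := hN n Nn; rewrite !ger0_norm ?en_ge0//.
by rewrite (enBC du (dn n)); do 2 move: (en _) => ?; lra.
Qed.

(** A diagonal choice of test functions approximates the sequence. *)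
Lemma Hs_complete (u_ : nat -> R -> R) : (forall n, Hs (u_ n)) ->
  (forall e : R, 0 < e -> exists N, forall m n, (N <= m)%N -> (N <= n)%N ->
    en (fun x => u_ m x - u_ n x) < e) ->
  exists2 u, Hs u & null_seq (fun n => en (fun x => u_ n x - u x)).
Proof.
move=> hu C.
have /choice[p hp] : forall n, exists phi, test_function phi /\
    en (fun x => phi x - u_ n x) < n.+1%:R^-1.
  move=> n; have [q [tq dq hq _]] := hu n.
  have [|N hN] := hq n.+1%:R^-1; first by rewrite invr_gt0.
  exists (q N); split => //; have := hN N (leqnn _).
  by rewrite ger0_norm ?en_ge0.
have dn n := Dom_test (hp n).1; have du n := Hs_Dom (hu n).
have hn : null_seq (fun n => en (fun x => p n x - u_ n x)).
  apply: null_seq_le (@null_seq_invS R) => n.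
  by rewrite ger0_norm ?en_ge0// ltW//; case: (hp n).
have [|e e0|u au] := @test_complete p; first by move=> n; case: (hp n).
  have e16 : 0 < e / 16 by rewrite divr_gt0.
  have [N hN] := hn _ e16; have [M hM] := C _ e16.
  exists (N + M)%N => m n Nm Nn.
  have h1 := hN m (leq_trans (leq_addr _ _) Nm).
  have h2 := hN n (leq_trans (leq_addr _ _) Nn).
  have h3 := hM m n (leq_trans (leq_addl _ _) Nm) (leq_trans (leq_addl _ _) Nn).
  rewrite !ger0_norm ?en_ge0// in h1 h2.
  have t1 := en_tri (dn m) (du m) (dn n); have t2 := en_tri (du m) (du n) (dn n).
  rewrite (enBC (du n) (dn n)) in t2.
  by move: t1 t2 h1 h2 h3; do 5 move: (en _) => ?; lra.
exists u; first by exists p.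
have [_ dau hau _] := au.
apply: null_seq_le (null_seqD (null_seqZ 2 hn) (null_seqZ 2 hau)) => n.
rewrite ger0_norm ?en_ge0//; apply: le_trans (en_tri (du n) (dn n) dau) _.
by rewrite (enBC (du n) (dn n)).
Qed.

Lemma HsD u v : Hs u -> Hs v -> Hs (fun x => u x + v x).
Proof.
move=> [p [tp du hp pp]] [q [tq dv hq qq]].
exists (fun n x => p n x + q n x); split.
- by move=> n; exact: testD.
- exact: DomD.
- apply: null_seq_le (null_seqD (null_seqZ 2 hp) (null_seqZ 2 hq)) => n.
  rewrite ger0_norm ?en_ge0//.
  rewrite (_ : (fun x => _) = (fun x => (p n x - u x) + (q n x - v x))).
    by apply: enD_le; apply: DomB => //; exact: Dom_test.
  by apply/funext => x; ring.
- move=> x; have := null_seqD (pp x) (qq x); congr null_seq.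
  by apply/funext => n; ring.
Qed.

Lemma HsZ c u : Hs u -> Hs (fun x => c * u x).
Proof.
move=> [p [tp du hp pp]]; exists (fun n x => c * p n x); split.
- by move=> n; exact: testZ.
- exact: DomZ.
- apply: null_seq_le (null_seqZ (c ^+ 2) hp) => n.
  rewrite ger0_norm ?en_ge0//.
  rewrite (_ : (fun x => c * p n x - c * u x) = (fun x => c * (p n x - u x))).
    have d := DomB (Dom_test (tp n)) du.
    have dd := DomZ c d.
    by rewrite -2!ip_en ipZl// ipC ipZl// mulrA.
  by apply/funext => x; rewrite mulrBr.
- move=> x; have := null_seqZ c (pp x); congr null_seq.
  by apply/funext => n; rewrite mulrBr.
Qed.

Lemma Hs_test phi : test_function phi -> Hs phi.
Proof.
move=> tp; exists (fun=> phi); split => //; first exact: Dom_test.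
- move=> e e0; exists 0%N => n _; rewrite ger0_norm ?en_ge0//.
  have d := Dom_test tp.
  have -> : (fun x => phi x - phi x) = (fun x => 0 * phi x).
    by apply/funext => x; rewrite subrr mul0r.
  by rewrite -ip_en ipZl ?mul0r//; exact: DomZ.
- by move=> x e e0; exists 0%N => n _; rewrite subrr normr0.
Qed.

(** A translation by a rotates the pair of the values of the transform at w and - w
    by the angle aw, which preserves the sum of their squares. *)
Lemma en_shift_test a phi : test_function phi -> en (fun x => phi (x + a)) = en phi.
Proof.
move=> tp; have ta := test_shift a tp; congr (_ + _).
  by rewrite /nsq (I_shift a (test_sq tp).2).
suff : 2 * pi * nsq (D (fun x => phi (x + a))) = 2 * pi * nsq (D phi).
  by move: (nsq _) (nsq _) => p q; exact: mulfI (lt0r_neq0 pi2_gt0) _ _.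
rewrite (nsq_D_test ta) (nsq_D_test tp).
have Ti := test_ig tp.
have E w : hartley (fun x => phi (x + a)) w =
    cos (a * w) * hartley phi w - sin (a * w) * hartley phi (- w).
  rewrite /hartley -IZ; last exact: hartley_ig.
  rewrite -IZ; last exact: hartley_ig.
  rewrite -IB; try (by apply: igZ; exact: hartley_ig).
  have i : ig (fun x => phi x * cas ((x - a) * w)).
    apply: (ig_le _ (igZ 2 (ig_abs Ti))).
      apply: measurable_funM; first exact: ig_meas.
      apply: (@measurableT_comp _ _ _ _ _ _ cas).
        by apply: continuous_measurable_fun; exact: continuous_cas.
      by apply: measurable_funM => //; exact: measurable_funB.
    by move=> x; rewrite normrM mulrC ler_wpM2r// cas_le2.
  have := I_shift a i; under eq_fun do rewrite addrK.
  move=> ->; apply: I_ext => x.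
  rewrite (_ : (x - a) * w = x * w - a * w); last by ring.
  by rewrite mulrN casN /cas cosB sinB; ring.
have [s1 _] := hartley_test_sq tp.
pose f w := wt w * hartley phi w; pose fa w := wt w * hartley (fun x => phi (x + a)) w.
have sf : sq f by exact: wt_hartley_sq.
have sfa : sq fa by exact: wt_hartley_sq.
have h1 : nsq fa + nsq (fun w => fa (- w)) = nsq f + nsq (fun w => f (- w)).
  rewrite /nsq -ID; [|exact: sfa.2|exact: (sq_comp_opp sfa).2].
  rewrite -ID; [|exact: sf.2|exact: (sq_comp_opp sf).2].
  apply: I_ext => w; rewrite /fa /f !E !wtN opprK mulrN cosN sinN.
  have := cos2Dsin2 (a * w); move: (cos _) (sin _) (hartley _ _) (hartley _ _).
  move=> c s y x cs.
  transitivity ((c ^+ 2 + s ^+ 2) * (wt w ^+ 2 * (x ^+ 2 + y ^+ 2))); first by ring.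
  by rewrite cs mul1r; ring.
move: h1; rewrite (nsq_opp sfa) (nsq_opp sf) -/fa -/f.
by move: (nsq fa) (nsq f) => a1 a2; lra.
Qed.

Lemma Hs_shift a u : Hs u ->
  Hs (fun x => u (x + a)) /\ en (fun x => u (x + a)) = en u.
Proof.
move=> [p ap]; have [tp du hp pp] := ap; have C := approx_cauchy ap.
have ta n := test_shift a (tp n).
have [|e e0|v av] := @test_complete (fun n x => p n (x + a)) => //.
  have [N hN] := C _ e0; exists N => m n Nm Nn.
  by rewrite (en_shift_test a (testB (tp m) (tp n))); exact: hN.
have [_ dv _ vv] := av.
have E : v = (fun x => u (x + a)).
  apply/funext => x; have /cvg_nullP h1 := vv x; have /cvg_nullP h2 := pp (x + a).
  exact: seq_lim_unique h1 h2.
have c1 := approx_en av; have c2 := approx_en ap.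
rewrite -E; split; first by exists (fun n x => p n (x + a)).
apply: seq_lim_unique c1 _.
suff -> : (fun n => en (fun x => p n (x + a))) = (fun n => en (p n)) by exact: c2.
by apply/funext => n; exact: en_shift_test.
Qed.

(** * Comparison with the completion under the H^alpha norm *)

(** The factor 2 pi comes from the unnormalized Fourier transform, in which
    [Halpha_norm] measures the derivative. *)
Lemma Halpha_normE phi : test_function phi ->
  Halpha_norm alpha phi = (Num.sqrt (nsq phi + 2 * pi * nsq (D phi)))%:E.
Proof.
move=> tp; have [sw nw] := wtC_test alpha_gt alpha_lt tp.
have [sn nn] := normc_sq sw.
have sp := test_sq tp.
rewrite /Halpha_norm /L2Cnorm (L2normE sp) (L2normE sn) nn nw -nsq_D_test//.
rewrite !poweR_EFin powR12_sqrt.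
  congr (Num.sqrt _)%:E; rewrite !powR_mulrn ?sqrtr_ge0// !sqr_sqrtr ?nsq_ge0//.
  by rewrite mulr_ge0 ?nsq_ge0 ?(ltW pi2_gt0).
by rewrite addr_ge0 ?powR_ge0.
Qed.

Let pi2_ge1 : 1 <= 2 * pi :> R.
Proof. by have := pi_ge2 R; lra. Qed.

Lemma Halpha_norm_lt phi (e : R) : test_function phi -> 0 < e ->
  (Halpha_norm alpha phi < e%:E)%E = (nsq phi + 2 * pi * nsq (D phi) < e ^+ 2).
Proof.
move=> tp e0; rewrite Halpha_normE// lte_fin.
have h0 : 0 <= nsq phi + 2 * pi * nsq (D phi).
  by rewrite addr_ge0 ?nsq_ge0// mulr_ge0 ?nsq_ge0 ?(ltW pi2_gt0).
by rewrite -(@ltr_pXn2r _ 2)// ?nnegrE ?sqrtr_ge0 ?(ltW e0)// sqr_sqrtr.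
Qed.

Lemma Hs_Halpha u : Hs u -> Halpha alpha u.
Proof.
move=> [p ap]; have [tp du hp _] := ap; have C := approx_cauchy ap.
have [su _] := Dom_sq du.
split; first exact/sq_L2.
exists p; split => //.
  move=> e e0; have e2 : 0 < e ^+ 2 / (2 * pi) by rewrite divr_gt0 ?exprn_gt0 ?pi2_gt0.
  have [N hN] := C _ e2; exists N => m n Nm Nn.
  rewrite Halpha_norm_lt//; last exact: testB.
  have := hN m n Nm Nn; rewrite ltr_pdivlMr ?pi2_gt0// => h; apply: le_lt_trans h.
  rewrite /en; have n0 := nsq_ge0 (fun x => p m x - p n x); move: n0 pi2_ge1.
  move: (2 * pi) (nsq _) (nsq _) => q y z y0 q1.
  by have := ler_peMr y0 q1; lra.
apply/L2normP; first by move=> n; apply: sqB => //; exact: test_sq.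
apply: null_seq_le hp => n; rewrite ger0_norm ?nsq_ge0// /en lerDl nsq_ge0//.
Qed.

(** A Cauchy sequence representing u converges in energy to an element v of the
    energy space, and both are its limit in L^2. *)
Lemma Halpha_Hs u : Halpha alpha u -> Dom u /\
  exists2 v, Hs v & {ae leb R, forall x, u x = v x} /\ {ae leb R, forall x, D u x = D v x}.
Proof.
move=> [/sq_L2 su [p [tp C cu]]].
have dn n := Dom_test (tp n).
have cu' : null_seq (fun n => nsq (fun x => p n x - u x)).
  by apply/L2normP => // n; apply: sqB => //; exact: test_sq.
have [e e0|v av] := @test_complete p tp.
  have [|N hN] := C (Num.sqrt e); first by rewrite sqrtr_gt0.
  exists N => m n Nm Nn; have := hN m n Nm Nn.
  rewrite Halpha_norm_lt ?sqrtr_gt0//; last exact: testB.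
  rewrite sqr_sqrtr ?ltW//; apply: le_lt_trans.
  by rewrite /en lerD2l ler_peMl ?nsq_ge0.
have [_ dv hv _] := av.
have [sv sDv] := Dom_sq dv.
have E n : en (fun x => p n x - v x) =
    nsq (fun x => p n x - v x) + nsq (fun x => D (p n) x - D v x).
  exact: (enE (isLWB (Dom_LW (dn n)) (Dom_LW dv))).
have lu : isLW u (D v).
  apply: (isLW_closed (fun n => Dom_LW (dn n)) su sDv cu').
  by apply: null_seq_le hv => n; rewrite E ger0_norm ?nsq_ge0// lerDr nsq_ge0.
have du : Dom u by exists (D v).
split => //; exists v; first by exists p.
split; last exact: isLW_uniq (Dom_LW du) lu.
have suv : sq (fun x => u x - v x) by exact: sqB.
suff n0 : nsq (fun x => u x - v x) = 0.
  by apply: aeS (nsq_eq0 suv n0) => x /eqP; rewrite subr_eq0 => /eqP.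
apply/eqP; rewrite eq_le nsq_ge0 andbT; apply/ler_addgt0Pr => e e0.
have e4 : 0 < e / 4 by rewrite divr_gt0.
have [N hN] := cu' _ e4; have [M hM] := hv _ e4; pose k := (N + M)%N.
have := hN k (leq_addr M N); have := hM k (leq_addl N M).
rewrite !ger0_norm ?nsq_ge0 ?en_ge0// E add0r => h1 h2.
apply: le_trans (nsq_tri su (test_sq (tp k)) sv) _.
rewrite (nsqBC u); have := nsq_ge0 (fun x => D (p k) x - D v x); lra.
Qed.

End energy.

(** * Hilbert spaces of functions with bounded point evaluations *)

(** What the variational argument needs to know about the energy space. Bounded
    point evaluations and equicontinuity of the bounded sets provide pointwise
    convergent subsequences, and take the place of compact embeddings. *)
Record fspace {R : realType} (H : (R -> R) -> Prop)
    (ip : (R -> R) -> (R -> R) -> R) : Prop := FSpace {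
  fsD : forall u v, H u -> H v -> H (fun x => u x + v x);
  fsZ : forall c u, H u -> H (fun x => c * u x);
  fs_ipC : forall u v, ip u v = ip v u;
  fs_ipD : forall u v w, H u -> H v -> H w ->
    ip (fun x => u x + v x) w = ip u w + ip v w;
  fs_ipZ : forall c u w, H u -> H w -> ip (fun x => c * u x) w = c * ip u w;
  fs_L2 : forall u, H u -> sq u /\ nsq u <= ip u u;
  fs_sup : exists2 C, 0 < C & forall u x, H u -> u x ^+ 2 <= C * ip u u;
  fs_equi : exists2 om : R -> R -> R,
    forall u x y, H u -> (u x - u y) ^+ 2 <= om x y * ip u u &
    forall x y_, y_ n @[n --> \oo] --> x -> null_seq (fun n => om x (y_ n));
  fs_complete : forall u_ : nat -> R -> R, (forall n, H (u_ n)) ->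
    (forall e : R, 0 < e -> exists N, forall m n, (N <= m)%N -> (N <= n)%N ->
      ip (fun x => u_ m x - u_ n x) (fun x => u_ m x - u_ n x) < e) ->
    exists2 u, H u &
      null_seq (fun n => ip (fun x => u_ n x - u x) (fun x => u_ n x - u x));
  fs_shift : forall a u, H u -> H (fun x => u (x + a)) /\
    ip (fun x => u (x + a)) (fun x => u (x + a)) = ip u u;
  fs_pos : exists u x, H u /\ 0 < u x }.

Section hilbert.
Context {R : realType}.
Variables (H : (R -> R) -> Prop) (ip : (R -> R) -> (R -> R) -> R).
Hypothesis X : fspace H ip.
Implicit Types u v w p q : R -> R.

Definition nn u : R := ip u u.

Lemma fsN u : H u -> H (fun x => - u x).
Proof.
by move=> /(fsZ X (-1)); congr H; apply/funext => x; rewrite mulN1r.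
Qed.

Lemma fsB u v : H u -> H v -> H (fun x => u x - v x).
Proof. by move=> hu hv; apply: (fsD X) => //; exact: fsN. Qed.

Lemma nn_ge0 u : H u -> 0 <= nn u.
Proof. by move=> /(fs_L2 X)[_]; apply: le_trans; exact: nsq_ge0. Qed.

Lemma ipDr u v w : H u -> H v -> H w ->
  ip w (fun x => u x + v x) = ip w u + ip w v.
Proof. by move=> hu hv hw; rewrite (fs_ipC X) (fs_ipD X)// !(fs_ipC X _ w). Qed.

Lemma ipZr c u w : H u -> H w -> ip w (fun x => c * u x) = c * ip w u.
Proof. by move=> hu hw; rewrite (fs_ipC X) (fs_ipZ X)// (fs_ipC X w). Qed.

Lemma fs_ipN u w : H u -> H w -> ip (fun x => - u x) w = - ip u w.
Proof.
move=> hu hw; rewrite -mulN1r -(fs_ipZ X)//; congr ip.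
by apply/funext => x; rewrite mulN1r.
Qed.

Lemma fs_ipNr u w : H u -> H w -> ip w (fun x => - u x) = - ip w u.
Proof. by move=> hu hw; rewrite (fs_ipC X) fs_ipN// (fs_ipC X w). Qed.

Lemma fs_ipB u v w : H u -> H v -> H w ->
  ip (fun x => u x - v x) w = ip u w - ip v w.
Proof. by move=> hu hv hw; rewrite (fs_ipD X)//; [rewrite fs_ipN|exact: fsN]. Qed.

Lemma nnD u v : H u -> H v -> nn (fun x => u x + v x) = nn u + 2 * ip u v + nn v.
Proof.
move=> hu hv; have huv := fsD X hu hv.
rewrite /nn (fs_ipD X)// !ipDr// (fs_ipC X v u); ring.
Qed.

Lemma nnZ c u : H u -> nn (fun x => c * u x) = c ^+ 2 * nn u.
Proof.
move=> hu; have hcu := fsZ X c hu.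
by rewrite /nn (fs_ipZ X)// ipZr// mulrA.
Qed.

Lemma nnN u : H u -> nn (fun x => - u x) = nn u.
Proof. by move=> hu; rewrite /nn fs_ipN ?fs_ipNr ?opprK//; exact: fsN. Qed.

Lemma nnB u v : H u -> H v -> nn (fun x => u x - v x) = nn u - 2 * ip u v + nn v.
Proof. by move=> hu hv; rewrite nnD ?nnN ?fs_ipNr//; [ring|exact: fsN]. Qed.

Lemma fs_CS u v : H u -> H v -> ip u v ^+ 2 <= nn u * nn v.
Proof.
move=> hu hv; apply: quad_disc => t; have htv := fsZ X t hv.
have := nn_ge0 (fsD X hu htv); rewrite nnD// nnZ// ipZr//.
by rewrite mulrA.
Qed.

Lemma fs_cont u : H u -> continuous u.
Proof.
move=> hu x; have [om h1 h2] := fs_equi X.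
apply/(@cvg_nbhsP _ R^o) => y_ cy; apply/cvg_nullP; apply: null_seq_sqr.
apply: null_seq_le (null_seqZ (nn u) (h2 x y_ cy)) => n.
rewrite ger0_norm ?sqr_ge0// mulrC -(sqrrN (u (y_ n) - u x)) opprB.
exact: h1.
Qed.

Lemma fs_meas u : H u -> meas u.
Proof. by move=> hu; apply: continuous_measurable_fun; exact: fs_cont. Qed.

Lemma nn_ptw (u_ : nat -> R -> R) u : (forall n, H (u_ n)) -> H u ->
  null_seq (fun n => nn (fun x => u_ n x - u x)) ->
  forall x, u_ n x @[n --> \oo] --> u x.
Proof.
move=> hn hu h x; have [C C0 hC] := fs_sup X.
apply/cvg_nullP; apply: null_seq_sqr; apply: null_seq_le (null_seqZ C h) => n.
by rewrite ger0_norm ?sqr_ge0//; apply: (hC (fun x => u_ n x - u x)); exact: fsB.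
Qed.

Lemma nn_ip (u_ : nat -> R -> R) u v : (forall n, H (u_ n)) -> H u -> H v ->
  null_seq (fun n => nn (fun x => u_ n x - u x)) ->
  ip (u_ n) v @[n --> \oo] --> ip u v.
Proof.
move=> hn hu hv h; apply/cvg_nullP; apply: null_seq_sqr.
apply: null_seq_le (null_seqZ (nn v) h) => n.
rewrite ger0_norm ?sqr_ge0// -fs_ipB// mulrC; apply: fs_CS => //; exact: fsB.
Qed.

Definition mid p q : R -> R := fun x => 2^-1 * (p x + q x).

(** The hull of the tail of a sequence under midpoints, which are all that the
    parallelogram identity needs; as an intersection of classes, it comes with its
    induction principle. *)
Definition hull (u_ : nat -> R -> R) (m : nat) p : Prop :=
  forall Q : (R -> R) -> Prop, (forall p q, Q p -> Q q -> Q (mid p q)) ->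
    (forall k, (m <= k)%N -> Q (u_ k)) -> Q p.

Lemma hull_mid (u_ : nat -> R -> R) m p q : hull u_ m p -> hull u_ m q -> hull u_ m (mid p q).
Proof. by move=> hp hq Q Qm Qu; apply: (Qm); [exact: hp|exact: hq]. Qed.

Lemma hull_le (u_ : nat -> R -> R) m l p : (m <= l)%N -> hull u_ l p -> hull u_ m p.
Proof.
by move=> ml hp Q Qm Qu; apply: hp => // k lk; apply: Qu; exact: leq_trans lk.
Qed.

Lemma hull_in (u_ : nat -> R -> R) m k : (m <= k)%N -> hull u_ m (u_ k).
Proof. by move=> mk Q _; apply. Qed.

Lemma fs_mid p q : H p -> H q -> H (mid p q).
Proof. by move=> hp hq; apply: (fsZ X); exact: (fsD X). Qed.

Lemma parallelogram p q : H p -> H q ->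
  nn (fun x => p x - q x) + 4 * nn (mid p q) = 2 * nn p + 2 * nn q.
Proof.
move=> hp hq; rewrite /mid nnZ ?nnB ?nnD//; first by field.
exact: (fsD X).
Qed.

Lemma hull_H (u_ : nat -> R -> R) m p : (forall n, H (u_ n)) -> hull u_ m p -> H p.
Proof. by move=> hu; apply; [exact: fs_mid|]. Qed.

(** Nearly minimal elements of the hulls of the tails form a Cauchy sequence, so
    that the pointwise limit is a strong limit of convex combinations. *)
Lemma mazur (u_ : nat -> R -> R) u (B : R) : (forall n, H (u_ n)) ->
  (forall n, nn (u_ n) <= B) -> (forall x, u_ n x @[n --> \oo] --> u x) ->
  H u /\ exists p : nat -> R -> R, [/\ forall m, hull u_ m (p m),
    forall m, H (p m) & null_seq (fun n => nn (fun x => p n x - u x))].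
Proof.
move=> hu uB cu.
have hH m p : hull u_ m p -> H p by exact: hull_H.
pose S m := [set nn p | p in [set p | hull u_ m p]].
have S0 m : S m !=set0 by exists (nn (u_ m)); exists (u_ m) => //; exact: hull_in.
have Sb m : has_lbound (S m).
  by exists 0 => _ [p hp <-]; apply: nn_ge0; exact: hH hp.
(* d increases with m since the hulls shrink, and it is bounded by B; near-minimal
   elements of the hulls are close to each other by the parallelogram identity. *)
pose d m := inf (S m).
have dle m p : hull u_ m p -> d m <= nn p.
  by move=> hp; apply: ge_inf => //; exists p.
have dmono m l : (m <= l)%N -> d m <= d l.
  move=> ml; apply: lb_le_inf => // _ [p hp <-].
  by apply: dle; exact: hull_le hp.
have dB m : d m <= B by apply: le_trans (uB m); apply: dle; exact: hull_in.
have cd : cvgn d.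
  apply: nondecreasing_is_cvgn.
    by apply/nondecreasing_seqP => n; exact: dmono.
  by exists B => _ [n _ <-].
have [dl hdl] : exists dl : R, d n @[n --> \oo] --> dl by exists (limn d).
have /choice[p hp] : forall m, exists p, hull u_ m p /\ nn p < d m + m.+1%:R^-1.
  move=> m; have i0 : (0 : R) < m.+1%:R^-1 by rewrite invr_gt0.
  have [_ [q hq <-] lt] := inf_adherent i0 (conj (S0 m) (Sb m)).
  by exists q.
have Hp m : H (p m) by exact: hH (hp m).1.
have est m l : (m <= l)%N ->
    nn (fun x => p m x - p l x) <= 2 * (d l - d m) + 2 * m.+1%:R^-1 + 2 * l.+1%:R^-1.
  move=> ml; have := parallelogram (Hp m) (Hp l).
  have := dle m _ (hull_mid (hp m).1 (hull_le ml (hp l).1)).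
  have := (hp m).2; have := (hp l).2.
  move: (m.+1%:R^-1) (l.+1%:R^-1) => im il; do 4 move: (nn _) => ?; lra.
have pc e : 0 < e -> exists N, forall m l, (N <= m)%N -> (N <= l)%N ->
    nn (fun x => p m x - p l x) < e.
  move=> e0; have e8 : 0 < e / 16 by rewrite divr_gt0.
  have /cvg_seqP/(_ _ e8)[N hN] := hdl; have [M hM] := @null_seq_invS R _ e8.
  exists (N + M)%N => m l.
  have W i j : (N + M <= i)%N -> (i <= j)%N -> nn (fun x => p i x - p j x) < e.
    move=> Ni ij; have Nj := leq_trans Ni ij.
    have h1 := hN i (leq_trans (leq_addr _ _) Ni).
    have h2 := hN j (leq_trans (leq_addr _ _) Nj).
    have h3 := hM i (leq_trans (leq_addl _ _) Ni).
    have h4 := hM j (leq_trans (leq_addl _ _) Nj).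
    apply: le_lt_trans (est i j ij) _; move: h1 h2 h3 h4.
    rewrite !ltr_norml; move: (i.+1%:R^-1) (j.+1%:R^-1) => im jm.
    move=> /andP[? ?] /andP[? ?] /andP[? ?] /andP[? ?]; lra.
  move=> Nm Nl; have [ml|lm] := leqP m l; first exact: W.
  have := W l m Nl (ltnW lm).
  rewrite -(nnN (fsB (Hp l) (Hp m))); congr (nn _ < _).
  by apply/funext => x; rewrite opprB.
have [v hv cv] := fs_complete X Hp pc.
have Ev : v = u.
  apply/funext => x; have c1 : p n x @[n --> \oo] --> v x by exact: nn_ptw.
  suff c2 : p n x @[n --> \oo] --> u x by exact: seq_lim_unique c1 c2.
  apply/cvg_seqP => e e0; have e2 : 0 < e / 2 by rewrite divr_gt0.
  have /cvg_seqP/(_ _ e2)[N hN] := cu x; exists N => n Nn.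
  suff : `|p n x - u x| <= e / 2 by move=> h; apply: le_lt_trans h _; lra.
  apply: ((hp n).1 (fun q => `|q x - u x| <= e / 2)) => [a b ha hb|k nk].
    rewrite /mid; move: ha hb; rewrite !ler_norml => /andP[? ?] /andP[? ?].
    apply/andP; split; lra.
  by apply: ltW; apply: hN; exact: leq_trans nk.
rewrite Ev in hv cv; split => //; exists p; split => // m.
by case: (hp m).
Qed.

(** If ip (u_ n) v stayed above ip u v + e along a subsequence, it would do so for
    the convex combinations of [mazur], which converge strongly to u. *)
Lemma weak_limit (u_ : nat -> R -> R) u (B : R) : (forall n, H (u_ n)) ->
  (forall n, nn (u_ n) <= B) -> (forall x, u_ n x @[n --> \oo] --> u x) ->
  H u /\ forall v, H v -> ip (u_ n) v @[n --> \oo] --> ip u v.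
Proof.
move=> hu uB cu; have [Hu _] := mazur hu uB cu; split => //.
have one v e : H v -> 0 < e -> exists N, forall n, (N <= n)%N ->
    ip (u_ n) v < ip u v + e.
  move=> hv e0; apply: contrapT => /forallNP no.
  have /choice[t ht] : forall N, exists n, (N <= n)%N /\ ip u v + e <= ip (u_ n) v.
    move=> N; have /existsNP[n /not_implyP[Nn /negP]] := no N.
    by rewrite -leNgt => h; exists n.
  have ct x : u_ (t n) x @[n --> \oo] --> u x.
    apply/cvg_seqP => d d0; have /cvg_seqP/(_ _ d0)[N hN] := cu x; exists N => n Nn.
    by apply: hN; apply: leq_trans Nn _; case: (ht n).
  have [_ [p [hp Hp cp]]] := mazur (fun n => hu (t n)) (fun n => uB (t n)) ct.
  have c := nn_ip Hp Hu hv cp.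
  have lower n : ip u v + e <= ip (p n) v.
    have [] : H (p n) /\ ip u v + e <= ip (p n) v; last by [].
    apply: (hp n (fun q => H q /\ ip u v + e <= ip q v)) => [a b [Ha la] [Hb lb]|k nk].
      split; first exact: fs_mid.
      rewrite /mid (fs_ipZ X)//; last exact: (fsD X).
      rewrite (fs_ipD X)//; lra.
    by split; [exact: hu|case: (ht k)].
  have /cvg_seqP/(_ _ e0)[N hN] := c.
  have := hN N (leqnn _); have := lower N; rewrite ltr_norml => ? /andP[_]; lra.
move=> v hv; apply/cvg_seqP => e e0.
have [N hN] := one v e hv e0; have [M hM] := one _ e (fsN hv) e0.
exists (N + M)%N => n nN.
have h1 := hN n (leq_trans (leq_addr _ _) nN).
have h2 := hM n (leq_trans (leq_addl _ _) nN).
rewrite !fs_ipNr// in h2; rewrite ltr_norml; apply/andP; split; lra.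
Qed.

(** The limit is taken along an ultrafilter, the subsequence is selected on the
    rationals, and equicontinuity handles the other points. *)
Lemma subseq_ptw (u_ : nat -> R -> R) (B : R) : (forall n, H (u_ n)) ->
  (forall n, nn (u_ n) <= B) ->
  exists (s : nat -> nat) u, (forall k, (k <= s k)%N) /\
    forall x, u_ (s k) x @[k --> \oo] --> u x.
Proof.
move=> hu uB.
have B0 : 0 <= B by apply: le_trans (uB 0%N); exact: nn_ge0.
have [C C0 hC] := fs_sup X; have [om ho1 ho2] := fs_equi X.
have [U [UU subU]] := @ultraFilterLemma nat \oo _.
pose M := C * B + 1.
have M0 : 0 < M by rewrite ltr_wpDl// mulr_ge0// ltW.
have ub n x : `|u_ n x| <= M.
  have h : u_ n x ^+ 2 <= C * B.
    by apply: le_trans (hC _ x (hu n)) _; apply: ler_wpM2l; [exact: ltW|exact: uB].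
  have M1 : 1 <= M by rewrite lerDr mulr_ge0// ltW.
  rewrite -(@ler_pXn2r _ 2)// ?nnegrE ?(ltW M0)// sqr_normr; apply: (le_trans h).
  by apply: (@le_trans _ _ M); [rewrite lerDl|rewrite expr2 ler_peMr// ltW].
have U0 A : U A -> A !=set0 by exact: filter_ex.
have lim x : exists L : R, forall e : R, 0 < e -> U [set n | `|u_ n x - L| < e].
  pose S := [set c : R | U [set n | c <= u_ n x]].
  have SM : S (- M).
    by apply: (@filterS _ U _ setT) filterT => n _ /=; have := ub n x; rewrite ler_norml => /andP[].
  have Sub : ubound S M.
    move=> c /U0[n /= cn]; apply: le_trans cn _.
    by have := ub n x; rewrite ler_norml => /andP[].
  have Sup : has_sup S by split; [exists (- M)|exists M].
  exists (sup S) => e e0.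
  have [c Sc ce] := sup_adherent e0 Sup.
  have nS : ~ S (sup S + e).
    by move=> h; have := ub_le_sup Sup.2 h; rewrite gerDl leNgt e0.
  have Uc : U (~` [set n | sup S + e <= u_ n x]).
    by have [|] := @in_ultra_setVsetC _ U [set n | sup S + e <= u_ n x] UU.
  apply: filterS (filterI Sc Uc) => n /= [h1 /negP]; rewrite -ltNge => h2.
  rewrite ltr_norml; apply/andP; split; lra.
have /choice[u hU] := lim.
(* An enumeration of the rationals. *)
pose q (j : nat) : R := ratr (odflt (0 : rat) (unpickle j)).
have /choice[s hs] : forall k : nat, exists n : nat, (k <= n)%N /\
    forall j, (j < k)%N -> `|u_ n (q j) - u (q j)| < k.+1%:R^-1.
  move=> k.
  have fin l : U [set n | forall j, (j < l)%N -> `|u_ n (q j) - u (q j)| < k.+1%:R^-1].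
    elim: l => [|l IHl].
      by apply: (@filterS _ U _ setT) filterT => n _ /= j.
    have i0 : (0 : R) < k.+1%:R^-1 by rewrite invr_gt0.
    apply: filterS (filterI IHl (hU (q l) _ i0)) => n /= [h1 h2] j.
    by rewrite ltnS leq_eqVlt => /predU1P[->//|]; exact: h1.
  have [n [h1 h2]] := U0 _ (filterI (fin k) (subU _ (nbhs_infty_ge k))).
  by exists n.
exists s, u; split; first by move=> k; case: (hs k).
move=> x; apply/cvg_seqP => e e0.
have e5 : 0 < e / 5 by rewrite divr_gt0.
have [j hj] : exists j, forall n, `|u_ n x - u_ n (q j)| < e / 5.
  have /choice[r hr] : forall n : nat, exists r : rat, x < ratr r < x + n.+1%:R^-1.
    move=> n; have [|r] := @rat_in_itvoo R x (x + n.+1%:R^-1).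
      by rewrite ltrDl invr_gt0.
    by rewrite in_itv /=; exists r.
  have rx : (ratr (r n) : R) @[n --> \oo] --> x.
    apply/cvg_nullP; apply: null_seq_le (@null_seq_invS R) => n.
    have /andP[h1 h2] := hr n; rewrite ger0_norm ?subr_ge0 ?ltW//.
    by rewrite ltrBlDl.
  have d0 : 0 < (e / 5) ^+ 2 / (B + 1) by rewrite divr_gt0 ?exprn_gt0// ltr_wpDl.
  have [N hN] := ho2 x _ rx _ d0.
  exists (pickle (r N)) => n.
  have -> : q (pickle (r N)) = ratr (r N) by rewrite /q pickleK.
  have h := hN N (leqnn _); rewrite -(@ltr_pXn2r _ 2)// ?nnegrE ?(ltW e5)//.
  rewrite sqr_normr; apply: le_lt_trans (ho1 _ x _ (hu n)) _.
  rewrite ltr_pdivlMr ?ltr_wpDl// in h; apply: le_lt_trans h.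
  apply: (@le_trans _ _ (`|om x (ratr (r N))| * nn (u_ n))).
    by rewrite ler_wpM2r ?nn_ge0// ler_norm.
  by rewrite ler_wpM2l//; apply: le_trans (uB n) _; rewrite lerDl.
have Lx : `|u x - u (q j)| < 3 * (e / 5).
  have [n [/= h1 h2]] := U0 _ (filterI (hU x _ e5) (hU (q j) _ e5)).
  have := hj n; move: h1 h2; rewrite !ltr_norml => /andP[? ?] /andP[? ?] /andP[? ?].
  apply/andP; split; lra.
have [N hN] := @null_seq_invS R _ e5.
exists (maxn N j.+1) => k; rewrite geq_max => /andP[Nk jk].
have h1 := (hs k).2 j jk; have := hN k Nk; rewrite ger0_norm ?invr_ge0// => h2.
have h3 := lt_trans h1 h2; have h4 := hj (s k); move: h3 h4 Lx.
rewrite !ltr_norml => /andP[? ?] /andP[? ?] /andP[? ?].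
apply/andP; split; lra.
Qed.

End hilbert.

(** * The nonlinearity *)

(** The bounds [nl_small] and [nl_lip] are one-sided because f is non-negative;
    uniformity in t is what makes them survive translations. *)
Record nonlin {R : realType} (f F : R -> R -> R) (theta : R) : Prop := Nonlin {
  nl_theta : 2 < theta;
  nl_cont : continuous (fun z : R * R => f z.1 z.2);
  nl_ge0 : forall t x, 0 <= f t x;
  nl_neg : forall t x, x <= 0 -> f t x = 0;
  nl_Fneg : forall t x, x <= 0 -> F t x = 0;
  nl_der : forall t (x : R), is_derive x (1 : R) (F t) (f t x);
  nl_AR : forall t x, 0 < x -> 0 < theta * F t x <= f t x * x;
  nl_small : forall e, 0 < e -> exists2 d, 0 < d &
    forall t x, `|x| < d -> f t x <= e * `|x|;
  nl_lip : forall M, exists2 L, 0 < L &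
    forall t x, x <= M -> f t x <= L * `|x|;
  nl_mono : forall t x y, 0 < x -> x < y -> f t x * y < f t y * x }.

Section nonlinearity.
Context {R : realType}.
Implicit Types (G g u v : R -> R).

Lemma mean_value G g (a b : R) : (forall x : R, is_derive x (1 : R) G (g x)) ->
  exists2 c, Num.min a b <= c <= Num.max a b & G b - G a = g c * (b - a).
Proof.
move=> dG; have cG : continuous G by move=> x; exact: is_derive_cont (dG x).
have W (x y : R) : x < y -> exists2 c, x <= c <= y & G y - G x = g c * (y - x).
  move=> xy; have [|c] := @MVT R G g x y xy (fun z _ => dG z).
    exact: continuous_subspaceT.
  by rewrite in_itv /= => /andP[/ltW xc /ltW cy] E; exists c; rewrite ?xc ?cy.
have [ab|ba|->] := ltgtP a b.
- exact: W.
- have [c hc E] := W _ _ ba; exists c => //.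
  by rewrite -[RHS]opprK -mulrN opprB -E opprB.
- by exists b; rewrite ?lexx// !subrr mulr0.
Qed.

Variables (f F : R -> R -> R) (theta : R).
Hypothesis N : nonlin f F theta.

Lemma f_zero t : f t 0 = 0. Proof. exact: (nl_neg N). Qed.

Lemma F_ge0 t x : 0 <= F t x.
Proof.
have [x0|x0] := leP x 0; first by rewrite (nl_Fneg N).
have /andP[h _] := nl_AR N t x0; have := nl_theta N => th.
by move: h; rewrite pmulr_rgt0; [exact: ltW|lra].
Qed.

Lemma F_gt0 t x : 0 < x -> 0 < F t x.
Proof.
move=> x0; have /andP[h _] := nl_AR N t x0; have := nl_theta N => th.
by move: h; rewrite pmulr_rgt0//; lra.
Qed.

Lemma fx_ge0 t x : 0 <= f t x * x.
Proof.
have [x0|x0] := leP x 0; first by rewrite (nl_neg N)// mul0r.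
by rewrite mulr_ge0 ?(nl_ge0 N)// ltW.
Qed.

Lemma AR_le t x : theta * F t x <= f t x * x.
Proof.
have [x0|x0] := leP x 0; first by rewrite (nl_neg N)// (nl_Fneg N)// mulr0 mul0r.
by have /andP[] := nl_AR N t x0.
Qed.

Lemma F_le_fx t x : 2 * F t x <= f t x * x.
Proof.
apply: le_trans (AR_le t x); apply: ler_wpM2r; first exact: F_ge0.
exact: ltW (nl_theta N).
Qed.

Lemma f_mono_le t x y : 0 <= x -> x <= y -> f t x * y <= f t y * x.
Proof.
rewrite le_eqVlt => /predU1P[<-|x0]; first by rewrite f_zero mul0r mulr0.
rewrite le_eqVlt => /predU1P[->//|xy]; exact: ltW (nl_mono N t x0 xy).
Qed.

(** Since f(y)/y increases, F(y) - y^2 f(x)/(2x) is minimal at y = x. *)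
Lemma F_scale t x s : 0 <= s ->
  F t x + (s ^+ 2 - 1) / 2 * (f t x * x) <= F t (s * x).
Proof.
move=> s0; have [x0|x0] := leP x 0.
  rewrite (nl_neg N)// !(nl_Fneg N)//; last by rewrite mulr_ge0_le0.
  by rewrite mul0r mulr0 addr0.
have dG (y : R) : is_derive y (1 : R) (fun y => F t y * x - y * (y * f t x / 2))
    (f t y * x - y * f t x).
  have h := is_deriveM_R (nl_der N t y) (is_derive_cst x y (1 : R)).
  have k := is_deriveM_R (is_derive_id y (1 : R)) (is_derive_affine (f t x / 2) 0 y).
  have kk := is_deriveM_R k (is_derive_cst (-1 : R) y (1 : R)).
  have := is_deriveD_R h kk; congr is_derive.
    by apply/funext => z; rewrite /cst/=; field.
  by rewrite /cst/=; field.
suff : F t x * x - x * (x * f t x / 2) <=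
    F t (s * x) * x - s * x * (s * x * f t x / 2).
  move=> h; rewrite -(ler_pM2r x0).
  rewrite -subr_ge0 in h; rewrite -subr_ge0; apply: le_trans h _.
  by rewrite le_eqVlt; apply/orP; left; apply/eqP; field.
have [c /andP[c1 c2] E] := mean_value x (s * x) dG.
rewrite -subr_ge0 E.
have [s1|s1] := leP 1 s.
  have xsx : x <= s * x by rewrite ler_peMl// ltW.
  move: c1 c2; rewrite min_l ?max_r// => xc cs.
  by rewrite mulr_ge0 ?subr_ge0// mulrC f_mono_le// ltW.
have sxx : s * x <= x by rewrite ler_piMl// ltW.
move: c1 c2; rewrite min_r ?max_l// => sc cx.
rewrite mulr_le0 ?subr_le0// [leRHS]mulrC f_mono_le//.
by apply: le_trans sc; rewrite mulr_ge0// ltW.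
Qed.

Lemma F_double_f t x : 3 / 2 * (f t x * x) <= F t (2 * x).
Proof.
have := F_scale t x (ler0n R 2); have := F_ge0 t x; move: (f t x * x) => y; lra.
Qed.

(** [F_scale] with s = 2 and the Ambrosetti-Rabinowitz condition. As theta > 2 the
    factor exceeds 4 = 2^2, so that F grows faster than the square along the powers
    of 2. *)
Lemma F_double t x : (1 + 3 / 2 * theta) * F t x <= F t (2 * x).
Proof.
have := F_scale t x (ler0n R 2); have := AR_le t x.
by move: (f t x * x) => y h1 h2; nra.
Qed.

Lemma F_pow2 t x k : (1 + 3 / 2 * theta) ^+ k * F t x <= F t (2 ^+ k * x).
Proof.
have th := nl_theta N; have D := F_double t.
have : 0 <= 1 + 3 / 2 * theta by lra.
move: (1 + _) D => q D q0.
elim: k => [|k IH]; first by rewrite !expr0 !mul1r.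
rewrite !exprS -!mulrA; apply: le_trans (D _).
exact: ler_wpM2l.
Qed.

Section bounded_range.
Variables (M L : R).
Hypothesis fL : forall t x, x <= M -> f t x <= L * `|x|.

Lemma f_norm_le t x : x <= M -> `|f t x| <= L * `|x|.
Proof. by move=> xM; rewrite ger0_norm ?(nl_ge0 N) ?fL. Qed.

Lemma fx_le t x : x <= M -> f t x * x <= L * x ^+ 2.
Proof.
move=> xM; apply: le_trans (ler_norm _) _.
by rewrite normrM -sqr_normr expr2 mulrA ler_wpM2r// f_norm_le.
Qed.

Lemma F_le t x : x <= M -> F t x <= L * x ^+ 2.
Proof.
move=> xM; apply: le_trans (fx_le t xM); have := F_le_fx t x; have := F_ge0 t x; lra.
Qed.

(** The mean value theorem, with the smaller of |a| and |b| as increment. This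
    replaces the Brezis-Lieb lemma. *)
Lemma F_split t a b : `|a| + `|b| <= M ->
  `|F t (a + b) - F t a - F t b| <= 3 * L * (`|a| * `|b|).
Proof.
wlog ba : a b / `|b| <= `|a|.
  move=> W h; have [?|/ltW ab] := leP `|b| `|a|; first exact: W.
  rewrite (addrC a) -addrA (addrC (- _)) addrA (mulrC `|a|); apply: W => //.
  by rewrite addrC.
move=> abM; have aM : `|a| <= M by apply: le_trans abM; rewrite lerDl.
have bM : `|b| <= M by apply: le_trans abM; rewrite lerDr.
have [c /andP[c1 c2] E] := mean_value a (a + b) (nl_der N t).
have ca : `|c| <= `|a| + `|b|.
  have h1 := ler_norm a; have h2 := ler_norm b; have h3 := ler_normr (- a) a.
  have h4 : - a <= `|a| by rewrite -normrN ler_norm.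
  have h5 : - b <= `|b| by rewrite -normrN ler_norm.
  have b0 := normr_ge0 b.
  move: c1 c2; rewrite ge_min le_max ler_norml => /orP[c1|c1] /orP[c2|c2];
    apply/andP; split; lra.
have cM : c <= M by apply: le_trans (ler_norm _) _; exact: le_trans ca _.
have L0 : 0 <= L * `|c| by apply: le_trans (f_norm_le t cM).
have h1 : `|F t (a + b) - F t a| <= L * `|c| * `|b|.
  by rewrite E addrAC subrr add0r normrM ler_wpM2r// f_norm_le.
have h2 := F_le t (le_trans (ler_norm _) bM).
have L1 : 0 <= L * `|a| by apply: le_trans (f_norm_le t (le_trans (ler_norm _) aM)).
apply: le_trans (ler_normB _ _) _; rewrite (ger0_norm (F_ge0 t b)).
apply: le_trans (lerD h1 h2) _; rewrite -(sqr_normr b).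
move: (normr_ge0 a) (normr_ge0 b) (normr_ge0 c) ba ca L0 L1.
move: `|a| `|b| `|c| => x y z x0 y0 z0 yx zxy L0 L1.
have [x00|xp] := leP x 0.
  have -> : y = 0 by apply/eqP; rewrite eq_le y0 (le_trans yx).
  by rewrite expr0n/= !mulr0 addr0.
have Lp : 0 <= L by rewrite pmulr_lge0 in L1.
have h3 : L * z * y <= L * (2 * x) * y.
  by rewrite ler_wpM2r// ler_wpM2l//; lra.
have h4 : L * y ^+ 2 <= L * (x * y) by rewrite expr2 ler_wpM2l// ler_wpM2r.
apply: le_trans (lerD h3 h4) _; rewrite le_eqVlt; apply/orP; left; apply/eqP; ring.
Qed.

End bounded_range.

Lemma cont_pair (w z : R -> R) (p : R -> R -> R) :
  continuous (fun q : R * R => p q.1 q.2) -> continuous w -> continuous z ->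
  continuous (fun t => p (w t) (z t)).
Proof.
move=> cp cw cz t.
exact: (@continuous2_cvg _ R R R _ _ w z p _ _ (cp (w t, z t)) (cw t) (cz t)).
Qed.

Lemma cont_f u : continuous u -> continuous (fun t => f t (u t)).
Proof. move=> cu; apply: (@cont_pair id u f (nl_cont N)) => // t; exact: cvg_id. Qed.

Lemma meas_f u : continuous u -> meas (fun t => f t (u t)).
Proof. by move=> cu; apply: continuous_measurable_fun; exact: cont_f. Qed.

Lemma cont_ft t : continuous (f t).
Proof. apply: (@cont_pair (fun=> t) id f (nl_cont N)) => x; [exact: cvg_cst|exact: cvg_id]. Qed.

Lemma cont_Ft t : continuous (F t).
Proof. by move=> x; exact: is_derive_cont (nl_der N t x). Qed.

(** Dominated convergence, as F(t, x) is the integral of f(t, sx)x over s in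
    [0, 1]. *)
Lemma cont_F u : continuous u -> continuous (fun t => F t (u t)).
Proof.
move=> cu t; apply/(@cvg_nbhsP _ R^o) => t_ ct.
have FE r x : F r x = IR (fun s => f r (s * x) * x * \1_(`[0, 1]) s).
  have cm (g : R -> R) : continuous g -> continuous (fun s : R => g (s * x)).
    move=> cg s; apply: (@continuous_comp _ _ _ (fun s : R => s * x) g); last exact: cg.
    by apply: cvgM; [exact: cvg_id|exact: cvg_cst].
  have cfx : continuous (fun s : R => f r (s * x) * x).
    move=> s; apply: cvgM; last exact: cvg_cst.
    by apply: (cm (f r)); exact: cont_ft.
  have dF (s : R) : 0 < s -> is_derive s (1 : R) (fun s => F r (s * x)) (f r (s * x) * x).
    move=> _; apply: is_derive_comp_R; first exact: (nl_der N).
    have := is_derive_affine x 0 s; congr is_derive.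
    by apply/funext => y; rewrite addr0 mulrC.
  rewrite (FTC_itv ltr01 cfx (cm (F r) (@cont_Ft r)) dF).
  by rewrite mul1r mul0r (nl_Fneg N _ (lexx 0)) subr0.
have cut : u (t_ n) @[n --> \oo] --> u t by apply: (cvg_comp _ _ ct); exact: cu.
have [M M0 hM] : exists2 M : R, 0 <= M & forall n, `|u (t_ n)| <= M.
  have := cvg_seq_bounded (cvgP _ cut); rewrite /bounded_near => /pinfty_ex_gt0[M M0 hM].
  by exists M; [exact: ltW|move=> n; exact: hM].
have [L L0 hL] := nl_lip N M.
have hfx n (s : R) : `|f (t_ n) (s * u (t_ n)) * u (t_ n) * \1_(`[0, 1]) s| <=
    (L * M * M) * \1_(`[0, 1]) s.
  rewrite normrM [X in _ * X <= _]ger0_norm// ; rewrite indicE.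
  have [|] := boolP (s \in _); last by rewrite !mulr0.
  rewrite inE /= in_itv /= => /andP[s0 s1]; rewrite !mulr1 normrM.
  have sM : `|s * u (t_ n)| <= M.
    by rewrite normrM (ger0_norm s0); apply: le_trans (hM n); rewrite ler_piMl.
  apply: ler_pM => //.
  apply: le_trans (f_norm_le hL _ (le_trans (ler_norm _) sM)) _.
  by rewrite ler_wpM2l// ltW.
rewrite FE; under eq_fun do rewrite FE.
have [] // := @DCTe R (fun n s => f (t_ n) (s * u (t_ n)) * u (t_ n) * \1_(`[0, 1]) s)
  (fun s => f t (s * u t) * u t * \1_(`[0, 1]) s) (fun s => (L * M * M) * \1_(`[0, 1]) s).
- move=> n; apply: measurable_funM => //; apply: measurable_funM => //.
  apply: continuous_measurable_fun => s.
  apply: (@continuous_comp _ _ _ (fun s : R => s * u (t_ n)) (f (t_ n))); last exact: cont_ft.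
  by apply: cvgM; [exact: cvg_id|exact: cvg_cst].
- move=> s; apply: cvgM; last exact: cvg_cst.
  apply: cvgM => //.
  have cs : s * u (t_ n) @[n --> \oo] --> s * u t by apply: cvgM => //; exact: cvg_cst.
  have c0 : {for ((t, s * u t) : R * R), continuous (fun z : R * R => f z.1 z.2)} by exact: (nl_cont N).
  exact: (@continuous2_cvg _ R R R _ _ t_ (fun n => s * u (t_ n)) f t _ c0 ct cs).
- exact: ig_itv_cst.
Qed.

Lemma meas_F u : continuous u -> meas (fun t => F t (u t)).
Proof. by move=> cu; apply: continuous_measurable_fun; exact: cont_F. Qed.

End nonlinearity.

(** * The Nehari set of the energy functional *)

Section positive_integral.
Context {R : realType}.
Implicit Types g h : R -> R.

Lemma I_itv_cst (c a b : R) : a < b -> IR (fun x => c * \1_(`[a, b]) x) = c * (b - a).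
Proof.
move=> ab; have cF : continuous (fun x : R => c * x + 0).
  by move=> x; exact: is_derive_cont (is_derive_affine c 0 x).
have dF (x : R) : a < x -> is_derive x (1 : R) (fun x => c * x + 0) c.
  by move=> _; exact: is_derive_affine.
rewrite (FTC_itv ab (@cst_continuous _ _ c) cF dF); ring.
Qed.

(** The integrand exceeds half its value at x0 on an interval. *)
Lemma I_gt0 g x0 : continuous g -> ig g -> (forall x, 0 <= g x) -> 0 < g x0 ->
  0 < IR g.
Proof.
move=> cg gi g0 gx.
have [d d0 hd] : exists2 d : R, 0 < d & forall x, `|x - x0| < d -> g x0 / 2 < g x.
  have /cvgrPdist_lt/(_ _ (divr_gt0 gx (ltr0n _ 2)))[d /= d0 hd] := cg x0.
  exists d => // x xd; have := hd x; rewrite /= distrC => /(_ xd).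
  by rewrite ltr_norml => /andP[_]; lra.
have ab : x0 - d / 2 < x0 + d / 2 by lra.
apply: lt_le_trans (_ : g x0 / 2 * (x0 + d / 2 - (x0 - d / 2)) <= _).
  by rewrite mulr_gt0 ?divr_gt0//; lra.
rewrite -I_itv_cst//; apply: I_le => //; first exact: ig_itv_cst.
move=> x; rewrite indicE; have [|] := boolP (x \in _); last by rewrite mulr0.
rewrite inE /= in_itv /= mulr1 => /andP[h1 h2]; apply: ltW; apply: hd.
by rewrite ltr_norml; apply/andP; split; lra.
Qed.

Lemma I_lt g h x0 : continuous g -> continuous h -> ig g -> ig h ->
  (forall x, g x <= h x) -> g x0 < h x0 -> IR g < IR h.
Proof.
move=> cg ch gi hi gh lt; rewrite -subr_gt0 -IB//.
apply: (@I_gt0 _ x0); last by rewrite subr_gt0.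
- by move=> x; apply: cvgB; [exact: ch|exact: cg].
- exact: igB.
- by move=> x; rewrite subr_ge0.
Qed.

End positive_integral.

Section functional.
Context {R : realType}.
Variables (H : (R -> R) -> Prop) (ip : (R -> R) -> (R -> R) -> R).
Hypothesis X : fspace H ip.
Variables (f F : R -> R -> R) (theta : R).
Hypothesis N : nonlin f F theta.
Implicit Types (u v g : R -> R).

Notation nn := (nn ip).

(** [slope u] is the derivative of [energy] at u in the direction u. *)
Definition slope u : R := nn u - IR (fun t => f t (u t) * u t).
Definition energy u : R := nn u / 2 - IR (fun t => F t (u t)).
Definition nehari u : Prop := [/\ H u, slope u = 0 & exists x, 0 < u x].

Lemma fs_sq u : H u -> sq u. Proof. by move=> /(fs_L2 X)[]. Qed.

Lemma fs_bound (B : R) : exists2 M, 0 < M & forall u x, H u -> nn u <= B -> `|u x| <= M.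
Proof.
have [C C0 hC] := fs_sup X; exists (C * `|B| + 1); first by rewrite ltr_wpDl// mulr_ge0// ltW.
move=> u x hu uB; have P : 0 <= C * `|B| by rewrite mulr_ge0// ltW.
rewrite -(@ler_pXn2r _ 2)// ?nnegrE ?addr_ge0// sqr_normr.
apply: le_trans (hC u x hu) _; apply: (@le_trans _ _ (C * `|B|)).
  by apply: ler_wpM2l; [exact: ltW|exact: le_trans uB (ler_norm _)].
by move: P; move: (C * _) => y y0; nra.
Qed.

Lemma nn_gt0 u x : H u -> u x != 0 -> 0 < nn u.
Proof.
move=> hu ux; have [C C0 hC] := fs_sup X.
have h : 0 < u x ^+ 2 by rewrite exprn_even_gt0.
by have := lt_le_trans h (hC u x hu); rewrite pmulr_rgt0.
Qed.

Lemma sq_fu u : H u -> sq (fun t => f t (u t)).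
Proof.
move=> hu; have [M M0 hM] := fs_bound (nn u); have [L L0 hL] := nl_lip N M.
apply: (sq_le (meas_f N (fs_cont X hu)) (sqZ L (fs_sq hu))) => t.
rewrite normrM (gtr0_norm L0); apply: (f_norm_le N hL).
by apply: le_trans (ler_norm _) _; exact: hM.
Qed.

Lemma ig_fv u v : H u -> sq v -> ig (fun t => f t (u t) * v t).
Proof. by move=> hu sv; apply: sq_mul => //; exact: sq_fu. Qed.

Lemma ig_fu u : H u -> ig (fun t => f t (u t) * u t).
Proof. by move=> hu; apply: ig_fv => //; exact: fs_sq. Qed.

Lemma ig_F u : H u -> ig (fun t => F t (u t)).
Proof.
move=> hu; have mF := meas_F N (fs_cont X hu); apply: (ig_le mF (ig_fu hu)) => t.
rewrite ger0_norm ?(F_ge0 N)//.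
by have := F_le_fx N t (u t); have := F_ge0 N t (u t); lra.
Qed.

Lemma cont_fu u : H u -> continuous (fun t : R => f t (u t) * u t).
Proof.
by move=> hu t; apply: cvgM; [exact: (cont_f N (fs_cont X hu))|exact: (fs_cont X hu)].
Qed.

Lemma slopeZ s u : H u ->
  slope (fun x => s * u x) = s ^+ 2 * nn u - IR (fun t => f t (s * u t) * (s * u t)).
Proof. by move=> hu; rewrite /slope (nnZ X). Qed.

Lemma energyZ s u : H u ->
  energy (fun x => s * u x) = s ^+ 2 * nn u / 2 - IR (fun t => F t (s * u t)).
Proof. by move=> hu; rewrite /energy (nnZ X). Qed.

(** The bound on g puts the whole sequence in a range where f is dominated by a
    linear function, so that g^2 dominates both integrands. *)
Lemma functional_cvg (u_ : nat -> R -> R) u g (M : R) : (forall n, H (u_ n)) -> H u ->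
  (forall x, u_ n x @[n --> \oo] --> u x) -> nn (u_ n) @[n --> \oo] --> nn u ->
  sq g -> (forall x, g x <= M) -> (forall n x, `|u_ n x| <= g x) ->
  (slope (u_ n) @[n --> \oo] --> slope u) /\
  (energy (u_ n) @[n --> \oo] --> energy u).
Proof.
move=> hn hu cu cn sg gM ug; have [L L0 hL] := nl_lip N M.
have uM n x : u_ n x <= M by apply: le_trans (ler_norm _) _; exact: le_trans (ug n x) _.
have uu n x : L * u_ n x ^+ 2 <= L * g x ^+ 2.
  rewrite ler_wpM2l ?(ltW L0)// -sqr_normr ler_pXn2r// nnegrE//.
  exact: le_trans (normr_ge0 _) (ug n x).
have ft t : f t (u_ n t) @[n --> \oo] --> f t (u t).
  by apply: (cvg_comp _ _ (cu t)); exact: (@cont_ft _ _ _ _ N t).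
have Ft t : F t (u_ n t) @[n --> \oo] --> F t (u t).
  by apply: (cvg_comp _ _ (cu t)); exact: (@cont_Ft _ _ _ _ N t).
have [_ c1] : ig (fun t => f t (u t) * u t) /\
    (IR (fun t => f t (u_ n t) * u_ n t) @[n --> \oo] --> IR (fun t => f t (u t) * u t)).
  apply: (@DCTe _ _ _ (fun x => L * g x ^+ 2)).
  - by move=> n; exact: ig_meas (ig_fu (hn n)).
  - by move=> t; apply: cvgM.
  - by apply: igZ; exact: sg.2.
  - move=> n t; rewrite ger0_norm ?(fx_ge0 N)//.
    exact: le_trans (fx_le N hL t (uM n t)) (uu n t).
have [_ c2] : ig (fun t => F t (u t)) /\
    (IR (fun t => F t (u_ n t)) @[n --> \oo] --> IR (fun t => F t (u t))).
  apply: (@DCTe _ _ _ (fun x => L * g x ^+ 2)).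
  - by move=> n; exact: ig_meas (ig_F (hn n)).
  - exact: Ft.
  - by apply: igZ; exact: sg.2.
  - move=> n t; rewrite ger0_norm ?(F_ge0 N)//.
    exact: le_trans (F_le N hL t (uM n t)) (uu n t).
split; first exact: cvgB.
by apply: cvgB => //; apply: cvgM => //; exact: cvg_cst.
Qed.

Lemma slope_cont u : H u -> continuous (fun s : R => slope (fun x => s * u x)).
Proof.
move=> hu s; apply/(@cvg_nbhsP _ R^o) => s_ cs.
have [S S0 hS] : exists2 S : R, 0 <= S & forall n, `|s_ n| <= S.
  have := cvg_seq_bounded (cvgP _ cs); rewrite /bounded_near => /pinfty_ex_gt0[S S0 hS].
  by exists S; [exact: ltW|move=> n; exact: hS].
have [M M0 hM] := fs_bound (nn u).
have [] // := @functional_cvg (fun n x => s_ n * u x) (fun x => s * u x)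
  (fun x => S * `|u x|) (S * M).
- by move=> n; exact: (fsZ X).
- exact: (fsZ X).
- by move=> x; apply: cvgM => //; exact: cvg_cst.
- rewrite (nnZ X)//; under eq_fun do rewrite (nnZ X)//.
  by apply: cvgM; [rewrite expr2; under eq_fun do rewrite expr2; exact: cvgM|exact: cvg_cst].
- apply: sqZ; apply: (sq_le _ (fs_sq hu)); last by move=> x; rewrite normr_id.
  by apply: measurableT_comp => //; exact: (fs_meas X).
- by move=> x; rewrite ler_wpM2l// hM.
- by move=> n x; rewrite normrM ler_wpM2r.
Qed.

(** [F_scale] integrated: the term of first order is the slope. *)
Lemma energy_max u s : H u -> slope u = 0 -> 0 <= s ->
  energy (fun x => s * u x) <= energy u.
Proof.
move=> hu Du s0; rewrite energyZ// /energy.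
have : IR (fun t => F t (u t) + (s ^+ 2 - 1) / 2 * (f t (u t) * u t)) <=
    IR (fun t => F t (s * u t)).
  apply: I_le; last by move=> t; exact: (F_scale N).
    by apply: igD; [exact: ig_F|apply: igZ; exact: ig_fu].
  exact: (ig_F (fsZ X s hu)).
rewrite ID; [|exact: ig_F|by apply: igZ; exact: ig_fu].
rewrite IZ; last exact: ig_fu.
move: Du; rewrite /slope => /eqP; rewrite subr_eq0 => /eqP <-.
by move: (nn u) (IR _) (IR _) (s ^+ 2) => a b c d; lra.
Qed.

(** The Ambrosetti-Rabinowitz condition bounds the integral of F by theta^-1 times
    that of f(t, u)u, which is at most the squared norm. *)
Lemma energy_coercive u : H u -> 0 <= slope u -> (1 / 2 - theta^-1) * nn u <= energy u.
Proof.
move=> hu; rewrite /slope subr_ge0 => h; have th := nl_theta N.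
have : theta * IR (fun t => F t (u t)) <= nn u.
  apply: le_trans h; rewrite -IZ; last exact: ig_F.
  apply: I_le; [apply: igZ; exact: ig_F|exact: ig_fu|].
  by move=> t; exact: (AR_le N).
rewrite /energy; move: (nn u) (IR _) => a b h2.
suff : b <= theta^-1 * a by lra.
by rewrite mulrC ler_pdivlMr 1?mulrC//; lra.
Qed.

Lemma theta_gap : 0 < 1 / 2 - theta^-1.
Proof.
have th := nl_theta N; have t0 : 0 < theta by lra.
by rewrite subr_gt0 div1r ltf_pV2// posrE.
Qed.

Lemma energy_ge0 u : H u -> 0 <= slope u -> 0 <= energy u.
Proof.
move=> hu h; apply: le_trans (energy_coercive hu h).
by rewrite mulr_ge0 ?(nn_ge0 X)// ltW// theta_gap.
Qed.

(** Below d, the integrand f(t, u)u is at most u^2 / 2. *)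
Lemma slope_small : exists2 d, 0 < d & forall u, H u -> (forall x, u x < d) ->
  nn u <= 2 * slope u.
Proof.
have [d d0 hd] := nl_small N (divr_gt0 (ltr01 : 0 < 1 :> R) (ltr0n _ 2)).
exists d => // u hu ud.
have [su nu] := fs_L2 X hu.
have h : IR (fun t => f t (u t) * u t) <= IR (fun t => 1 / 2 * u t ^+ 2).
  apply: I_le; [exact: ig_fu|by apply: igZ; exact: su.2|].
  move=> t; have [u0|u0] := leP (u t) 0.
    by rewrite (nl_neg N)// mul0r mulr_ge0 ?sqr_ge0.
  have := hd t (u t); rewrite gtr0_norm// => /(_ (ud t)) h.
  by rewrite expr2 mulrA ler_wpM2r// ltW.
rewrite IZ in h; last exact: su.2.
have nu' : IR (fun t => u t ^+ 2) <= nn u by exact: nu.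
by move: h nu'; rewrite /slope; move: (nn u) (IR _) (IR _) => a b c; lra.
Qed.

(** Otherwise [slope_small] would force u = 0. Translating such a point x to the
    origin keeps the limit of a sequence from vanishing. *)
Lemma nehari_large : exists2 d, 0 < d & forall u, nehari u -> exists x, d <= u x.
Proof.
have [d d0 hd] := slope_small; exists d => // u [hu Du [x ux]].
apply: contrapT => /forallNP h.
have ud y : u y < d by have := h y; move/negP; rewrite -ltNge.
have := hd u hu ud; rewrite Du mulr0 leNgt (nn_gt0 (x := x) hu)// gt_eqF//.
Qed.

Lemma nehari_low : exists2 r, 0 < r & forall u, nehari u -> r <= nn u.
Proof.
have [d d0 hd] := nehari_large; have [C C0 hC] := fs_sup X.
exists (d ^+ 2 / C); first by rewrite divr_gt0// exprn_gt0.
move=> u nu; have [hu _ _] := nu; have [x dx] := hd u nu.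
rewrite ler_pdivrMr// mulrC; apply: le_trans (hC u x hu).
by rewrite ler_pXn2r// ?nnegrE ?(ltW d0)// (le_trans (ltW d0)).
Qed.

(** f(t, y)/y is non-decreasing. *)
Lemma slope_shrink u s : H u -> 0 <= s -> s <= 1 ->
  s ^+ 2 * slope u <= slope (fun x => s * u x).
Proof.
move=> hu s0 s1; rewrite slopeZ// /slope mulrBr lerD2l lerN2 -IZ; last exact: ig_fu.
apply: I_le; [exact: (ig_fu (fsZ X s hu))|by apply: igZ; exact: ig_fu|].
move=> t; have [u0|u0] := leP (u t) 0.
  by rewrite !(nl_neg N) ?mul0r ?mulr0// mulr_ge0_le0.
have su : s * u t <= u t by rewrite ler_piMl// ltW.
have := f_mono_le N t (mulr_ge0 s0 (ltW u0)) su.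
move=> /(ler_wpM2l s0); congr (_ <= _); ring.
Qed.

(** f(t, y)/y is strictly increasing, and u is positive somewhere; so the slope
    along the ray through a point of the Nehari set changes sign there. *)
Lemma slope_strict u s r : nehari u -> 0 < s -> s < r ->
  slope (fun x => r * u x) / r ^+ 2 < slope (fun x => s * u x) / s ^+ 2.
Proof.
move=> [hu _ [x ux]] s0 sr; have r0 := lt_trans s0 sr.
have S q : 0 < q -> slope (fun x => q * u x) / q ^+ 2 =
    nn u - IR (fun t => f t (q * u t) * (q * u t) / q ^+ 2).
  move=> q0; rewrite slopeZ// (IZr _ (ig_fu (fsZ X q hu))).
  by move: (nn u) (IR _) => a b; field; rewrite gt_eqF.
have hs := fsZ X s hu; have hr := fsZ X r hu.
rewrite !S// ltrD2l ltrN2.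
have E (q y : R) : q != 0 -> forall t, f t (q * y) * (q * y) / q ^+ 2 = f t (q * y) * y / q.
  by move=> q0 t; field.
have lt t : 0 < u t -> f t (s * u t) * (s * u t) / s ^+ 2 < f t (r * u t) * (r * u t) / r ^+ 2.
  move=> u0; rewrite !E ?gt_eqF// ltr_pdivrMr// mulrAC ltr_pdivlMr//.
  have := nl_mono N t (mulr_gt0 s0 u0); move=> /(_ (r * u t)).
  rewrite ltr_pM2r// => /(_ sr); congr (_ < _); ring.
have cm q : continuous (fun t : R => f t (q * u t) * (q * u t) / q ^+ 2).
  by move=> t; apply: cvgM; [exact: (cont_fu (fsZ X q hu))|exact: cvg_cst].
apply: (@I_lt _ _ _ x) => //; [by apply: igZr; exact: (ig_fu hs)|by apply: igZr; exact: (ig_fu hr)| |exact: lt].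
move=> t; have [u0|/lt/ltW//] := leP (u t) 0.
by rewrite !(nl_neg N) ?mul0r// mulr_ge0_le0// ltW.
Qed.

(** The slope is positive for small dilations by [slope_small]. *)
Lemma nehari_exists u s0 : H u -> 0 < s0 -> slope (fun x => s0 * u x) < 0 ->
  exists2 s, 0 < s < s0 & nehari (fun x => s * u x).
Proof.
move=> hu p0 neg.
have [x ux] : exists x, 0 < u x.
  apply: contrapT => /forallNP h; move: neg; rewrite slopeZ//.
  rewrite (_ : (fun t => _) = (fun=> 0)) ?I0 ?subr0; last first.
    apply/funext => t; rewrite (nl_neg N) ?mul0r// mulr_ge0_le0 ?(ltW p0)//.
    by rewrite leNgt; apply/negP; exact: h.
  by rewrite ltNge mulr_ge0 ?sqr_ge0 ?(nn_ge0 X).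
have [d d0 hd] := slope_small; have [M M0 hM] := fs_bound (nn u).
(* Small enough for s1 u to stay below d. *)
pose s1 := Num.min (s0 / 2) (d / (2 * M)).
have s1p : 0 < s1 by rewrite lt_min !divr_gt0 ?mulr_gt0.
have s10 : s1 < s0.
  by apply: le_lt_trans (_ : s0 / 2 < _); [rewrite ge_min lexx|lra].
have pos : 0 < slope (fun x => s1 * u x).
  have h1 := fsZ X s1 hu.
  have n1 : 0 < nn (fun x => s1 * u x).
    by apply: (nn_gt0 (x := x) h1); rewrite gt_eqF// mulr_gt0.
  have : nn (fun x => s1 * u x) <= 2 * slope (fun x => s1 * u x); last by lra.
  apply: hd h1 _ => y; apply: le_lt_trans (_ : d / (2 * M) * M < _).
    apply: (@le_trans _ _ (s1 * M)).
      by rewrite ler_wpM2l ?(ltW s1p)//; apply: le_trans (ler_norm _) _; exact: hM.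
    by rewrite ler_wpM2r ?(ltW M0)// ge_min lexx orbT.
  rewrite (_ : d / (2 * M) * M = d / 2); first by lra.
  by field; rewrite gt_eqF.
have [|s] := @IVT R (fun s : R => slope (fun x => s * u x)) s1 s0 0 (ltW s10)
  (continuous_subspaceT (slope_cont hu)).
  by rewrite ge_min le_max (ltW pos) (ltW neg) orbT.
rewrite in_itv /= => /andP[l1 l2] E; exists s.
  rewrite (lt_le_trans s1p l1)/= lt_neqAle l2 andbT.
  by apply/eqP => sE; move: neg; rewrite -sE E ltxx.
split; [exact: (fsZ X)|exact: E|exists x; rewrite mulr_gt0//].
exact: lt_le_trans l1.
Qed.

Lemma energy_neg u : H u -> energy u < 0 -> slope u < 0.
Proof.
by move=> hu h; rewrite ltNge; apply/negP => /(energy_ge0 hu); rewrite leNgt h.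
Qed.

(** On 2^k u the squared norm is multiplied by 4^k, and the integral of F by a
    larger power, according to [F_pow2]. *)
Lemma energy_ray (P B : R) : 0 < P -> exists k : nat, forall u, H u -> nn u <= B ->
  P <= IR (fun t => F t (u t)) -> energy (fun x => 2 ^+ k * u x) < 0.
Proof.
move=> P0; have th := nl_theta N.
(* The squared norm gains a factor 4^k, the integral of F at least 4^k q^k. *)
have [q qE q1] : exists2 q : R, 1 + 3 / 2 * theta = 2 ^+ 2 * q & 1 < q.
  by exists ((1 + 3 / 2 * theta) / 4); [field|lra].
have [k hk] : exists k : nat, B / 2 < q ^+ k * P.
  have c0 : 0 < (q - 1) * P by rewrite mulr_gt0// subr_gt0.
  exists (Num.truncn (`|B| / ((q - 1) * P))).+1.
  have h := truncnS_gt (`|B| / ((q - 1) * P)).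
  rewrite ltr_pdivrMr// in h.
  have bern m : 1 + m%:R * (q - 1) <= q ^+ m.
    elim: m => [|m IH]; first by rewrite mul0r addr0 expr0.
    rewrite exprS -natr1; have := ler_wpM2l (ltW (lt_trans ltr01 q1)) IH.
    apply: le_trans; have m0 : 0 <= m%:R :> R by [].
    have := mulr_ge0 m0 (sqr_ge0 (q - 1)).
    by move: (m%:R : R) => y; lra.
  have := ler_wpM2r (ltW P0) (bern (Num.truncn (`|B| / ((q - 1) * P))).+1).
  apply: lt_le_trans; have := ler_norm B.
  move: h; move: (_.+1%:R) => y h hB; have := normr_ge0 B; rewrite mulrDl mul1r -mulrA; lra.
exists k => u hu uB hP; rewrite energyZ// subr_lt0.
have h : IR (fun t => (1 + 3 / 2 * theta) ^+ k * F t (u t)) <=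
    IR (fun t => F t (2 ^+ k * u t)).
  apply: I_le; [by apply: igZ; exact: ig_F|exact: (ig_F (fsZ X _ hu))|].
  by move=> t; exact: (F_pow2 N).
rewrite IZ in h; last exact: ig_F.
apply: lt_le_trans h.
rewrite qE exprMn -!exprM mulnC -!mulrA ltr_pM2l ?exprn_gt0//.
apply: le_lt_trans (_ : B / 2 < _); first by lra.
apply: lt_le_trans hk _; rewrite ler_wpM2l// exprn_ge0//; lra.
Qed.

Lemma nehari_ray u x : H u -> 0 < u x -> exists2 s, 0 < s & nehari (fun x => s * u x).
Proof.
move=> hu ux.
have P0 : 0 < IR (fun t => F t (u t)).
  apply: (@I_gt0 _ _ x); [exact: (cont_F N (fs_cont X hu))|exact: ig_F| |exact: (F_gt0 N)].
  by move=> t; exact: (F_ge0 N).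
have [k hk] := energy_ray (nn u) P0.
have := energy_neg (fsZ X _ hu) (hk u hu (lexx _) (lexx _)).
by move=> /(nehari_exists hu (exprn_gt0 _ (ltr0n _ 2)))[s /andP[s0 _] ns]; exists s.
Qed.

End functional.

(** * Integrals that vanish in the limit *)

Section vanishing.
Context {R : realType}.
Variables (v_ : nat -> R -> R) (B M : R).
Hypothesis vs : forall n, sq (v_ n).
Hypothesis vB : forall n, nsq (v_ n) <= B.
Hypothesis vM : forall n x, `|v_ n x| <= M.
Hypothesis v0 : forall x, v_ n x @[n --> \oo] --> 0.

Let B0 : 0 <= B. Proof. exact: le_trans (nsq_ge0 _) (vB 0%N). Qed.
Let M0 : 0 <= M. Proof. exact: le_trans (normr_ge0 _) (vM 0%N 0). Qed.

Let va x : `|v_ n x| @[n --> \oo] --> 0.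
Proof. by rewrite -(normr0 R); exact: cvg_norm (v0 x). Qed.

(** Where |u v| is not at most d v^2 it is at most u^2 / d, which is integrable;
    dominated convergence applies to the minimum of |u v| and u^2 / d. *)
Lemma vanish_prod (u : R -> R) : sq u ->
  null_seq (fun n => IR (fun x => `|u x| * `|v_ n x|)).
Proof.
move=> su e e0; pose d := e / (2 * (B + 1)).
have d0 : 0 < d by rewrite divr_gt0// mulr_gt0// ltr_wpDl.
have mu : meas (fun x => `|u x|) by apply: measurableT_comp => //; exact: su.1.
have mv n : meas (fun x => `|v_ n x|) by apply: measurableT_comp => //; exact: (vs n).1.
pose m n x := Num.min (`|u x| * `|v_ n x|) (d^-1 * u x ^+ 2).
have m0 n x : 0 <= m n x.
  rewrite le_min (mulr_ge0 (normr_ge0 _) (normr_ge0 _))/=.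
  by rewrite mulr_ge0 ?sqr_ge0// invr_ge0 ltW.
have mm n : meas (m n).
  apply: measurable_minr; first exact: measurable_funM.
  by apply: measurable_funM => //; apply: measurable_funX; exact: su.1.
have iu : ig (fun x => d^-1 * u x ^+ 2) by apply: igZ; exact: su.2.
have mle n x : `|m n x| <= d^-1 * u x ^+ 2 by rewrite ger0_norm// ge_min lexx orbT.
have im n : ig (m n) by exact: (ig_le (mm n) iu (mle n)).
have [_ c] : ig (fun _ : R => 0 : R) /\ (IR (m n) @[n --> \oo] --> IR (fun _ : R => 0 : R)).
  apply: (@DCTe _ _ _ (fun x => d^-1 * u x ^+ 2)) => // x.
  apply/cvg_nullP; apply: null_seq_le (null_seqZ `|u x| (proj2 (null_seqP _) (va x))) => n.
  by rewrite subr0 ger0_norm// ge_min lexx.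
rewrite I0 in c; move/null_seqP: c => /(_ _ (divr_gt0 e0 (ltr0n _ 2)))[K hK].
exists K => n Kn; rewrite ger0_norm; last by apply: I_ge0 => x; rewrite mulr_ge0.
apply: (@le_lt_trans _ _ (IR (fun x => d * v_ n x ^+ 2 + m n x))).
  apply: I_le => [||x].
  - by apply: (ig_ext _ (ig_abs (sq_mul su (vs n)))) => x; rewrite normrM.
  - by apply: igD => //; apply: igZ; exact: (vs n).2.
  - have [h|h] := leP (`|u x| * `|v_ n x|) (d^-1 * u x ^+ 2).
      by rewrite /m min_l// lerDr mulr_ge0 ?sqr_ge0// ltW.
    rewrite /m min_r ?(ltW h)//.
    have w : `|u x| * `|v_ n x| <= d * v_ n x ^+ 2; last first.
      by apply: le_trans w _; rewrite lerDl mulr_ge0 ?sqr_ge0// invr_ge0 ltW.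
    move: h; rewrite -(sqr_normr (u x)) -(sqr_normr (v_ n x)); move: `|u x| `|v_ n x| (normr_ge0 (u x)) (normr_ge0 (v_ n x)).
    move=> a b a0 b0; rewrite mulrC ltr_pdivrMr// => h.
    suff : a <= d * b by move=> /(ler_wpM2r b0); rewrite expr2 mulrA.
    rewrite leNgt; apply/negP => dba.
    have := ler_wpM2l a0 (ltW dba); rewrite -expr2; lra.
rewrite ID ?IZ//; [|exact: (vs n).2|by apply: igZ; exact: (vs n).2].
have h1 : d * nsq (v_ n) < e / 2.
  apply: (@le_lt_trans _ _ (d * B)); first by rewrite ler_wpM2l// ltW.
  apply: (@lt_le_trans _ _ (d * (B + 1))); first by rewrite ltr_pM2l// ltrDl.
  by rewrite le_eqVlt; apply/orP; left; apply/eqP; rewrite /d; field; rewrite gt_eqF// ltr_wpDl.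
have := hK n Kn; rewrite ger0_norm; last by apply: I_ge0 => x; exact: m0.
by rewrite /nsq in h1; lra.
Qed.

(** Far out the integrand is small compared with v^2, whose integral is bounded; on
    a bounded interval dominated convergence applies. *)
Lemma vanish_quad (g_ : nat -> R -> R) (L : R) : (forall n, meas (g_ n)) ->
  (forall n x, 0 <= g_ n x <= L * v_ n x ^+ 2) ->
  (forall e, 0 < e -> exists T : R, forall n x, T < `|x| -> g_ n x <= e * v_ n x ^+ 2) ->
  null_seq (fun n => IR (g_ n)).
Proof.
move=> mg gL gT e e0; pose d := e / (2 * (B + 1)).
have d0 : 0 < d by rewrite divr_gt0// mulr_gt0// ltr_wpDl.
have [T hT] := gT d d0.
have L0 n x : L * v_ n x ^+ 2 <= `|L| * v_ n x ^+ 2 by rewrite ler_wpM2r ?sqr_ge0// ler_norm.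
pose m n x := g_ n x * \1_(`[- T, T]) x.
have m0 n x : 0 <= m n x by rewrite mulr_ge0//; case/andP: (gL n x).
have mm n : meas (m n) by apply: measurable_funM.
have mle n x : `|m n x| <= `|L| * M ^+ 2 * \1_(`[- T, T]) x.
  rewrite ger0_norm// ler_wpM2r//; case/andP: (gL n x) => _ h; apply: le_trans h _.
  apply: le_trans (L0 n x) _; rewrite ler_wpM2l// -sqr_normr.
  by rewrite ler_pXn2r ?nnegrE.
have im n : ig (m n) by exact: (ig_le (mm n) (ig_itv_cst _ _ _ _ _) (mle n)).
have [_ c] : ig (fun _ : R => 0 : R) /\ (IR (m n) @[n --> \oo] --> IR (fun _ : R => 0 : R)).
  apply: (@DCTe _ _ _ (fun x => `|L| * M ^+ 2 * \1_(`[- T, T]) x)) => //; last exact: ig_itv_cst.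
  move=> x; apply/cvg_nullP.
  have z : null_seq (fun n => `|L| * M * `|v_ n x|).
    by apply: null_seqZ; exact: (proj2 (null_seqP _) (va x)).
  apply: null_seq_le z => n; rewrite subr0 ger0_norm//.
  apply: (@le_trans _ _ (g_ n x)).
    have /andP[gx _] := gL n x.
    by apply: ler_piMr => //; rewrite indicE; case: (_ \in _).
  case/andP: (gL n x) => _ h; apply: le_trans h _; apply: le_trans (L0 n x) _.
  by rewrite -sqr_normr expr2 mulrA ler_wpM2r// ler_wpM2l.
rewrite I0 in c; move/null_seqP: c => /(_ _ (divr_gt0 e0 (ltr0n _ 2)))[K hK].
have ig_g n : ig (g_ n).
  apply: (ig_le (mg n) (igZ L (vs n).2)) => x.
  by case/andP: (gL n x) => h1 h2; rewrite ger0_norm.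
exists K => n Kn; rewrite ger0_norm; last by apply: I_ge0 => x; case/andP: (gL n x).
apply: (@le_lt_trans _ _ (IR (fun x => d * v_ n x ^+ 2 + m n x))).
  apply: I_le => [//||x].
  - by apply: igD => //; apply: igZ; exact: (vs n).2.
  - have [h|h] := leP `|x| T.
      rewrite /m indicE mem_set ?mulr1; last by rewrite /= in_itv /= -ler_norml.
      by rewrite lerDr mulr_ge0 ?sqr_ge0// ltW.
    by apply: le_trans (hT n x h) _; rewrite lerDl.
rewrite ID ?IZ//; [|exact: (vs n).2|by apply: igZ; exact: (vs n).2].
have h1 : d * nsq (v_ n) < e / 2.
  apply: (@le_lt_trans _ _ (d * B)); first by rewrite ler_wpM2l// ltW.
  apply: (@lt_le_trans _ _ (d * (B + 1))); first by rewrite ltr_pM2l// ltrDl.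
  by rewrite le_eqVlt; apply/orP; left; apply/eqP; rewrite /d; field; rewrite gt_eqF// ltr_wpDl.
have := hK n Kn; rewrite ger0_norm; last by apply: I_ge0 => x; exact: m0.
by rewrite /nsq in h1; lra.
Qed.

End vanishing.

(** * Existence of minimizers on the Nehari set *)

(** [fb] is the limit of [f] at infinity, from below. Elements of a bounded set
    have a common range, which is why the rate may depend on M. *)
Record asymptotic {R : realType} (f fb : R -> R -> R) : Prop := Asymptotic {
  as_ge : forall t x, fb t x <= f t x;
  as_near : forall M e : R, 0 < e -> exists T : R, forall t x, T < `|t| ->
    0 <= x -> x <= M -> f t x - fb t x <= e * x }.

Lemma asymptotic_refl {R : realType} (f : R -> R -> R) : asymptotic f f.
Proof.
split=> [t x //|M e e0]; exists 0 => t x _ x0 _; by rewrite subrr mulr_ge0// ltW.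
Qed.

Section comparison.
Context {R : realType}.
Variables (H : (R -> R) -> Prop) (ip : (R -> R) -> (R -> R) -> R).
Hypothesis X : fspace H ip.
Variables (f F fb Fb : R -> R -> R) (theta : R).
Hypothesis N : nonlin f F theta.
Hypothesis Nb : nonlin fb Fb theta.
Hypothesis A : asymptotic f fb.
Implicit Types (u v g : R -> R).

Notation nn := (nn ip).
(** The mean value theorem for F - Fb on [0, x]. *)
Lemma primitive_gap t x (e : R) : (forall y, 0 <= y -> y <= x -> f t y - fb t y <= e * y) ->
  0 <= e -> Fb t x <= F t x <= Fb t x + e * x ^+ 2.
Proof.
move=> h e0; have [x0|x0] := leP x 0.
  by rewrite !(nl_Fneg N, nl_Fneg Nb)// lexx add0r mulr_ge0// sqr_ge0.
have dG (y : R) : is_derive y (1 : R) (fun y => F t y + Fb t y * -1) (f t y + (fb t y * -1 + Fb t y * 0)).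
  exact: is_deriveD_R (nl_der N t y) (is_deriveM_R (nl_der Nb t y) (is_derive_cst (-1 : R) y (1 : R))).
have [c /andP[c1 c2] E] := mean_value 0 x dG.
move: c1 c2; rewrite min_l ?max_r ?(ltW x0)// => c0 cx.
have := h c c0 cx; have := as_ge A t c; move: E.
rewrite (nl_Fneg N t (lexx 0)) (nl_Fneg Nb t (lexx 0)) mul0r mulr0 !addr0 !subr0 !mulrN1 => E h1 h2.
have k1 : 0 <= (f t c - fb t c) * x by rewrite mulr_ge0 ?subr_ge0// ltW.
have k2 : (f t c - fb t c) * x <= e * x * x.
  by rewrite ler_wpM2r ?(ltW x0)//; apply: le_trans h2 _; rewrite ler_wpM2l.
by rewrite expr2 mulrA; apply/andP; split; lra.
Qed.

Lemma Fb_le t x : Fb t x <= F t x.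
Proof.
have [L L0 hL] := nl_lip N x.
have h y : 0 <= y -> y <= x -> f t y - fb t y <= L * y.
  move=> y0 yx; have := hL t y yx; rewrite ger0_norm//.
  by have := nl_ge0 Nb t y; lra.
by case/andP: (primitive_gap h (ltW L0)).
Qed.

Lemma energy_le_limit u : H u -> energy ip F u <= energy ip Fb u.
Proof.
move=> hu; rewrite /energy lerD2l lerN2; apply: I_le; [exact: (ig_F X Nb)|exact: (ig_F X N)|].
by move=> t; exact: Fb_le.
Qed.

End comparison.

Section limits.
Context {R : realType}.
Variables (H : (R -> R) -> Prop) (ip : (R -> R) -> (R -> R) -> R).
Hypothesis X : fspace H ip.
Variables (f F fb Fb : R -> R -> R) (theta : R).
Hypothesis N : nonlin f F theta.
Hypothesis Nb : nonlin fb Fb theta.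
Hypothesis A : asymptotic f fb.
Implicit Types (u v g : R -> R).

Notation nn := (nn ip).

(** Where w is not positive both nonlinearities vanish, so that v needs to dominate
    only the positive part of w. It is applied to multiples of v, and to functions
    whose positive part is v. *)
Lemma gap_vanish (v_ w_ : nat -> R -> R) (B M S : R) : (forall n, sq (v_ n)) ->
  (forall n, nsq (v_ n) <= B) -> (forall n x, `|v_ n x| <= M) ->
  (forall x, v_ n x @[n --> \oo] --> 0) -> 0 <= S -> (forall n, H (w_ n)) ->
  (forall n x, 0 < w_ n x -> w_ n x <= S * `|v_ n x|) ->
  null_seq (fun n => IR (fun t => F t (w_ n t)) - IR (fun t => Fb t (w_ n t))) /\
  null_seq (fun n => IR (fun t => f t (w_ n t) * w_ n t) -
    IR (fun t => fb t (w_ n t) * w_ n t)).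
Proof.
move=> vs vB vM v0 S0 hw wv.
have [L L0 hL] := nl_lip N (S * M).
have M0 : 0 <= M by exact: le_trans (normr_ge0 _) (vM 0%N 0).
have wM n x : w_ n x <= S * M.
  have [w0|w0] := leP (w_ n x) 0; first by apply: le_trans w0 _; rewrite mulr_ge0.
  by apply: le_trans (wv n x w0) _; rewrite ler_wpM2l.
have w2 n x : 0 < w_ n x -> w_ n x ^+ 2 <= S ^+ 2 * v_ n x ^+ 2.
  move=> w0; rewrite -exprMn -(sqr_normr (S * _)) normrM (ger0_norm S0).
  by rewrite ler_pXn2r ?nnegrE ?(ltW w0) ?mulr_ge0 ?normr_ge0 ?wv.
have v2 n x : 0 <= S ^+ 2 * v_ n x ^+ 2 by rewrite mulr_ge0 ?sqr_ge0.
have far e : 0 < e -> exists2 d, 0 < d &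
    forall n x, 0 < w_ n x -> d * w_ n x ^+ 2 <= e * v_ n x ^+ 2.
  move=> e0; have S1 : 0 < S ^+ 2 + 1 by rewrite ltr_wpDl// sqr_ge0.
  exists (e / (S ^+ 2 + 1)); first by rewrite divr_gt0.
  move=> n x w0; rewrite mulrAC ler_pdivrMr//.
  rewrite -mulrA ler_wpM2l ?(ltW e0)//; apply: le_trans (w2 n x w0) _.
  by rewrite mulrC ler_wpM2l ?sqr_ge0// lerDl.
have cw n := fs_cont X (hw n).
split.
- suff h : null_seq (fun n => IR (fun t => F t (w_ n t) - Fb t (w_ n t))).
    by move: h; congr null_seq; apply/funext => n; rewrite (IB (ig_F X N (hw n)) (ig_F X Nb (hw n))).
  apply: (@vanish_quad R v_ B M vs vB vM v0 _ (L * S ^+ 2)).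
  + by move=> n; apply: measurable_funB; [exact: (meas_F N)|exact: (meas_F Nb)].
  + move=> n x; rewrite subr_ge0 (Fb_le N Nb A)/=.
    have [w0|w0] := leP (w_ n x) 0.
      by rewrite (nl_Fneg N)// (nl_Fneg Nb)// subr0 -mulrA mulr_ge0// ltW.
    rewrite lerBlDr; apply: le_trans (F_le N hL x (wM n x)) _.
    apply: ler_wpDr; first exact: (F_ge0 Nb).
    by rewrite -mulrA ler_wpM2l ?w2// ltW.
  + move=> e e0; have [d d0 hd] := far e e0; have [T hT] := as_near A (S * M) d0.
    exists T => n x Tx; have [w0|w0] := leP (w_ n x) 0.
      by rewrite (nl_Fneg N)// (nl_Fneg Nb)// subr0 mulr_ge0 ?sqr_ge0// ltW.
    apply: le_trans (hd n x w0); rewrite lerBlDl.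
    have small y : 0 <= y -> y <= w_ n x -> f x y - fb x y <= d * y.
      by move=> y0 yw; apply: hT => //; exact: le_trans yw (wM n x).
    by case/andP: (primitive_gap N Nb A small (ltW d0)).
- suff h : null_seq (fun n => IR (fun t => f t (w_ n t) * w_ n t - fb t (w_ n t) * w_ n t)).
    by move: h; congr null_seq; apply/funext => n; rewrite (IB (ig_fu X N (hw n)) (ig_fu X Nb (hw n))).
  apply: (@vanish_quad R v_ B M vs vB vM v0 _ (L * S ^+ 2)).
  + by move=> n; apply: ig_meas; apply: igB; [exact: (ig_fu X N)|exact: (ig_fu X Nb)].
  + move=> n x; have [w0|w0] := leP (w_ n x) 0.
      by rewrite (nl_neg N)// (nl_neg Nb)// !mul0r subr0 lexx -mulrA mulr_ge0// ltW.
    rewrite subr_ge0 ler_wpM2r ?(as_ge A) ?(ltW w0)//=.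
    rewrite lerBlDr; apply: le_trans (fx_le N hL x (wM n x)) _.
    apply: ler_wpDr; first exact: (fx_ge0 Nb).
    by rewrite -mulrA ler_wpM2l ?w2// ltW.
  + move=> e e0; have [d d0 hd] := far e e0; have [T hT] := as_near A (S * M) d0.
    exists T => n x Tx; have [w0|w0] := leP (w_ n x) 0.
      by rewrite (nl_neg N)// (nl_neg Nb)// !mul0r subr0 mulr_ge0 ?sqr_ge0// ltW.
    apply: le_trans (hd n x w0); rewrite -mulrBl expr2 mulrA ler_wpM2r ?(ltW w0)//.
    by apply: hT => //; exact: ltW.
Qed.

Lemma nn_tri u v : H u -> H v -> nn (fun x => u x - v x) <= 2 * nn u + 2 * nn v.
Proof.
move=> hu hv; have := parallelogram X hu hv; have := nn_ge0 X (fs_mid X hu hv).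
by do 4 move: (nn _) => ?; lra.
Qed.

(** The cross terms are ip u v_n, which tends to 0 by weak convergence, and the
    integral of |u v_n|, which comes from [F_split] and tends to 0 by
    [vanish_prod]; [gap_vanish] replaces F by Fb in the second part. *)
Lemma energy_split u (v_ : nat -> R -> R) (B s : R) (a_ : nat -> R) : H u ->
  (forall n, H (v_ n)) -> (forall n, nn (v_ n) <= B) ->
  (forall x, v_ n x @[n --> \oo] --> 0) -> (forall n, 0 <= a_ n <= s) ->
  exists2 d : nat -> R, null_seq d & forall n,
    energy ip F (fun x => a_ n * u x) + energy ip Fb (fun x => a_ n * v_ n x) - d n <=
    energy ip F (fun x => a_ n * (u x + v_ n x)).
Proof.
move=> hu hv vB v0 has.
have a0 n : 0 <= a_ n by case/andP: (has n).
have as_ n : a_ n <= s by case/andP: (has n).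
have s0 := le_trans (a0 0%N) (as_ 0%N).
have [M1 M10 hM1] := fs_bound X (nn u); have [M2 M20 hM2] := fs_bound X B.
have [L L0 hL] := nl_lip N (s * (M1 + M2)).
have vs n := (fs_L2 X (hv n)).1.
have vB' n : nsq (v_ n) <= B by exact: le_trans (fs_L2 X (hv n)).2 (vB n).
have vM n x : `|v_ n x| <= M2 by exact: hM2.
have us := (fs_L2 X hu).1.
have [|gap _] := @gap_vanish v_ (fun n x => a_ n * v_ n x) B M2 s vs vB' vM v0 s0 (fun n => fsZ X (a_ n) (hv n)).
  move=> n x _; apply: le_trans (ler_norm _) _.
  by rewrite normrM (ger0_norm (a0 n)) ler_wpM2r.
have prod := vanish_prod vs vB' v0 us.
have [h0 wk] := weak_limit X hv vB v0.
have ip0 : ip (fun=> 0) u = 0.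
  by rewrite -[RHS](mul0r (ip u u)) -(fs_ipZ X)//; congr ip; apply/funext => x; rewrite mul0r.
have wk0 : null_seq (fun n => ip (v_ n) u).
  by have := wk u hu; rewrite ip0 => /null_seqP.
pose r n := IR (fun x => `|u x| * `|v_ n x|).
exists (fun n => s ^+ 2 * `|ip (v_ n) u| +
    (3 * L * s ^+ 2 * r n +
    (IR (fun t => F t (a_ n * v_ n t)) - IR (fun t => Fb t (a_ n * v_ n t))))).
  apply: null_seqD; last by apply: null_seqD => //; exact: null_seqZ.
  apply: null_seqZ => e e0; have [K hK] := wk0 e e0; exists K => n Kn.
  by rewrite normr_id hK.
move=> n; rewrite !(energyZ X) ?(nnD X)//; last exact: (fsD X).
have iau := ig_F X N (fsZ X (a_ n) hu).
have iav := ig_F X N (fsZ X (a_ n) (hv n)).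
have iauv := ig_F X N (fsZ X (a_ n) (fsD X hu (hv n))).
have ir : ig (fun x => `|u x| * `|v_ n x|).
  by apply: (ig_ext _ (ig_abs (sq_mul us (vs n)))) => x; rewrite normrM.
have : IR (fun t => F t (a_ n * (u t + v_ n t))) <=
    IR (fun t => F t (a_ n * u t) + F t (a_ n * v_ n t) + 3 * L * s ^+ 2 * (`|u t| * `|v_ n t|)).
  apply: I_le => // [|t]; first by apply: igD; [exact: igD|exact: igZ].
  have ran : `|a_ n * u t| + `|a_ n * v_ n t| <= s * (M1 + M2).
    rewrite !normrM (ger0_norm (a0 n)) -mulrDr.
    by apply: ler_pM; rewrite ?addr_ge0//; apply: lerD; [exact: hM1|exact: vM].
  have := F_split N hL t ran; rewrite -mulrDr => h.
  have k : 3 * L * (`|a_ n * u t| * `|a_ n * v_ n t|) <= 3 * L * s ^+ 2 * (`|u t| * `|v_ n t|).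
    rewrite -[leRHS]mulrA; apply: ler_wpM2l; first by rewrite mulr_ge0// ltW.
    rewrite !normrM (ger0_norm (a0 n)) mulrACA -expr2 ler_wpM2r ?mulr_ge0//.
    by rewrite ler_pXn2r ?nnegrE.
  have := le_trans h k; rewrite ler_norml => /andP[_].
  by move: (F _ _) (F _ _) (F _ _) (3 * L * _ * _) => p q l m; lra.
rewrite ID ?IZ//; [|exact: igD|exact: igZ]; rewrite ID// -/(r n).
have := ler_norm (- ip (v_ n) u); rewrite normrN (fs_ipC X (v_ n) u).
have := normr_ge0 (ip u (v_ n)).
have : a_ n ^+ 2 <= s ^+ 2 by rewrite ler_pXn2r ?nnegrE.
have := sqr_ge0 (a_ n).
move: (3 * L * s ^+ 2 * r n) => Lr.
move: (IR _) (IR _) (IR _) (IR _) (nn u) (nn (v_ n)) (ip u (v_ n)) `|_| => I1 I2 I3 I4 n1 n2 p q.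
move: (s ^+ 2) (a_ n ^+ 2) => S2 A2 A0 AS q0 pq h.
have h1 : A2 * - p <= S2 * q.
  by apply: le_trans (_ : A2 * q <= _); [rewrite ler_wpM2l|rewrite ler_wpM2r].
lra.
Qed.

(** Write u_n = u + v_n, let su be on the Nehari set, and suppose that its energy
    exceeds c. By [energy_split], the energy of a u_n is asymptotically the sum of
    the energy of au and of that of a v_n at infinity, for every a <= s. If the
    slope at infinity of s v_n is non-negative, so is its energy, and a = s gives a
    sum above c. Otherwise some a v_n with a < s is on the Nehari set at infinity:
    its energy is at least c, while a is bounded below, so that the energy of au
    is bounded below by a positive constant. In both cases the energy of u_n,
    which is maximal along its ray, stays above c. *)
Lemma nehari_limit (u_ : nat -> R -> R) u (c B x0 : R) :
  (forall n, nehari H ip f (u_ n)) -> energy ip F (u_ n) @[n --> \oo] --> c ->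
  (forall n, nn (u_ n) <= B) -> (forall x, u_ n x @[n --> \oo] --> u x) ->
  0 < u x0 -> (forall v, nehari H ip fb v -> c <= energy ip Fb v) ->
  exists2 w, nehari H ip f w & energy ip F w <= c.
Proof.
move=> nu cE uB cu ux cb.
have hun n : H (u_ n) by case: (nu n).
have [hu _] := weak_limit X hun uB cu.
have [s s0 ns] := nehari_ray X N hu ux.
exists (fun x => s * u x) => //; rewrite leNgt; apply/negP => lt.
pose v_ n x := u_ n x - u x.
have hv n : H (v_ n) by exact: (fsB X).
pose B' := 2 * B + 2 * nn u + 1.
have vB n : nn (v_ n) <= B'.
  by apply: le_trans (nn_tri (hun n) hu) _; have := uB n; rewrite /B'; lra.
have v0 x : v_ n x @[n --> \oo] --> 0.
  by apply/null_seqP; have /cvg_nullP := cu x.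
have B0 : 0 < B'.
  have := le_trans (nn_ge0 X (hun 0%N)) (uB 0%N); have := nn_ge0 X hu.
  by rewrite /B'; lra.
have [rho rho0 hrho] := nehari_low X Nb.
have /choice[a ha] : forall n, exists a, 0 < a <= s /\
    ((a = s /\ 0 <= slope ip fb (fun x => s * v_ n x)) \/
     nehari H ip fb (fun x => a * v_ n x)).
  move=> n; have [h|h] := leP 0 (slope ip fb (fun x => s * v_ n x)).
    by exists s; split; [rewrite s0 lexx|left].
  have [a /andP[a0 as_] na] := nehari_exists X Nb (hv n) s0 h.
  by exists a; split; [rewrite a0 ltW|right].
have has n : 0 <= a n <= s by case: (ha n) => /andP[/ltW -> ->].
have [d dn hd] := energy_split hu hv vB v0 has.
have nnu : 0 < nn u by apply: (nn_gt0 X (x := x0)) => //; rewrite gt_eqF.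
pose e1 := energy ip F (fun x => s * u x) - c.
(* As the squared norm of a v_n is at least rho, a^2 >= rho / B'. *)
pose e2 := (1 / 2 - theta^-1) * (rho / B' * nn u).
have e10 : 0 < e1 by rewrite subr_gt0.
have e20 : 0 < e2 by rewrite mulr_gt0 ?(theta_gap N)// mulr_gt0// divr_gt0.
pose e := Num.min e1 e2.
have e0 : 0 < e by rewrite lt_min e10.
have low n : c + e - d n <= energy ip F (u_ n).
  have [hn sn _] := nu n; have /andP[a0 as_] := has n.
  apply: le_trans (energy_max X N hn sn a0).
  rewrite (_ : (fun x => a n * u_ n x) = (fun x => a n * (u x + v_ n x))); last first.
    by apply/funext => x; rewrite /v_ addrC subrK.
  apply: le_trans (hd n); rewrite lerD2r.
  case: (ha n) => [/andP[a1 _] [[-> h]|nb]].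
    have Eb := energy_ge0 X Nb (fsZ X s (hv n)) h.
    by have : e <= e1; [rewrite ge_min lexx|rewrite /e1; lra].
  have E1 := cb _ nb.
  have : e <= e2 by rewrite ge_min lexx orbT.
  suff : e2 <= energy ip F (fun x => a n * u x) by lra.
  have [hs ss _] := ns; have hau := fsZ X (a n) hu.
  have sl : 0 <= slope ip f (fun x => a n * u x).
    have q1 : a n / s <= 1 by rewrite ler_pdivrMr// mul1r.
    have := slope_shrink X N hs (divr_ge0 a0 (ltW s0)) q1; rewrite ss mulr0.
    congr (0 <= slope ip f _); apply/funext => x; rewrite mulrA divfK// gt_eqF//.
  apply: le_trans (energy_coercive X N hau sl).
  rewrite ler_wpM2l ?(ltW (theta_gap N))// (nnZ X)// ler_wpM2r ?(ltW nnu)//.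
  rewrite ler_pdivrMr//; apply: le_trans (hrho _ nb) _; rewrite (nnZ X)//.
  by rewrite ler_wpM2l ?sqr_ge0.
have /cvg_seqP/(_ _ (divr_gt0 e0 (ltr0n _ 2)))[K1 hK1] := cE.
have [K2 hK2] := dn _ (divr_gt0 e0 (ltr0n _ 2)).
have := hK1 _ (leq_addr K2 K1); have := hK2 _ (leq_addl K1 K2).
have := low (K1 + K2)%N; rewrite !ltr_norml => ? /andP[? ?] /andP[? ?]; lra.
Qed.

Lemma minimizing_sequence : exists (c B : R) (u_ : nat -> R -> R),
  [/\ forall v, nehari H ip f v -> c <= energy ip F v,
  forall n, nehari H ip f (u_ n), energy ip F (u_ n) @[n --> \oo] --> c &
  forall n, nn (u_ n) <= B].
Proof.
pose S := [set energy ip F v | v in nehari H ip f].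
have lb v : nehari H ip f v -> 0 <= energy ip F v.
  by move=> [hv sv _]; apply: (energy_ge0 X N) => //; rewrite sv.
have hS : has_inf S.
  split; last by exists 0 => _ [v nv <-]; exact: lb.
  have [u [x [hu ux]]] := fs_pos X; have [s _ ns] := nehari_ray X N hu ux.
  by exists (energy ip F (fun x => s * u x)); exists (fun x => s * u x).
have hc v : nehari H ip f v -> inf S <= energy ip F v.
  by move=> nv; apply: ge_inf; [exact: hS.2|exists v].
have /choice[u_ hu] : forall n : nat, exists u, nehari H ip f u /\
    energy ip F u < inf S + n.+1%:R^-1.
  move=> n; have i0 : (0 : R) < n.+1%:R^-1 by rewrite invr_gt0.
  by have [_ [v nv <-] lt] := inf_adherent i0 hS; exists v.
have g0 := theta_gap N.
exists (inf S), ((inf S + 1) / (1 / 2 - theta^-1)), u_; split => //.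
- by move=> n; case: (hu n).
- apply/cvg_nullP; apply: null_seq_le (@null_seq_invS R) => n; have [nu lt] := hu n.
  rewrite ger0_norm ?subr_ge0 ?hc//; rewrite lerBlDl; exact: ltW.
- move=> n; have [[hn sn _] lt] := hu n; rewrite ler_pdivlMr// mulrC.
  apply: le_trans (energy_coercive X N hn _) _; first by rewrite sn.
  apply: le_trans (ltW lt) _; rewrite lerD2l invf_le1//.
  by rewrite ler1n.
Qed.

End limits.

Section minimizers.
Context {R : realType}.
Variables (H : (R -> R) -> Prop) (ip : (R -> R) -> (R -> R) -> R).
Hypothesis X : fspace H ip.
Implicit Types (f F : R -> R -> R) (u v : R -> R).

Notation nn := (nn ip).

Lemma autonomous_shift f F theta a u : nonlin f F theta ->
  (forall t x, f t x = f 0 x) -> (forall t x, F t x = F 0 x) -> H u ->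
  slope ip f (fun x => u (x + a)) = slope ip f u /\
  energy ip F (fun x => u (x + a)) = energy ip F u.
Proof.
move=> N fa Fa hu; have [hs ns] := fs_shift X a hu.
rewrite /slope /energy /nn ns; split; congr (_ - _).
- rewrite -(I_shift a (ig_fu X N hu)); apply: I_ext => x.
  by rewrite fa [in RHS]fa.
- rewrite -(I_shift a (ig_F X N hu)); apply: I_ext => x.
  by rewrite Fa [in RHS]Fa.
Qed.

(** Without dependence on t, a minimizing sequence can be translated so that its
    terms are not small at the origin, and [nehari_limit] applies. *)
Lemma ground_state f F theta : nonlin f F theta ->
  (forall t x, f t x = f 0 x) -> (forall t x, F t x = F 0 x) ->
  exists2 w, nehari H ip f w &
    forall v, nehari H ip f v -> energy ip F w <= energy ip F v.
Proof.
move=> N fa Fa; have [c [B [u_ [hc nu cu uB]]]] := minimizing_sequence X N.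
have [d d0 hd] := nehari_large X N.
have /choice[a ha] : forall n, exists x, d <= u_ n x by move=> n; exact: hd.
pose w_ n x := u_ n (x + a n).
have hun n : H (u_ n) by case: (nu n).
have wE n := autonomous_shift (a n) N fa Fa (hun n).
have hw n : H (w_ n) by case: (fs_shift X (a n) (hun n)).
have wB n : nn (w_ n) <= B by rewrite /nn (fs_shift X (a n) (hun n)).2; exact: uB.
have nw n : nehari H ip f (w_ n).
  have [_ sn [x ux]] := nu n; split; [exact: hw|by rewrite (wE n).1|].
  by exists (x - a n); rewrite /w_ subrK.
have [s [u [hs su]]] := subseq_ptw X hw wB.
have u0 : 0 < u 0.
  apply: lt_le_trans d0 _; rewrite leNgt; apply/negP => lt.
  have /cvg_seqP/(_ (d - u 0))[|K hK] := su 0; first by rewrite subr_gt0.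
  have := hK K (leqnn _); have := ha (s K); rewrite /w_ add0r ltr_norml => ? /andP[_]; lra.
have cs : energy ip F (w_ (s n)) @[n --> \oo] --> c.
  apply/cvg_seqP => e e0; have /cvg_seqP/(_ _ e0)[K hK] := cu; exists K => n Kn.
  by rewrite (wE (s n)).2; apply: hK; exact: leq_trans Kn (hs n).
have [w nw' wc] := nehari_limit X N N (asymptotic_refl f) (fun n => nw (s n)) cs
  (fun n => wB (s n)) su u0 hc.
by exists w => // v nv; apply: le_trans wc _; exact: hc.
Qed.

(** The positive part of the sequence tends to 0 at every point, so its terms see
    only the limit nonlinearity: suitable dilations a u_n are on the Nehari set at
    infinity, and their two energies differ by a null sequence. The factors a are
    bounded by [energy_ray], since the integral of F(t, 2u) controls that of
    f(t, u)u, that is, the squared norm. *)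
Lemma level_at_infinity f F fb Fb theta (u_ : nat -> R -> R) u (c cb B : R) :
  nonlin f F theta -> nonlin fb Fb theta -> asymptotic f fb ->
  (forall n, nehari H ip f (u_ n)) -> energy ip F (u_ n) @[n --> \oo] --> c ->
  (forall n, nn (u_ n) <= B) -> (forall x, u_ n x @[n --> \oo] --> u x) ->
  (forall x, u x <= 0) -> (forall v, nehari H ip fb v -> cb <= energy ip Fb v) ->
  cb <= c.
Proof.
move=> N Nb A nu cE uB cu un cb_min.
have hun n : H (u_ n) by case: (nu n).
pose v_ n x := 2^-1 * (`|u_ n x| + u_ n x).
have vE n x : 0 < u_ n x -> v_ n x = u_ n x.
  by move=> u0; rewrite /v_ gtr0_norm//; field.
have vle n x : `|v_ n x| <= `|u_ n x|.
  have [u0|u0] := leP (u_ n x) 0; last by rewrite vE.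
  by rewrite /v_ (ler0_norm u0) addNr mulr0 normr0 oppr_ge0.
have vs n : sq (v_ n).
  apply: (sq_le _ (fs_L2 X (hun n)).1 (vle n)).
  have mu := fs_meas X (hun n); apply: measurable_funM => //.
  by apply: measurable_funD => //; exact: measurableT_comp.
have vB n : nsq (v_ n) <= B.
  apply: le_trans (uB n); apply: le_trans (fs_L2 X (hun n)).2.
  apply: I_le; [exact: (vs n).2|exact: (fs_L2 X (hun n)).1.2|].
  by move=> x; rewrite -[leLHS]sqr_normr -[leRHS]sqr_normr ler_pXn2r ?nnegrE.
have [M M0 hM] := fs_bound X B.
have vM n x : `|v_ n x| <= M by apply: le_trans (vle n x) _; exact: hM.
have v0 x : v_ n x @[n --> \oo] --> 0.
  rewrite [X in _ --> X](_ : _ = 2^-1 * (`|u x| + u x)); last first.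
    by rewrite (ler0_norm (un x)) addNr mulr0.
  by apply: cvgM; [exact: cvg_cst|apply: cvgD => //; exact: cvg_norm].
have [|_ g1] := @gap_vanish R H ip X f F fb Fb theta N Nb A v_ u_ B M 1 vs vB vM v0 ler01 hun.
  by move=> n x u0; rewrite mul1r vE// ler_norm.
have [rho rho0 hrho] := nehari_low X N.
have [K1 hK1] := g1 _ (divr_gt0 rho0 (ltr0n _ 2)).
have P0 : 0 < rho / 2 by rewrite divr_gt0.
(* The bound applies to 2 u_n, for which int Fb(2 u_n) >= 3/2 int fb(u_n) u_n. *)
have [k hk] := energy_ray X Nb (4 * B) P0.
pose s : R := 2 ^+ k * 2.
have s0 : 0 < s by rewrite mulr_gt0// exprn_gt0.
have neg n : (K1 <= n)%N -> slope ip fb (fun x => s * u_ n x) < 0.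
  move=> Kn; have h2 := fsZ X 2 (hun n).
  apply: (energy_neg X Nb (fsZ X s (hun n))).
  rewrite (_ : (fun x => s * u_ n x) = (fun x => 2 ^+ k * (2 * u_ n x))); last first.
    by apply/funext => x; rewrite mulrA.
  apply: hk => //; first by rewrite (nnZ X)// -natrX ler_wpM2l.
  have := I_le (igZ (3 / 2) (ig_fu X Nb (hun n))) (ig_F X Nb h2) (fun t => F_double_f Nb t (u_ n t)).
  rewrite IZ; last exact: (ig_fu X Nb).
  apply: le_trans; have := hK1 n Kn; rewrite ltr_norml => /andP[_].
  have [_ sn _] := nu n; have := hrho _ (nu n).
  move/eqP: sn; rewrite /slope subr_eq0 => /eqP ->.
  by move: (IR _) (IR _) => p q; lra.
have /choice[a ha] : forall n, exists a, 0 <= a <= s /\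
    ((K1 <= n)%N -> nehari H ip fb (fun x => a * u_ n x)).
  move=> n; have [Kn|nK] := leqP K1 n; last by exists s; split => //; rewrite (ltW s0) lexx.
  have [a /andP[a0 as_] na] := nehari_exists X Nb (hun n) s0 (neg n Kn).
  by exists a; split => //; rewrite !ltW.
have [|g2 _] := @gap_vanish R H ip X f F fb Fb theta N Nb A v_ (fun n x => a n * u_ n x) B M s vs vB vM v0 (ltW s0) (fun n => fsZ X (a n) (hun n)).
  move=> n x; have [/andP[a0 as_] _] := ha n => au.
  have u0 : 0 < u_ n x.
    by rewrite ltNge; apply/negP => u0; move: au; rewrite ltNge mulr_ge0_le0.
  by rewrite vE// gtr0_norm// ler_wpM2r// ltW.
rewrite leNgt; apply/negP => lt.
have e0 : 0 < (cb - c) / 2 by rewrite divr_gt0// subr_gt0.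
have [K2 hK2] := g2 _ e0; have /cvg_seqP/(_ _ e0)[K3 hK3] := cE.
pose n := (K1 + (K2 + K3))%N.
have := hK2 n (leq_trans (leq_addr K3 K2) (leq_addl _ _)).
have := hK3 n (leq_trans (leq_addl K2 K3) (leq_addl _ _)).
have [/andP[a0 _] na] := ha n.
have := cb_min _ (na (leq_addr _ _)).
have [hn sn _] := nu n; have := energy_max X N hn sn a0.
rewrite !(energyZ X)// !ltr_norml.
move: (IR _) (IR _) (energy ip F (u_ n)) => p q E h1 h2 /andP[? ?] /andP[? ?]; lra.
Qed.

(** If the limit of a minimizing sequence is not positive anywhere, the level c is
    that of the limit problem, and then the dilation of the ground state at
    infinity that lies on the Nehari set is a minimizer. *)
Lemma nehari_minimizer f F fb Fb theta : nonlin f F theta -> nonlin fb Fb theta ->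
  asymptotic f fb -> (forall t x, fb t x = fb 0 x) -> (forall t x, Fb t x = Fb 0 x) ->
  exists2 w, nehari H ip f w &
    forall v, nehari H ip f v -> energy ip F w <= energy ip F v.
Proof.
move=> N Nb A fa Fa; have [wb [hwb sb [x0 wx]] minb] := ground_state Nb fa Fa.
have [c [B [u_ [hc nu cE uB]]]] := minimizing_sequence X N.
have [s s0 ns] := nehari_ray X N hwb wx.
have low : energy ip F (fun x => s * wb x) <= energy ip Fb wb.
  apply: le_trans (energy_max X Nb hwb sb (ltW s0)).
  exact: (energy_le_limit X N Nb A (fsZ X s hwb)).
have hun n : H (u_ n) by case: (nu n).
have [sg [u [hs su]]] := subseq_ptw X hun uB.
have cs : energy ip F (u_ (sg n)) @[n --> \oo] --> c.
  apply/cvg_seqP => e e0; have /cvg_seqP/(_ _ e0)[K hK] := cE; exists K => n Kn.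
  by apply: hK; exact: leq_trans Kn (hs n).
have [[x ux]|un] := pselect (exists x, 0 < u x).
  have [|w nw wc] := nehari_limit X N Nb A (fun n => nu (sg n)) cs (fun n => uB (sg n)) su ux.
    by move=> v nv; apply: le_trans (minb v nv); apply: le_trans low; exact: hc.
  by exists w => // v nv; apply: le_trans wc _; exact: hc.
exists (fun x => s * wb x) => // v nv; apply: le_trans (hc v nv); apply: le_trans low _.
apply: (level_at_infinity N Nb A (fun n => nu (sg n)) cs (fun n => uB (sg n)) su) => //.
by move=> x; rewrite leNgt; apply/negP => h; apply: un; exists x.
Qed.

End minimizers.

(** * Minimizers on the Nehari set are critical points *)

Section critical.
Context {R : realType}.
Variables (H : (R -> R) -> Prop) (ip : (R -> R) -> (R -> R) -> R).
Hypothesis X : fspace H ip.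
Variables (f F : R -> R -> R) (theta : R).
Hypothesis N : nonlin f F theta.
Implicit Types (u v w phi : R -> R).

Notation nn := (nn ip).
Notation slope := (slope ip f).
Notation energy := (energy ip F).
Notation nehari := (nehari H ip f).

Lemma seq_lim_le (a b : nat -> R) (l m : R) : a n @[n --> \oo] --> l ->
  b n @[n --> \oo] --> m -> (forall n, a n <= b n) -> l <= m.
Proof.
move=> /cvg_seqP ha /cvg_seqP hb ab; rewrite leNgt; apply/negP => lt.
have e0 : 0 < (l - m) / 2 by rewrite divr_gt0// subr_gt0.
have [K hK] := ha _ e0; have [K' hK'] := hb _ e0.
have := hK _ (leq_addr K' K); have := hK' _ (leq_addl K K'); have := ab (K + K')%N.
rewrite !ltr_norml => ? /andP[? ?] /andP[? ?]; lra.
Qed.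

Lemma sq_norm_fs u : H u -> sq (fun x => `|u x|).
Proof.
move=> hu; apply: (sq_le _ (fs_L2 X hu).1) => [|x]; last by rewrite normr_id.
by apply: measurableT_comp => //; exact: (fs_meas X).
Qed.

Definition perturb w phi (n : nat) : R -> R := fun x => w x + n.+1%:R^-1 * phi x.

Lemma perturb_fs w phi n : H w -> H phi -> H (perturb w phi n).
Proof. by move=> hw hp; apply: (fsD X) => //; exact: (fsZ X). Qed.

Lemma slope_perturb w phi s : H w -> H phi ->
  slope (fun x => s * perturb w phi n x) @[n --> \oo] --> slope (fun x => s * w x).
Proof.
move=> hw hp; have [M1 M10 hM1] := fs_bound X (nn w); have [M2 M20 hM2] := fs_bound X (nn phi).
have i0 : (n.+1%:R^-1 : R) @[n --> \oo] --> (0 : R) by apply/null_seqP; exact: null_seq_invS.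
have [] // := @functional_cvg R H ip X f F theta N (fun n x => s * perturb w phi n x)
  (fun x => s * w x) (fun x => `|s| * (`|w x| + `|phi x|)) (`|s| * (M1 + M2)).
- by move=> n; apply: (fsZ X); exact: perturb_fs.
- exact: (fsZ X).
- move=> x; apply: cvgM; first exact: cvg_cst.
  rewrite -[X in _ --> X]addr0 -[X in _ --> _ + X](mul0r (phi x)).
  by apply: cvgD; [exact: cvg_cst|apply: cvgM => //; exact: cvg_cst].
- rewrite (nnZ X)//.
  have E n : nn (fun x => s * perturb w phi n x) =
      s ^+ 2 * (nn w + n.+1%:R^-1 * (2 * ip w phi + n.+1%:R^-1 * nn phi)).
    have hip := fsZ X n.+1%:R^-1 hp.
    rewrite (nnZ X) ?(nnD X) ?(nnZ X) ?(ipZr X)//; last exact: perturb_fs.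
    by move: (n.+1%:R^-1) => z; ring.
  under eq_fun do rewrite E.
  apply: cvgM; first exact: cvg_cst.
  rewrite -[X in _ --> X]addr0 -[X in _ --> _ + X](mul0r (2 * ip w phi + 0 * nn phi)).
  apply: cvgD; first exact: cvg_cst.
  apply: cvgM => //; apply: cvgD; first exact: cvg_cst.
  by apply: cvgM => //; exact: cvg_cst.
- by apply: sqZ; apply: sqD; exact: sq_norm_fs.
- by move=> x; rewrite ler_wpM2l// lerD ?hM1 ?hM2.
- move=> n x; rewrite normrM ler_wpM2l//; apply: le_trans (ler_normD _ _) _.
  by rewrite lerD2l normrM ler_piMl// ger0_norm ?invf_le1 ?ler1n.
Qed.

(** The points of the Nehari set on the rays through the perturbations converge
    to w, since the slope changes sign strictly along the ray through w. *)
Lemma nehari_near w phi (k : nat) : nehari w -> H phi ->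
  exists (s : R) (m : nat), [/\ `|s - 1| <= k.+2%:R^-1, (k <= m)%N &
    nehari (fun x => s * perturb w phi m x)].
Proof.
move=> nw hp; have [hw sw _] := nw.
have [e0 e1] : 0 < k.+2%:R^-1 :> R /\ k.+2%:R^-1 < 1 :> R.
  by rewrite invr_gt0 ltr0n invf_lt1 ?ltr0n// ltr1n.
move: (k.+2%:R^-1 : R) e0 e1 => e e0 e1.
have w1 : (fun x => 1 * w x) = w by apply/funext => x; rewrite mul1r.
have pos : 0 < slope (fun x => (1 - e) * w x).
  have l0 : 0 < 1 - e by lra.
  have := slope_strict X N nw l0 (ltac:(lra) : 1 - e < 1).
  by rewrite w1 sw mul0r pmulr_lgt0 ?invr_gt0 ?exprn_gt0.
have neg : slope (fun x => (1 + e) * w x) < 0.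
  have l0 : 0 < 1 + e by lra.
  have := slope_strict X N nw ltr01 (ltac:(lra) : 1 < 1 + e).
  by rewrite w1 sw mul0r pmulr_llt0 ?invr_gt0 ?exprn_gt0.
have /cvg_seqP/(_ _ pos)[K1 hK1] := slope_perturb (s := 1 - e) hw hp.
have neg' : 0 < - slope (fun x => (1 + e) * w x) by lra.
have /cvg_seqP/(_ _ neg')[K2 hK2] := slope_perturb (s := 1 + e) hw hp.
pose m := (k + (K1 + K2))%N.
have hm := perturb_fs m hw hp.
have p1 : 0 < slope (fun x => (1 - e) * perturb w phi m x).
  have := hK1 m (leq_trans (leq_addr K2 K1) (leq_addl _ _)).
  by rewrite ltr_norml => /andP[]; lra.
have p2 : slope (fun x => (1 + e) * perturb w phi m x) < 0.
  have := hK2 m (leq_trans (leq_addl K1 K2) (leq_addl _ _)).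
  by rewrite ltr_norml => /andP[]; lra.
have [x px] : exists x, 0 < perturb w phi m x.
  have l0 : 0 < 1 + e by lra.
  have [s /andP[s0 _] [_ _ [x sx]]] := nehari_exists X N hm l0 p2.
  by exists x; move: sx; rewrite pmulr_rgt0.
have le12 : 1 - e <= 1 + e by lra.
have [|s] := @IVT R (fun s : R => slope (fun x => s * perturb w phi m x)) (1 - e) (1 + e) 0
  le12 (continuous_subspaceT (slope_cont X N hm)).
  by rewrite ge_min le_max (ltW p1) (ltW p2) orbT.
rewrite in_itv /= => /andP[s1 s2] E; exists s, m; split.
- by rewrite ler_norml; apply/andP; split; lra.
- exact: leq_addr.
- split; [exact: (fsZ X)|exact: E|exists x; rewrite mulr_gt0//; lra].
Qed.

(** With s w_e on the Nehari set, w_e = w + e phi, the energy of sw is at most that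
    of w, hence at most that of s w_e. Dividing the difference by e and letting
    e -> 0 and s -> 1 gives the inequality; the quotients converge by dominated
    convergence. *)
Lemma critical_half w phi : nehari w ->
  (forall v, nehari v -> energy w <= energy v) -> H phi ->
  IR (fun t => f t (w t) * phi t) <= ip w phi.
Proof.
move=> nw wmin hp; have [hw sw _] := nw.
have /choice[s /choice[m hsm]] : forall k, exists (s : R) (m : nat),
    [/\ `|s - 1| <= k.+2%:R^-1, (k <= m)%N & nehari (fun x => s * perturb w phi m x)].
  by move=> k; exact: nehari_near.
pose e k : R := (m k).+1%:R^-1.
have e0 k : 0 < e k by rewrite invr_gt0.
have e1 k : e k <= 1 by rewrite invf_le1 ?ler1n.
have ek k : e k <= k.+1%:R^-1.
  by case: (hsm k) => _ km _; rewrite lef_pV2 ?posrE// ler_nat.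
have ec : e k @[k --> \oo] --> (0 : R).
  apply/null_seqP; apply: null_seq_le (@null_seq_invS R) => k.
  by rewrite gtr0_norm.
have sk k : `|s k - 1| <= k.+1%:R^-1.
  by case: (hsm k) => h _ _; apply: le_trans h _; rewrite lef_pV2 ?posrE// ler_nat.
have sc : s k @[k --> \oo] --> (1 : R).
  by apply/cvg_nullP; exact: null_seq_le (@null_seq_invS R).
have s02 k : 0 <= s k <= 2.
  have := sk k; have : k.+1%:R^-1 <= 1 :> R by rewrite invf_le1 ?ler1n.
  by move: (k.+1%:R^-1) => z z1; rewrite ler_norml => /andP[? ?]; apply/andP; split; lra.
pose h k t := (e k)^-1 * (F t (s k * perturb w phi (m k) t) - F t (s k * w t)).
have [M1 M10 hM1] := fs_bound X (nn w); have [M2 M20 hM2] := fs_bound X (nn phi).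
have [L L0 hL] := nl_lip N (2 * (M1 + M2)).
have /choice[c hc] : forall k, exists c : R -> R, forall t,
    Num.min (s k * w t) (s k * perturb w phi (m k) t) <= c t <=
    Num.max (s k * w t) (s k * perturb w phi (m k) t) /\
    h k t = f t (c t) * (s k * phi t).
  move=> k; suff /choice[c hc] : forall t, exists c : R,
      Num.min (s k * w t) (s k * perturb w phi (m k) t) <= c <=
      Num.max (s k * w t) (s k * perturb w phi (m k) t) /\
      h k t = f t c * (s k * phi t) by exists c.
  move=> t.
  have [c hc E] := mean_value (s k * w t) (s k * perturb w phi (m k) t) (nl_der N t).
  exists c; split => //; rewrite /h E /perturb -/(e k).
  by field; rewrite gt_eqF.
have pc t : s k * perturb w phi (m k) t @[k --> \oo] --> w t.
  suff : s k * perturb w phi (m k) t @[k --> \oo] --> 1 * (w t + 0 * phi t).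
    by rewrite mul0r addr0 mul1r.
  apply: cvgM => //; apply: cvgD; first exact: cvg_cst.
  by apply: cvgM; [exact: ec|exact: cvg_cst].
have pw t : s k * w t @[k --> \oo] --> w t.
  by rewrite -[X in _ --> X]mul1r; apply: cvgM => //; exact: cvg_cst.
have cw t : c k t @[k --> \oo] --> w t.
  apply/cvg_seqP => d d0; have /cvg_seqP/(_ _ d0)[K1 hK1] := pc t.
  have /cvg_seqP/(_ _ d0)[K2 hK2] := pw t; exists (K1 + K2)%N => n Kn.
  have := hK1 n (leq_trans (leq_addr _ _) Kn); have := hK2 n (leq_trans (leq_addl _ _) Kn).
  have [/andP[]] := hc n t; rewrite ge_min le_max !ltr_norml.
  by move=> /orP[?|?] /orP[?|?] _ /andP[? ?] /andP[? ?]; apply/andP; split; lra.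
have cb k t : `|c k t| <= 2 * (`|w t| + `|phi t|).
  have [/andP[s0 s2]] := (s02 k, hc k t); case=> /andP[]; rewrite ge_min le_max ler_norml.
  have b1 : `|s k * w t| <= 2 * (`|w t| + `|phi t|).
    rewrite normrM (ger0_norm s0); apply: ler_pM => //; by rewrite lerDl.
  have b2 : `|s k * perturb w phi (m k) t| <= 2 * (`|w t| + `|phi t|).
    rewrite normrM (ger0_norm s0); apply: ler_pM => //.
    apply: le_trans (ler_normD _ _) _; rewrite lerD2l normrM ler_piMl//.
    by rewrite (gtr0_norm (e0 k)).
  move: b1 b2; rewrite !ler_norml => /andP[? ?] /andP[? ?] /orP[?|?] /orP[?|?] _;
    apply/andP; split; lra.
have sg : sq (fun x => `|w x| + `|phi x|) by apply: sqD; exact: sq_norm_fs.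
have hwk k := fsZ X (s k) hw; have hpk k := fsZ X (s k) (perturb_fs (m k) hw hp).
have ih k : ig (h k) by apply: igZ; apply: igB; [exact: (ig_F X N (hpk k))|exact: (ig_F X N (hwk k))].
have [_ lim] : ig (fun t => f t (w t) * phi t) /\
    (IR (h k) @[k --> \oo] --> IR (fun t => f t (w t) * phi t)).
  apply: (@DCTe _ _ _ (fun t => 4 * L * ((`|w t| + `|phi t|) * `|phi t|))).
  - by move=> k; exact: ig_meas (ih k).
  - move=> t; have E k : h k t = f t (c k t) * (s k * phi t) by case: (hc k t).
    under eq_fun do rewrite E.
    apply: cvgM; first by apply: (cvg_comp _ _ (cw t)); exact: (@cont_ft _ _ _ _ N t).
    by rewrite -[X in _ --> X]mul1r; apply: cvgM => //; exact: cvg_cst.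
  - by apply: igZ; apply: sq_mul => //; exact: sq_norm_fs.
  - move=> k t; have [_ ->] := hc k t; have /andP[s0 s2] := s02 k.
    have cM : c k t <= 2 * (M1 + M2).
      apply: le_trans (ler_norm _) _; apply: le_trans (cb k t) _.
      by rewrite ler_wpM2l// lerD ?hM1 ?hM2.
    have b1 := f_norm_le N hL t cM.
    rewrite !normrM (ger0_norm s0).
    apply: (@le_trans _ _ (L * (2 * (`|w t| + `|phi t|)) * (2 * `|phi t|))).
      apply: ler_pM => //; first by rewrite mulr_ge0.
        by apply: le_trans b1 _; apply: ler_wpM2l => //; exact: ltW.
      by rewrite ler_wpM2r.
    by rewrite le_eqVlt; apply/orP; left; apply/eqP; ring.
have upper k : IR (h k) <= s k ^+ 2 * (ip w phi + e k * (nn phi / 2)).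
  have /andP[s0 _] := s02 k; have [_ _ nk] := hsm k.
  have := le_trans (energy_max X N hw sw s0) (wmin _ nk).
  rewrite !(energyZ X)//; last exact: perturb_fs.
  have -> : nn (perturb w phi (m k)) = nn w + 2 * (e k * ip w phi) + e k ^+ 2 * nn phi.
    by rewrite [LHS](nnD X) ?(nnZ X) ?(ipZr X)//; exact: (fsZ X).
  move=> E; rewrite /h IZ; last by apply: igB; [exact: (ig_F X N (hpk k))|exact: (ig_F X N (hwk k))].
  rewrite (IB (ig_F X N (hpk k)) (ig_F X N (hwk k))).
  rewrite [leLHS]mulrC ler_pdivrMr//; move: E.
  move: (IR (fun t => F t (s k * perturb w phi (m k) t)))
    (IR (fun t => F t (s k * w t))) (nn w) (nn phi) (ip w phi) (s k) (e k) => I1 I2 n1 n2 p q z; lra.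
have ulim : s k ^+ 2 * (ip w phi + e k * (nn phi / 2)) @[k --> \oo] --> ip w phi.
  suff : s k ^+ 2 * (ip w phi + e k * (nn phi / 2)) @[k --> \oo] -->
      1 * 1 * (ip w phi + 0 * (nn phi / 2)) by rewrite mul0r addr0 !mul1r.
  apply: cvgM; first by under eq_fun do rewrite expr2; exact: cvgM.
  by apply: cvgD; [exact: cvg_cst|apply: cvgM => //; exact: cvg_cst].
exact: seq_lim_le lim ulim upper.
Qed.

Lemma nehari_critical w phi : nehari w ->
  (forall v, nehari v -> energy w <= energy v) -> H phi ->
  ip w phi = IR (fun t => f t (w t) * phi t).
Proof.
move=> nw wmin hp; have [hw _ _] := nw.
apply/eqP; rewrite eq_le (critical_half nw wmin hp) andbT.
have := critical_half nw wmin (fsN X hp); rewrite (fs_ipNr X)//.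
have := IN (ig_fv X N hw (fs_L2 X hp).1).
rewrite (_ : (fun x => - _) = (fun t => f t (w t) * - phi t)); last first.
  by apply/funext => t; rewrite mulrN.
by move=> ->; rewrite lerN2.
Qed.

End critical.

(** * The energy space and the given nonlinearities *)

Section instances.
Context {R : realType}.
Implicit Types (f : R -> R -> R).

Definition bump (x : R) : R := flat 1%:P x * flat 1%:P (1 - x).

Lemma test_bump : test_function bump.
Proof.
apply/test_functionP; split.
  apply: smoothM; first exact: smooth_flat.
  have := @smooth_affine _ 1 (- 1) 1 _ (@smooth_flat R 1%:P).
  by congr smooth; apply/funext => x; rewrite mul1r; congr (flat _ _); ring.
exists 1 => // x; rewrite /bump /flat; have [x0|x0] := leP x 0; first by rewrite mul0r.
by rewrite gtr0_norm// => x1; rewrite subr_gt0 ltNge (ltW x1) mulr0.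
Qed.

Lemma bump_gt0 : 0 < bump (1 / 2).
Proof.
have h : 0 < 1 / 2 :> R by lra.
have -> : bump (1 / 2) = flat 1%:P (1 / 2) * flat 1%:P (1 / 2).
  by rewrite /bump; congr (_ * flat _ _); field.
by rewrite /flat h hornerC mul1r mulr_gt0// expR_gt0.
Qed.

Lemma energy_fspace (alpha : R) : 1 / 2 < alpha -> alpha < 1 ->
  fspace (Hs alpha) (ip alpha).
Proof.
move=> ag al; split.
- exact: (HsD ag al).
- exact: (HsZ ag al).
- exact: ipC.
- by move=> u v w /Hs_Dom hu /Hs_Dom hv /Hs_Dom hw; exact: ipDl.
- by move=> c u w /Hs_Dom hu /Hs_Dom hw; exact: ipZl.
- move=> u /Hs_Dom hu; split; first by case: (Dom_sq hu).
  by rewrite ip_en /en lerDl nsq_ge0.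
- exists (`|sup_cst alpha| + 1); first by rewrite ltr_wpDl.
  move=> u x hu; rewrite ip_en; apply: le_trans (Hs_sup ag al x hu) _.
  rewrite ler_wpM2r ?en_ge0//; apply: le_trans (ler_norm _) _; by rewrite lerDl.
- exists (equi alpha); first by move=> u x y hu; exact: (Hs_equi ag al).
  by move=> x y_; exact: (equi_cvg ag al).
- by move=> u_; exact: (Hs_complete ag al).
- by move=> a u; exact: (Hs_shift ag al).
- exists bump, (1 / 2); split; last exact: bump_gt0.
  exact: (Hs_test ag al test_bump).
Qed.

(** Since f(t, .) vanishes on the negative half-line, any base point to the left
    of 0 gives the same primitive. *)
Lemma primitive_base f t a y : cond_f0 f -> a <= 0 -> a <= y ->
  primitive f t y = Rintegral (leb R) `[a, y] (f t).
Proof.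
move=> f0 a0 ay; rewrite /primitive; case: ifPn => [y0|].
  rewrite Rintegral_mkcond [RHS]Rintegral_mkcond; apply: eq_Rintegral => x _; rewrite !patchE.
  have [xy|xy] := boolP (x <= y); last first.
    rewrite !ifF//; apply/negbTE; rewrite notin_setE /= in_itv /= (negbTE xy) andbF//.
  have [x0|x0] := leP x 0; last first.
    by rewrite !ifT// inE /= in_itv /= xy ltW ?(le_lt_trans a0)// ltW.
  by rewrite (f0 t x).2//; do 2 case: ifP.
rewrite -ltNge => y0.
have Z b c : c <= 0 -> Rintegral (leb R) `[b, c] (f t) = 0.
  move=> c0; transitivity (Rintegral (leb R) `[b, c] (fun=> 0)).
    2: by rewrite Rintegral_cst ?mul0r.
  apply: eq_Rintegral => x; rewrite inE /= in_itv /= => /andP[_ xc]; apply: (f0 t x).2.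
  exact: le_trans c0.
by rewrite (Z _ _ (lexx 0)) (Z _ _ (ltW y0)) oppr0.
Qed.

Lemma primitive_derive f t (x : R) : cond_f0 f -> continuous (f t) ->
  is_derive x (1 : R) (primitive f t) (f t x).
Proof.
move=> f0 cf; pose a := Num.min 0 x - 1.
have a0 : a <= 0 by rewrite /a lerBlDr ge_min add0r ler01.
have ax : a < x - 1 + 1 / 2.
  by rewrite /a; have : Num.min 0 x <= x; [rewrite ge_min lexx orbT|lra].
have ax1 : a <= x - 1.
  by rewrite /a lerD2r ge_min lexx orbT.
apply: (@is_derive_near _ _ (fun y => Rintegral (leb R) `[a, y] (f t)) _ _ 1) => //.
  move=> h; rewrite ltr_norml => /andP[h1 h2]; apply: primitive_base => //; lra.
have [||||d1 d2] := @continuous_FTC1_closed R (f t) a x (x + 1).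
- by rewrite ltrDl.
- apply: continuous_compact_integrable; first exact: segment_compact.
  exact: continuous_subspaceT.
- lra.
- exact: cf.
- by apply: DeriveDef; [exact: d1|rewrite -derive1E].
Qed.

Lemma cond_nonlin f (theta p0 : R) : 2 < theta ->
  continuous (fun z : R * R => f z.1 z.2) -> cond_f04 theta p0 f ->
  nonlin f (primitive f) theta.
Proof.
move=> th cf [f0 f1 f2 f3 f4].
have fge t x : 0 <= f t x.
  by have [/(f0 t x).1//|/ltW/(f0 t x).2 ->] := leP 0 x.
have mono t (x y : R) : 0 < x -> x < y -> f t x * y < f t y * x.
  move=> x0 xy; have y0 := lt_trans x0 xy.
  have := f4 t 1 ltr01 x y x0 xy; rewrite !mulr1.
  by rewrite ltr_pdivrMr// mulrAC ltr_pdivlMr.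
split => //.
- by move=> t x x0; rewrite (f0 t x).2.
- move=> t x x0; rewrite (primitive_base t f0 x0 (lexx x)).
  transitivity (Rintegral (leb R) `[x, x] (fun=> 0)).
    2: by rewrite Rintegral_cst ?mul0r.
  apply: eq_Rintegral => y; rewrite inE /= in_itv /= => /andP[_ yx]; apply: (f0 t y).2; exact: le_trans x0.
- move=> t x; apply: primitive_derive => //.
  apply: (@cont_pair R (fun=> t) id f cf) => y; [exact: cvg_cst|exact: cvg_id].
- by move=> t x x0; have [h1 h2] := f1 t x x0; rewrite h1 [leRHS]mulrC h2.
- move=> e e0; have [d d0 hd] := f2 e e0; exists d => // t x xd.
  exact: le_trans (ler_norm _) (hd t x xd).
- move=> M; have [M0 M00 hM] := f3 1 ltr01.
  (* Since f(t, x)/x increases, it is at most its value at a point m beyond M and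
     M0, where [cond_f3] gives f(t, m) <= m^p0. *)
  pose m := `|M| + M0 + 1.
  have m0 : 0 < m by rewrite /m; have := normr_ge0 M; lra.
  have mM0 : M0 < m by rewrite /m; have := normr_ge0 M; lra.
  have p0m : 0 < m `^ p0 by exact: powR_gt0.
  exists (m `^ p0 / m); first by rewrite divr_gt0.
  move=> t x xM; have [x0|x0] := leP x 0.
    by rewrite (f0 t x).2// mulr_ge0 ?divr_ge0 ?(ltW p0m) ?(ltW m0).
  have xm : x < m by rewrite /m; have := ler_norm M; lra.
  have fm : f t m <= m `^ p0.
    have := hM t m; rewrite gtr0_norm// => /(_ mM0).
    rewrite normrM normfV (gtr0_norm p0m) ltr_pdivrMr// mul1r => h.
    exact: le_trans (ler_norm _) (ltW h).
  rewrite gtr0_norm// mulrAC ler_pdivlMr//; apply: le_trans (ltW (mono t x m x0 xm)) _.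
  by rewrite ler_wpM2r// ltW.
Qed.

Lemma cond_asymptotic f (fb a : R -> R) (p0 : R) : 1 < p0 ->
  (forall t xi, 0 <= f t xi - fb xi /\
     f t xi - fb xi <= a t * (`|xi| + `|xi| `^ p0)) ->
  a t @[t --> +oo] --> (0 : R) -> a t @[t --> -oo] --> (0 : R) ->
  asymptotic f (fun _ => fb).
Proof.
move=> p1 h ap am; split=> [t x|M e e0]; first by rewrite -subr_ge0; case: (h t x).
(* On [0, M] we have x + x^p0 <= k x. *)
pose k := 1 + (Num.max 1 M) `^ (p0 - 1).
have k0 : 0 < k by rewrite ltr_pwDl// powR_ge0.
have ek : 0 < e / k by rewrite divr_gt0.
have /cvgrPdist_lt/(_ _ ek)[T1 [_ hT1]] := ap.
have /cvgrPdist_lt/(_ _ ek)[T2 [_ hT2]] := am.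
exists (Num.max T1 (- T2)) => t x; rewrite gt_max => /andP[tT1 tT2] x0 xM.
have at_e : `|a t| <= e / k.
  have [t0|t0] := leP 0 t.
    rewrite ger0_norm// in tT1; have := hT1 t tT1.
    by rewrite /= sub0r normrN => /ltW.
  rewrite (ltr0_norm t0) in tT2; have := hT2 t; rewrite /= sub0r normrN.
  by move=> hh; apply: ltW; apply: hh; rewrite -ltrN2.
have [_ h2] := h t x; apply: le_trans h2 _; rewrite ger0_norm//.
have xp : x + x `^ p0 <= k * x.
  rewrite -(mulr_powRB1 x0); last by lra.
  rewrite /k mulrDl mul1r lerD2l mulrC ler_wpM2r//.
  by apply: ge0_ler_powR; rewrite ?nnegrE ?le_max ?ler01 ?xM ?orbT//; lra.
have s0 : 0 <= x + x `^ p0 by rewrite addr_ge0// powR_ge0.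
apply: (@le_trans _ _ (e / k * (x + x `^ p0))).
  by rewrite ler_wpM2r//; apply: le_trans (ler_norm _) at_e.
rewrite mulrAC ler_pdivrMr// -mulrA ler_wpM2l ?(ltW e0)// mulrC//.
Qed.

(** Every element of the completion is, up to a null set, an element of the energy
    space. *)
Lemma critical_weak_solution (alpha : R) f (F : R -> R -> R) (theta : R) w :
  1 / 2 < alpha -> alpha < 1 -> nonlin f F theta -> Hs alpha w ->
  (forall phi, Hs alpha phi -> ip alpha w phi = IR (fun t => f t (w t) * phi t)) ->
  weak_solution alpha f w.
Proof.
move=> ag al N hw crit; have X := energy_fspace ag al.
split; first exact: (Hs_Halpha ag al hw).
move=> v hv; have [dv [v' hv' [vv' Dvv']]] := Halpha_Hs ag al hv.
have [sw sDw] := Dom_sq (Hs_Dom hw); have [sv sDv] := Dom_sq dv.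
have [sv' sDv'] := Dom_sq (Hs_Dom hv').
have sfw := sq_fu X N hw.
have i1 := sq_mul sDw sDv; have i2 := sq_mul sw sv.
split; [exact: igD|exact: sq_mul|].
change (IR (fun t => LWderive alpha w t * LWderive alpha v t + w t * v t) =
  IR (fun t => f t (w t) * v t)).
have := crit _ hv'; rewrite /ip => E.
have E1 : IR (fun t => f t (w t) * v t) = IR (fun t => f t (w t) * v' t).
  apply: I_ae; [exact: ig_meas (sq_mul sfw sv)|exact: ig_meas (sq_mul sfw sv')|].
  by apply: aeS vv' => x ->.
have E2 : IR (fun t => w t * v t) = IR (fun t => w t * v' t).
  apply: I_ae; [exact: ig_meas i2|exact: ig_meas (sq_mul sw sv')|].
  by apply: aeS vv' => x ->.
have E3 : IR (fun t => LWderive alpha w t * LWderive alpha v t) =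
    IR (fun t => LWderive alpha w t * LWderive alpha v' t).
  apply: I_ae; [exact: ig_meas i1|exact: ig_meas (sq_mul sDw sDv')|].
  by apply: aeS Dvv' => x ->.
by rewrite ID// E1 E2 E3 addrC.
Qed.

End instances.

Unset Implicit Arguments.

Theorem theorem1p2 (R : realType) (alpha theta p0 : R) (f : R -> R -> R)
    (halpha : 1 / 2 < alpha /\ alpha < 1)
    (hf : continuous (fun z : R * R => f z.1 z.2))
    (htheta : 2 < theta) (hp0 : theta < p0 + 1)
    (hf0 : cond_f0 f)
    (hf1 : cond_f1 theta f)
    (hf2 : cond_f2 f)
    (hf3 : cond_f3 p0 f)
    (hf4 : cond_f4 f)
    (hf5 : cond_f5 theta p0 f) :
  exists u : R -> R,
    weak_solution alpha f u /\ ~ {ae leb R, forall t, u t = 0}.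
Proof.
have [ag al] := halpha.
have f04 : cond_f04 theta p0 f by [].
have [fb [a [[cfb ca] fb04 fa [ap am] _]]] := hf5.
have X := energy_fspace ag al.
have N := cond_nonlin htheta hf f04.
have cfb2 : continuous (fun z : R * R => fb z.2).
  move=> z; apply: (cvg_comp _ _ (@cvg_snd _ _ (nbhs z.1) (nbhs z.2) _)); exact: cfb.
have Nb := cond_nonlin htheta cfb2 fb04.
have A : asymptotic f (fun _ => fb) by apply: (cond_asymptotic _ fa ap am); lra.
have [w nw wmin] := nehari_minimizer X N Nb A (fun _ _ => erefl) (fun _ _ => erefl).
have [hw _ [x0 wx]] := nw.
exists w; split.
  apply: (critical_weak_solution ag al N hw) => phi hp.
  exact: (nehari_critical X N nw wmin hp).
move=> w0; have cw := fs_cont X hw.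
have P0 : 0 < IR (fun t => w t ^+ 2).
  apply: (@I_gt0 _ _ x0); [|exact: (fs_L2 X hw).1.2| |exact: exprn_gt0].
    have c2 : continuous (fun t => w t * w t) by move=> t; apply: cvgM; exact: cw.
    exact: c2.
  by move=> t; exact: sqr_ge0.
have E : IR (fun t => w t ^+ 2) = IR (fun _ : R => 0 : R).
  apply: I_ae; [exact: ig_meas (fs_L2 X hw).1.2|exact: measurable_cst|].
  by apply: aeS w0 => t ->; rewrite expr0n.
by move: P0; rewrite E I0 ltxx.
Qed.
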